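(* Let $\mathbb{G}$ be a discrete $C^{*}$-quantum group and let $\delta_C$ be a counital partial coaction of $C_0(\mathbb{G})$ on a $C^{*}$-algebra $C$. Then there exists a unique unital $*$-homomorphism $\pi\colon C(\mathbb{B}_{\mathbb{G}}^{\varepsilon})\to M(C)$ such that $$(\pi\otimes\mathrm{id})(p(p_\varepsilon\otimes 1))=\delta_C(1_C),$$ and this $\pi$ is a strong morphism of partial coactions (from $\delta^{\varepsilon}$ to $\delta_C$), that is, $(\pi\otimes\mathrm{id})\circ\delta^{\varepsilon}=\delta_C\circ\pi$.
   Context: Tensor products of $C^{*}$-algebras are minimal; $M(A)$ is the multiplier algebra. A $C^{*}$-bialgebra is a $C^{*}$-algebra $A$ with a nondegenerate coassociative $*$-homomorphism $\Delta\colon A\to M(A\otimes A)$. A discrete $C^{*}$-quantum group $\mathbb{G}=(C_0(\mathbb{G}),\Delta)$ is the dual of a compact $C^{*}$-quantum group (a unital $C^{*}$-bialgebra satisfying the density/cancellation conditions); $C_0(\mathbb{G})$ is a $c_0$-direct sum of matrix algebras and has a counit $\varepsilon$, i.e. a character with $(\varepsilon\otimes\mathrm{id})\Delta=\mathrm{id}=(\mathrm{id}\otimes\varepsilon)\Delta$. A $*$-homomorphism $\pi\colon B\to M(C)$ is strict if it is strictly continuous on the unit ball; it then extends to $M(B)$. A partial coaction of $(A,\Delta)$ on $C$ is a strict $*$-homomorphism $\delta\colon C\to M(C\otimes A)$ with $\delta(C)(1_C\otimes A)\subseteq C\otimes A$ and $(\delta\otimes\mathrm{id}_A)\delta(c)=(\delta(1_C)\otimes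 1_A)(\mathrm{id}_C\otimes\Delta)\delta(c)$ for all $c\in C$; it is counital if $(\mathrm{id}_C\otimes\varepsilon)\circ\delta=\mathrm{id}$. A strong morphism from a partial coaction $\delta_B$ on $B$ to a partial coaction $\delta_C$ on $C$ is a strict $*$-homomorphism $\pi\colon B\to M(C)$ with $(\pi\otimes\mathrm{id}_A)\delta_B(b)=\delta_C(\pi(b))$ for all $b\in B$. For a $C^{*}$-algebra $C$, a projection $q\in M(C\otimes C_0(\mathbb{G}))$ is admissible if $(q\otimes 1)\cdot(\mathrm{id}\otimes\Delta)(q)=(\mathrm{id}\otimes\Delta)(q)\cdot(q\otimes 1)$. $C(\mathbb{B}_{\mathbb{G}})$ is the unital $C^{*}$-algebra with an admissible projection $p\in M(C(\mathbb{B}_{\mathbb{G}})\otimes C_0(\mathbb{G}))$ that is universal: for every $C^{*}$-algebra $C$ and admissible projection $q\in M(C\otimes C_0(\mathbb{G}))$ there is a unique unital $*$-homomorphism $\pi\colon C(\mathbb{B}_{\mathbb{G}})\to M(C)$ with $q=(\pi\otimes\mathrm{id})(p)$. There is a unique coaction $\delta\colon C(\mathbb{B}_{\mathbb{G}})\to M(C(\mathbb{B}_{\mathbb{G}})\otimes C_0(\mathbb{G}))$ (a unital $*$-homomorphism with $(\delta\otimes\mathrm{id})\delta=(\mathrm{id}\otimes\Delta)\delta$) such that $(\delta\otimes\mathrm{id})(p)=(\mathrm{id}\otimes\Delta)(p)$. The projection $p_\varepsilon:=(\mathrm{id}\otimes\varepsilon)(p)\in C(\mathbb{B}_{\mathbb{G}})$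 is central. Put $C(\mathbb{B}_{\mathbb{G}}^{\varepsilon}):=p_\varepsilon C(\mathbb{B}_{\mathbb{G}})$. The partial Bernoulli action is the partial coaction $\delta^{\varepsilon}$ of $C_0(\mathbb{G})$ on $C(\mathbb{B}_{\mathbb{G}}^{\varepsilon})$ given by $\delta^{\varepsilon}(b)=\delta(b)(p_\varepsilon\otimes 1)$. *)

(* Defs.v *)
From HB Require Import structures.
From mathcomp Require Import all_boot all_order all_algebra.
From mathcomp Require Import complex.
From mathcomp Require Import all_classical all_reals topology normedtype.

Set Implicit Arguments.
Unset Strict Implicit.
Unset Printing Implicit Defensive.

Import Order.TTheory GRing.Theory Num.Theory.
Import numFieldNormedType.Exports.

Local Open Scope classical_set_scope.
Local Open Scope ring_scope.
Local Open Scope complex_scope.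

(* C*-algebras need not have a unit, so the product cannot come from the ring
   hierarchy of the library. *)
Record cstarAlgebra (R : realType) := CstarAlgebra {
  cs_sort :> completeNormedModType R[i];
  cs_mul : cs_sort -> cs_sort -> cs_sort;
  star : cs_sort -> cs_sort;
  cs_mulA : forall x y z, cs_mul x (cs_mul y z) = cs_mul (cs_mul x y) z;
  cs_mulDl : forall x y z, cs_mul (x + y) z = cs_mul x z + cs_mul y z;
  cs_mulDr : forall x y z, cs_mul x (y + z) = cs_mul x y + cs_mul x z;
  cs_scaleAl : forall (k : R[i]) x y, cs_mul (k *: x) y = k *: cs_mul x y;
  cs_scaleAr : forall (k : R[i]) x y, cs_mul x (k *: y) = k *: cs_mul x y;
  starK : forall x, star (star x) = x;
  starD : forall x y, star (x + y) = star x + star y;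
  starZ : forall (k : R[i]) x, star (k *: x) = conjc k *: star x;
  starM : forall x y, star (cs_mul x y) = cs_mul (star y) (star x);
  cs_normM : forall x y, `|cs_mul x y| <= `|x| * `|y|;
  cs_norm_star : forall x, `|cs_mul (star x) x| = `|x| ^+ 2 }.

Notation "x ** y" := (cs_mul x y) (at level 40, left associativity).

Definition is_unit_elt (R : realType) (A : cstarAlgebra R) (e : A) : Prop :=
  forall a, e ** a = a /\ a ** e = a.

Definition is_unital (R : realType) (A : cstarAlgebra R) : Prop :=
  exists e : A, is_unit_elt e.

Definition lspan (R : realType) (A : cstarAlgebra R) (S : set A) : set A :=
  [set x | exists n (c : 'I_n -> R[i]) (s : 'I_n -> A),
     (forall i, S (s i)) /\ x = \sum_(i < n) c i *: s i].

(* Busby's double centralizers: [lact m a] is m a and [ract m a] is a m.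
   Linearity and boundedness of both maps follow from the one identity. *)
Record multiplier (R : realType) (A : cstarAlgebra R) := Multiplier {
  lact : A -> A;
  ract : A -> A;
  multiplierP : forall a b, a ** lact b = ract a ** b }.

Section MultiplierAlgebra.
Context {R : realType} {A : cstarAlgebra R}.
Implicit Types (m n : multiplier A) (a b : A).

Lemma multiplier_ext m n :
  (forall a, lact m a = lact n a) -> (forall a, ract m a = ract n a) -> m = n.
Proof.
case: m n => [l r p] [l' r' p'] /= /funext el /funext er.
by subst l' r'; congr Multiplier; apply: Prop_irrelevance.
Qed.

Lemma cs_mulNl a b : (- a) ** b = - (a ** b).
Proof. by rewrite -scaleN1r cs_scaleAl scaleN1r. Qed.

Lemma cs_mulNr a b : a ** (- b) = - (a ** b).
Proof. by rewrite -scaleN1r cs_scaleAr scaleN1r. Qed.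

Lemma cs_star_eq0 a : star a ** a = 0 -> a = 0.
Proof.
move=> a0; apply/normr0_eq0/eqP.
by rewrite -sqrf_eq0 -cs_norm_star a0 normr0.
Qed.

Lemma cs_lfaithful a b : (forall c, c ** a = c ** b) -> a = b.
Proof.
move=> h; apply/subr0_eq/cs_star_eq0.
by rewrite cs_mulDr cs_mulNr h addrN.
Qed.

Lemma cs_rfaithful a b : (forall c, a ** c = b ** c) -> a = b.
Proof.
move=> h; rewrite -[a]starK -[b]starK; congr star.
by apply: cs_lfaithful => c; rewrite -[c]starK -!starM h.
Qed.

Lemma lactD m a b : lact m (a + b) = lact m a + lact m b.
Proof.
by apply: cs_lfaithful => c; rewrite cs_mulDr !multiplierP cs_mulDr.
Qed.

Lemma ractD m a b : ract m (a + b) = ract m a + ract m b.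
Proof.
by apply: cs_rfaithful => c; rewrite cs_mulDl -!multiplierP cs_mulDl.
Qed.

Lemma mult0_subproof a b : a ** (0 : A) = (0 : A) ** b.
Proof. by rewrite -[in LHS](scale0r a) -(scale0r b) cs_scaleAl cs_scaleAr !scale0r. Qed.
Definition mult0 : multiplier A := @Multiplier R A (fun=> 0) (fun=> 0) mult0_subproof.

Lemma mult_opp_subproof m a b : a ** (- lact m b) = (- ract m a) ** b.
Proof. by rewrite cs_mulNl cs_mulNr multiplierP. Qed.
Definition mult_opp m : multiplier A :=
  @Multiplier R A (fun a => - lact m a) (fun a => - ract m a) (mult_opp_subproof m).

Lemma mult_add_subproof m n a b :
  a ** (lact m b + lact n b) = (ract m a + ract n a) ** b.
Proof. by rewrite cs_mulDl cs_mulDr !multiplierP. Qed.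
Definition mult_add m n : multiplier A :=
  @Multiplier R A (fun a => lact m a + lact n a) (fun a => ract m a + ract n a)
    (mult_add_subproof m n).

Lemma mult1_subproof a b : a ** b = a ** b.
Proof. by []. Qed.
Definition mult1 : multiplier A := @Multiplier R A id id mult1_subproof.

Lemma mult_mul_subproof m n a b :
  a ** lact m (lact n b) = ract n (ract m a) ** b.
Proof. by rewrite !multiplierP. Qed.
Definition mult_mul m n : multiplier A :=
  @Multiplier R A (fun a => lact m (lact n a)) (fun a => ract n (ract m a))
    (mult_mul_subproof m n).

Lemma mult_scale_subproof (k : R[i]) m a b :
  a ** (k *: lact m b) = (k *: ract m a) ** b.
Proof. by rewrite cs_scaleAl cs_scaleAr multiplierP. Qed.
Definition mult_scale (k : R[i]) m : multiplier A :=
  @Multiplier R A (fun a => k *: lact m a) (fun a => k *: ract m a)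
    (mult_scale_subproof k m).

Lemma mstar_subproof m a b :
  a ** star (ract m (star b)) = star (lact m (star a)) ** b.
Proof. by rewrite -[a in LHS]starK -[b in RHS]starK -!starM multiplierP. Qed.
Definition mstar m : multiplier A :=
  @Multiplier R A (fun a => star (ract m (star a))) (fun a => star (lact m (star a)))
    (mstar_subproof m).

Lemma minj_subproof x a b : a ** (x ** b) = (a ** x) ** b.
Proof. exact: cs_mulA. Qed.
Definition minj (x : A) : multiplier A :=
  @Multiplier R A (fun a => x ** a) (fun a => a ** x) (minj_subproof x).

HB.instance Definition _ := gen_eqMixin (multiplier A).
HB.instance Definition _ := gen_choiceMixin (multiplier A).

Lemma mult_addA : associative mult_add.
Proof. by move=> m n p; apply: multiplier_ext => a /=; rewrite addrA. Qed.
Lemma mult_addC : commutative mult_add.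
Proof. by move=> m n; apply: multiplier_ext => a /=; rewrite addrC. Qed.
Lemma mult_add0 : left_id mult0 mult_add.
Proof. by move=> m; apply: multiplier_ext => a /=; rewrite add0r. Qed.
Lemma mult_addN : left_inverse mult0 mult_opp mult_add.
Proof. by move=> m; apply: multiplier_ext => a /=; rewrite addNr. Qed.
HB.instance Definition _ :=
  GRing.isZmodule.Build (multiplier A) mult_addA mult_addC mult_add0 mult_addN.

Lemma mult_mulA : associative mult_mul.
Proof. by move=> m n p; apply: multiplier_ext. Qed.
Lemma mult_mul1l : left_id mult1 mult_mul.
Proof. by move=> m; apply: multiplier_ext. Qed.
Lemma mult_mul1r : right_id mult1 mult_mul.
Proof. by move=> m; apply: multiplier_ext. Qed.
Lemma mult_mulDl : left_distributive mult_mul +%R.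
Proof. by move=> m n p; apply: multiplier_ext => a //=; rewrite ractD. Qed.
Lemma mult_mulDr : right_distributive mult_mul +%R.
Proof. by move=> m n p; apply: multiplier_ext => a //=; rewrite lactD. Qed.
HB.instance Definition _ := GRing.Zmodule_isPzRing.Build (multiplier A)
  mult_mulA mult_mul1l mult_mul1r mult_mulDl mult_mulDr.

Lemma mult_scaleA (k l : R[i]) m :
  mult_scale k (mult_scale l m) = mult_scale (k * l) m.
Proof. by apply: multiplier_ext => a /=; rewrite scalerA. Qed.
Lemma mult_scale1 : left_id 1 mult_scale.
Proof. by move=> m; apply: multiplier_ext => a /=; rewrite scale1r. Qed.
Lemma mult_scaleDr : right_distributive mult_scale +%R.
Proof. by move=> k m n; apply: multiplier_ext => a /=; rewrite scalerDr. Qed.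
Lemma mult_scaleDl m : {morph mult_scale^~ m : k l / k + l}.
Proof. by move=> k l; apply: multiplier_ext => a /=; rewrite scalerDl. Qed.
HB.instance Definition _ := GRing.Zmodule_isLmodule.Build R[i] (multiplier A)
  mult_scaleA mult_scale1 mult_scaleDr mult_scaleDl.

End MultiplierAlgebra.

Definition strict_cvg (R : realType) (A : cstarAlgebra R)
    (F : set_system (multiplier A)) (m : multiplier A) : Prop :=
  forall a : A,
    (fun n => lact n a) @ F --> lact m a /\ (fun n => ract n a) @ F --> ract m a.

(* The C*-norm of a multiplier is the operator norm of its left action. *)
Definition mult_ball (R : realType) (A : cstarAlgebra R) : set (multiplier A) :=
  [set m | forall a : A, `|lact m a| <= `|a|].

Definition star_hom (R : realType) (A B : cstarAlgebra R)
    (f : A -> multiplier B) : Prop :=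
  [/\ linear f,
      forall x y, f (x ** y) = f x * f y &
      forall x, f (star x) = mstar (f x)].

Definition mult_star_hom (R : realType) (A B : cstarAlgebra R)
    (f : multiplier A -> multiplier B) : Prop :=
  [/\ linear f,
      forall x y, f (x * y) = f x * f y &
      forall x, f (mstar x) = mstar (f x)].

Definition unital_hom (R : realType) (A B : cstarAlgebra R)
    (f : A -> multiplier B) : Prop :=
  star_hom f /\ forall e, is_unit_elt e -> f e = 1.

Definition nondegenerate (R : realType) (A B : cstarAlgebra R)
    (f : A -> multiplier B) : Prop :=
  dense (lspan [set y | exists a x, y = lact (f a) x]).

Definition strict_hom (R : realType) (A B : cstarAlgebra R)
    (f : A -> multiplier B) : Prop :=
  star_hom f /\
  forall (F : set_system A) (a : A), Filter F ->
    F [set x | `|x| <= 1] -> `|a| <= 1 ->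
    strict_cvg (minj @ F) (minj a) -> strict_cvg (f @ F) (f a).

Definition mult_strict (R : realType) (A B : cstarAlgebra R)
    (g : multiplier A -> multiplier B) : Prop :=
  forall (F : set_system (multiplier A)) (m : multiplier A), Filter F ->
    F (@mult_ball R A) -> mult_ball m ->
    strict_cvg F m -> strict_cvg (g @ F) (g m).

(* [g] is the (unique) extension to M(A) of the strict *-homomorphism [f]. *)
Definition strict_ext (R : realType) (A B : cstarAlgebra R)
    (f : A -> multiplier B) (g : multiplier A -> multiplier B) : Prop :=
  [/\ mult_star_hom g, mult_strict g & forall a, g (minj a) = f a].

(* [D] is the completion of the algebraic tensor product of [A] and [B] with
   respect to some C*-norm.  The third clause says that the linear map from
   the algebraic tensor product to [D] is injective. *)
Definition is_cstar_tensor (R : realType) (A B D : cstarAlgebra R)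
    (t : A -> B -> D) : Prop :=
  [/\ (forall b, linear (t^~ b)) /\ (forall a, linear (t a)),
      (forall a a' b b', t a b ** t a' b' = t (a ** a') (b ** b')) /\
      (forall a b, star (t a b) = t (star a) (star b)),
      forall n (a : 'I_n -> A) (b : 'I_n -> B),
        (forall c : 'I_n -> R[i],
           \sum_(i < n) c i *: b i = 0 -> forall i, c i = 0) ->
        \sum_(i < n) t (a i) (b i) = 0 -> forall i, a i = 0 &
      dense (lspan [set x | exists a b, x = t a b])].

(* The minimal tensor product is the one given by the least C*-norm, which by
   Takesaki's theorem is the spatial norm. *)
Definition is_min_tensor (R : realType) (A B D : cstarAlgebra R)
    (t : A -> B -> D) : Prop :=
  is_cstar_tensor t /\
  forall (D' : cstarAlgebra R) (t' : A -> B -> D'), is_cstar_tensor t' ->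
    forall n (a : 'I_n -> A) (b : 'I_n -> B),
      `|\sum_(i < n) t (a i) (b i)| <= `|\sum_(i < n) t' (a i) (b i)|.

(* A minimal tensor product is determined up to a unique isomorphism; all
   constructions below are relative to chosen models of it. *)
Record mintensor (R : realType) (A B : cstarAlgebra R) := MinTensor {
  mt_sort :> cstarAlgebra R;
  tens : A -> B -> mt_sort;
  tensP : is_min_tensor tens }.
Arguments tens {R A B} _ _ _.

(* A model of the triple tensor product of [A], [B], [D], both as (A B) D
   through [tens3l] and as A (B D) through [tens3r]. *)
Record mintensor3 (R : realType) (A B D : cstarAlgebra R)
    (AB : mintensor A B) (BD : mintensor B D) := MinTensor3 {
  mt3_sort :> cstarAlgebra R;
  tens3l : AB -> D -> mt3_sort;
  tens3r : A -> BD -> mt3_sort;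
  tens3lP : is_min_tensor tens3l;
  tens3rP : is_min_tensor tens3r;
  tens3A : forall a b d, tens3l (tens AB a b) d = tens3r a (tens BD b d) }.

Definition mt3l (R : realType) (A B D : cstarAlgebra R) (AB : mintensor A B)
    (BD : mintensor B D) (T : mintensor3 AB BD) : mintensor AB D :=
  MinTensor (tens3lP T).

Definition mt3r (R : realType) (A B D : cstarAlgebra R) (AB : mintensor A B)
    (BD : mintensor B D) (T : mintensor3 AB BD) : mintensor A BD :=
  MinTensor (tens3rP T).

(* [k] is the tensor product of the multipliers [m] and [n]. *)
Definition is_mtensor (R : realType) (A B : cstarAlgebra R) (D : mintensor A B)
    (m : multiplier A) (n : multiplier B) (k : multiplier D) : Prop :=
  forall a b, lact k (tens D a b) = tens D (lact m a) (lact n b).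

(* [h] is the strict extension to multiplier algebras of the tensor product of
   [f] and [g]; the identity of A is [minj : A -> multiplier A]. *)
Definition hom_tensor (R : realType) (A1 B1 A2 B2 : cstarAlgebra R)
    (D1 : mintensor A1 B1) (D2 : mintensor A2 B2)
    (f : A1 -> multiplier A2) (g : B1 -> multiplier B2)
    (h : multiplier D1 -> multiplier D2) : Prop :=
  [/\ mult_star_hom h, mult_strict h &
      forall a b, is_mtensor (D := D2) (f a) (g b) (h (minj (tens D1 a b)))].

Definition is_character (R : realType) (A : cstarAlgebra R) (w : A -> R[i]) : Prop :=
  [/\ (forall k x y, w (k *: x + y) = k * w x + w y),
      (forall x y, w (x ** y) = w x * w y),
      (forall x, w (star x) = conjc (w x)) &
      exists x, w x != 0].

(* [h] is the strict extension of (id (x) w), resp. (w (x) id), where the tensor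
   product of an algebra with the complex numbers is that algebra. *)
Definition slice_r (R : realType) (A B : cstarAlgebra R) (D : mintensor A B)
    (w : B -> R[i]) (h : multiplier D -> multiplier A) : Prop :=
  [/\ mult_star_hom h, mult_strict h &
      forall a b, h (minj (tens D a b)) = minj (w b *: a)].

Definition slice_l (R : realType) (A B : cstarAlgebra R) (D : mintensor A B)
    (w : A -> R[i]) (h : multiplier D -> multiplier B) : Prop :=
  [/\ mult_star_hom h, mult_strict h &
      forall a b, h (minj (tens D a b)) = minj (w a *: b)].

Record cstarBialgebra (R : realType) := CstarBialgebra {
  bi_alg :> cstarAlgebra R;
  bi_sq : mintensor bi_alg bi_alg;
  bi_cube : mintensor3 bi_sq bi_sq;
  comul : bi_alg -> multiplier bi_sq;
  comul_hom : star_hom comul;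
  comul_nondegenerate : nondegenerate comul;
  comul_coassoc :
    exists d1 d2 : multiplier bi_sq -> multiplier bi_cube,
      [/\ hom_tensor (D1 := bi_sq) (D2 := mt3l bi_cube) comul minj d1,
          hom_tensor (D1 := bi_sq) (D2 := mt3r bi_cube) minj comul d2 &
          forall a, d1 (comul a) = d2 (comul a)] }.

(* As the algebra is unital, 1 (x) b and b (x) 1 are the elements
   [tens _ e b] and [tens _ b e] of the tensor square itself. *)
Record compactQuantumGroup (R : realType) := CompactQuantumGroup {
  cq_bi :> cstarBialgebra R;
  cq_one : cq_bi;
  cq_oneP : is_unit_elt cq_one;
  cq_cancel1 : dense (lspan
    [set y | exists a b, y = lact (comul a) (tens (bi_sq cq_bi) cq_one b)]);
  cq_cancel2 : dense (lspan
    [set y | exists a b, y = lact (comul a) (tens (bi_sq cq_bi) b cq_one)]) }.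

Section Corepresentations.
Context {R : realType} (K : compactQuantumGroup R).

Definition unitary_corep n (u : 'M[K]_n) : Prop :=
  [/\ forall i j, comul (u i j) =
        minj (\sum_(k < n) tens (bi_sq K) (u i k) (u k j)),
      forall i j, \sum_(k < n) star (u k i) ** u k j = (i == j)%:R *: cq_one K &
      forall i j, \sum_(k < n) u i k ** star (u j k) = (i == j)%:R *: cq_one K].

(* T u = v T *)
Definition intertwiner n m (u : 'M[K]_n) (v : 'M[K]_m) (T : 'M[R[i]]_(m, n)) : Prop :=
  forall i j, \sum_(k < n) T i k *: u k j = \sum_(k < m) T k j *: v i k.

Definition irreducible_corep n (u : 'M[K]_n) : Prop :=
  [/\ (0 < n)%N, unitary_corep u &
      forall T, intertwiner u u T -> exists c, T = c%:M].

Definition equivalent_corep n m (u : 'M[K]_n) (v : 'M[K]_m) : Prop :=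
  exists (T : 'M[R[i]]_(m, n)) (S : 'M[R[i]]_(n, m)),
    [/\ intertwiner u v T, T *m S = 1%:M & S *m T = 1%:M].

(* [u] lists the irreducible unitary corepresentations, one for each
   equivalence class. *)
Definition complete_irreps (I : Type) (n : I -> nat)
    (u : forall x : I, 'M[K]_(n x)) : Prop :=
  (forall x, irreducible_corep (u x)) /\
  (forall m (v : 'M[K]_m), irreducible_corep v ->
     exists! x, equivalent_corep (u x) v).

End Corepresentations.

(* [A] is the c_0-direct sum of the full matrix algebras of sizes [n x], with
   matrix units [E x i j]. *)
Definition c0_sum_of_matrices (R : realType) (A : cstarAlgebra R) (I : Type)
    (n : I -> nat) (E : forall x : I, 'I_(n x) -> 'I_(n x) -> A) : Prop :=
  [/\ forall x i j k l, E x i j ** E x k l = (j == k)%:R *: E x i l,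
      forall x y i j k l, x <> y -> E x i j ** E y k l = 0,
      forall x i j, star (E x i j) = E x j i,
      forall x i j, E x i j <> 0 &
      dense (lspan [set a | exists x i j, a = E x i j])].

(* [A] is the dual of [K]: it is the c_0-direct sum of the matrix algebras
   belonging to the irreducible unitary corepresentations u^x of [K], and the
   unitary W = sum_(x,k,l) E^x_kl (x) u^x_kl in M(A (x) K) satisfies
   (Delta_A (x) id)(W) = W_13 W_23. *)
Definition is_dual (R : realType) (A : cstarBialgebra R)
    (K : compactQuantumGroup R) : Prop :=
  exists (I : Type) (n : I -> nat) (u : forall x : I, 'M[K]_(n x))
         (E : forall x : I, 'I_(n x) -> 'I_(n x) -> A),
  [/\ complete_irreps u, c0_sum_of_matrices E &
  exists (AK : mintensor A K) (AAK : mintensor3 (bi_sq A) AK) (W : multiplier AK)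
         (iota1 : A -> multiplier (bi_sq A))
         (d l13 : multiplier AK -> multiplier AAK) (W23 : multiplier AAK),
    [/\ forall x i j b, lact W (tens AK (E x i j) b) =
          \sum_(k < n x) tens AK (E x k j) (u x k i ** b),
        forall a, is_mtensor (D := bi_sq A) (minj a) 1 (iota1 a),
        hom_tensor (D1 := AK) (D2 := mt3l AAK) (@comul R A) minj d /\
        hom_tensor (D1 := AK) (D2 := mt3l AAK) iota1 minj l13,
        is_mtensor (D := mt3r AAK) 1 W W23 &
        d W = l13 W * W23]].

Record discreteQuantumGroup (R : realType) := DiscreteQuantumGroup {
  dq_bi :> cstarBialgebra R;
  dq_dual : exists K : compactQuantumGroup R, is_dual dq_bi K }.

Definition is_counit (R : realType) (A : cstarBialgebra R) (eps : A -> R[i]) : Prop :=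
  is_character eps /\
  exists hl hr : multiplier (bi_sq A) -> multiplier A,
    [/\ slice_l eps hl, slice_r eps hr &
        forall a, hl (comul a) = minj a /\ hr (comul a) = minj a].

Section PartialCoactions.
Context {R : realType} (A : cstarBialgebra R).

(* [dbar] is the extension of [d] to M(C); it is needed for d(1_C). *)
Definition partial_coaction (C : cstarAlgebra R) (CA : mintensor C A)
    (CAA : mintensor3 CA (bi_sq A)) (d : C -> multiplier CA)
    (dbar : multiplier C -> multiplier CA) : Prop :=
  [/\ strict_hom d, strict_ext d dbar,
      forall c a, exists (k : multiplier CA) (y : CA),
        is_mtensor 1 (minj a) k /\ d c * k = minj y &
      exists (d_id id_D : multiplier CA -> multiplier CAA) (k : multiplier CAA),
        [/\ hom_tensor (D1 := CA) (D2 := mt3l CAA) d minj d_id,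
            hom_tensor (D1 := CA) (D2 := mt3r CAA) minj (@comul R A) id_D,
            is_mtensor (D := mt3l CAA) (dbar 1) 1 k &
            forall c, d_id (d c) = k * id_D (d c)]].

Definition counital (C : cstarAlgebra R) (CA : mintensor C A) (eps : A -> R[i])
    (d : C -> multiplier CA) : Prop :=
  exists h, slice_r eps h /\ forall c, h (d c) = minj c.

(* (pi (x) id)(x) = y *)
Definition leg1_maps (B C : cstarAlgebra R) (BA : mintensor B A)
    (CA : mintensor C A) (pi : B -> multiplier C)
    (x : multiplier BA) (y : multiplier CA) : Prop :=
  exists h, hom_tensor pi minj h /\ h x = y.

(* [dCbar] is the extension to M(C) of the partial coaction on C. *)
Definition strong_morphism (B C : cstarAlgebra R) (BA : mintensor B A)
    (CA : mintensor C A) (dB : B -> multiplier BA)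
    (dCbar : multiplier C -> multiplier CA) (pi : B -> multiplier C) : Prop :=
  strict_hom pi /\
  exists h, hom_tensor pi minj h /\ forall b, h (dB b) = dCbar (pi b).

Definition admissible (C : cstarAlgebra R) (CA : mintensor C A)
    (CAA : mintensor3 CA (bi_sq A)) (q : multiplier CA) : Prop :=
  [/\ q * q = q, mstar q = q &
      exists (id_D : multiplier CA -> multiplier CAA) (q1 : multiplier CAA),
        [/\ hom_tensor (D1 := CA) (D2 := mt3r CAA) minj (@comul R A) id_D,
            is_mtensor (D := mt3l CAA) q 1 q1 &
            q1 * id_D q = id_D q * q1]].

(* Admissibility does not depend on the model [CAA] of the triple tensor
   product, and such a model always exists. *)
Definition universal_admissible (B : cstarAlgebra R) (BA : mintensor B A)
    (BAA : mintensor3 BA (bi_sq A)) (p : multiplier BA) : Prop :=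
  [/\ is_unital B, admissible BAA p &
      forall (C : cstarAlgebra R) (CA : mintensor C A) (q : multiplier CA),
        (forall CAA : mintensor3 CA (bi_sq A), admissible CAA q) ->
        exists! pi : B -> multiplier C, unital_hom pi /\ leg1_maps pi p q].

(* The coaction [d] on the universal algebra for which (d (x) id)(p) equals
   (id (x) Delta)(p). *)
Definition bernoulli_coaction (B : cstarAlgebra R) (BA : mintensor B A)
    (BAA : mintensor3 BA (bi_sq A)) (p : multiplier BA)
    (d : B -> multiplier BA) : Prop :=
  unital_hom d /\
  exists d_id id_D : multiplier BA -> multiplier BAA,
    [/\ hom_tensor (D1 := BA) (D2 := mt3l BAA) d minj d_id,
        hom_tensor (D1 := BA) (D2 := mt3r BAA) minj (@comul R A) id_D,
        forall b, d_id (d b) = id_D (d b) &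
        d_id p = id_D p].

(* [inc] identifies the C*-algebra [Be] with the ideal pe B of [B]. *)
Definition is_corner (B Be : cstarAlgebra R) (pe : B) (inc : Be -> B) : Prop :=
  [/\ star_hom (fun b => minj (inc b)), injective inc &
      range inc = [set pe ** b | b in [set: B]]].

(* In terms of the inclusion J of M(pe B (x) A) in M(B (x) A) induced by [inc]:
   [P] is p (pe (x) 1), and [de] maps b to d(b) (pe (x) 1). *)
Definition partial_bernoulli (B Be : cstarAlgebra R) (BA : mintensor B A)
    (BeA : mintensor Be A) (p : multiplier BA) (d : B -> multiplier BA)
    (pe : B) (inc : Be -> B) (P : multiplier BeA) (de : Be -> multiplier BeA) : Prop :=
  exists (J : multiplier BeA -> multiplier BA) (pe1 : multiplier BA),
    [/\ hom_tensor (fun b => minj (inc b)) minj J,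
        is_mtensor (minj pe) 1 pe1,
        J P = p * pe1 &
        forall b, J (de b) = d (inc b) * pe1].

End PartialCoactions.

(* Main.v *)
(** Write q for the multiplier deltaC(1) of C (x) G, and k for q (x) 1.  The coaction
    identity extends strictly to the unit, (deltaC (x) id)(q) = k (id (x) Delta)(q); as the
    left-hand side is self-adjoint the two factors commute, so q is admissible and the
    universal property gives rho : B -> M(C) with (rho (x) id)(p) = q.  Slicing with the
    counit gives rho(p_eps) = 1, so pi is the restriction of rho to the corner.

    For the intertwining property put sigma = (rho (x) id) delta : B -> M(C (x) G), whose
    amplification sends p to q' = (id (x) Delta)(q).  Conjugating by the unitary 2q - 1 does
    not change q', so by uniqueness sigma(b) commutes with q; then
    deltaC(rho(b)) + (1 - q) sigma(b) is another unital homomorphism whose amplification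
    sends p to k q' + (1 - k) q' = q', hence equals sigma(b), that is,
    deltaC(rho(b)) = q sigma(b).  Finally sigma(p_eps) = q, again by the counit.

    All amplifications f (x) id that are needed exist because the function algebra of a
    discrete quantum group is a c_0-sum of matrix algebras: a commuting pair of
    homomorphisms of A and G is defined on each block A (x) M_n, where a crude bound in
    terms of matrix coefficients is improved to a contractive one by the C*-identity.
    The required C*-theory (contractivity of homomorphisms, boundedness below of injective
    ones, approximate units) is obtained from square roots alone, without spectral theory:
    if h is a self-adjoint contraction and (1 - y)^2 = 1 - h^2, then h + i (1 - y) is
    unitary. *)

Require Import Defs.
From mathcomp Require Import all_boot all_order all_algebra.
From mathcomp Require Import complex.
From mathcomp Require Import all_classical all_reals topology normedtype.
From mathcomp Require Import sequences.
From mathcomp Require Import ring lra.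

Set Implicit Arguments.
Unset Strict Implicit.
Unset Printing Implicit Defensive.

Import Order.TTheory GRing.Theory Num.Theory.
Import numFieldNormedType.Exports.

Local Open Scope classical_set_scope.
Local Open Scope ring_scope.
Local Open Scope complex_scope.

(** * Norms, limits and density *)

(** The universal property compares unital homomorphisms only, whereas deltaC composed with rho
    sends 1 to q. The corner 1 - q therefore has to be filled with (1 - q) sigma, and the sum is
    multiplicative because sigma commutes with q; this is the purpose of the conjugation by 2q - 1.
    Both comparisons take place over the algebra C (x) G, with q' as admissible projection, so the
    universal property is applied to a target that is itself a tensor product. A least C*-norm
    characterises the minimal tensor product, but does not by itself extend f (x) id beyond
    elementary tensors. On finite sums of blocks the map is kept as a relation until it is known to
    be contractive, which settles well-definedness at the same time. Any bound, however poor, is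
    enough there: the C*-identity replaces a constant C by its 2^k-th root for every k. *)

Section RealNorm.
Context {R : realType} {V : normedModType R[i]}.
Implicit Types (x y : V) (T : Type).

(* The norm of a complex normed space takes its values in [R[i]], whose order
   is partial; [nr] is the same number seen in [R]. *)
Definition nr x : R := complex.Re `|x|.

Lemma nrE x : `|x| = (nr x)%:C.
Proof. by rewrite /nr RRe_real// normr_real. Qed.

Lemma nr_ge0 x : 0 <= nr x.
Proof. by rewrite -ler0c -nrE. Qed.

Lemma nr0 : nr 0 = 0.
Proof. by apply: complexI; rewrite -nrE normr0. Qed.

Lemma nr_eq0 x : nr x = 0 -> x = 0.
Proof. by move=> x0; apply: normr0_eq0; rewrite nrE x0. Qed.

Lemma nrN x : nr (- x) = nr x.
Proof. by rewrite /nr normrN. Qed.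

Lemma nrB x y : nr (x - y) = nr (y - x).
Proof. by rewrite /nr distrC. Qed.

Lemma nrD x y : nr (x + y) <= nr x + nr y.
Proof. by rewrite -lecR rmorphD/= -!nrE ler_normD. Qed.

Lemma nrDB x y z : nr (x - z) <= nr (x - y) + nr (y - z).
Proof. by apply: le_trans (nrD _ _); rewrite addrA subrK. Qed.

Lemma nr_le_dist x y : nr x <= nr y + nr (x - y).
Proof. by apply: le_trans (nrD _ _); rewrite addrC subrK. Qed.

Lemma nrZ (k : R[i]) x : nr (k *: x) = complex.Re `|k| * nr x.
Proof.
apply: complexI; rewrite -nrE normrZ nrE [RHS]rmorphM/=.
by rewrite RRe_real// normr_real.
Qed.

Lemma nrZr (t : R) x : nr (t%:C *: x) = `|t| * nr x.
Proof. by rewrite nrZ normc_def/= expr0n addr0 sqrtr_sqr. Qed.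

Lemma cvg_nrP T (F : set_system T) (f : T -> V) (y : V) {FF : Filter F} :
  f @ F --> y <-> forall e : R, 0 < e -> F [set t | nr (y - f t) < e].
Proof.
split=> [/cvgrPdist_lt h e e0|h].
  have := h e%:C; rewrite ltcR => /(_ e0).
  by apply: filterS => t /=; rewrite nrE ltcR.
apply/cvgrPdist_lt => e e0.
have eR : e = (complex.Re e)%:C by rewrite RRe_real// gtr0_real.
have := h (complex.Re e); rewrite -ltcR -eR => /(_ e0).
by apply: filterS => t /=; rewrite nrE eR ltcR.
Qed.

Lemma cvg_uniq T (F : set_system T) (f : T -> V) (y z : V) {FF : ProperFilter F} :
  f @ F --> y -> f @ F --> z -> y = z.
Proof. exact: norm_cvg_unique. Qed.

Lemma cvg_congr T (F : set_system T) (f g : T -> V) (y : V) :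
  (forall t, g t = f t) -> f @ F --> y -> g @ F --> y.
Proof. by move=> /funext ->. Qed.

Lemma nr_cvg_le T (F : set_system T) (f : T -> V) (y : V) (K : R) {FF : ProperFilter F} :
  f @ F --> y -> F [set t | nr (f t) <= K] -> nr y <= K.
Proof.
move=> /cvg_nrP h hK; apply/ler_addgt0Pr => e e0.
have [t [/= h1 h2]] := @filter_ex _ _ FF _ (filterI (h e e0) hK).
rewrite (le_trans (nr_le_dist y (f t)))// lerD//; exact: ltW.
Qed.

End RealNorm.

Lemma cvg_dom (R : realType) (V W : normedModType R[i]) T (F : set_system T)
    (f : T -> V) (y : V)
    (g : T -> W) (z : W) (K : R) {FF : Filter F} : g @ F --> z ->
  F [set t | nr (y - f t) <= K * nr (z - g t)] -> f @ F --> y.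
Proof.
move=> /cvg_nrP h hK; apply/cvg_nrP => e e0.
have K0 : 0 < `|K| + 1 by rewrite ltr_wpDl.
have e1 : 0 < e / (`|K| + 1) by rewrite divr_gt0.
apply: filterS2 (h _ e1) hK => t /= ht hk; apply: (le_lt_trans hk).
rewrite ltr_pdivlMr// in ht.
apply: (le_lt_trans _ ht); rewrite [leRHS]mulrC.
by apply: ler_wpM2r; [exact: nr_ge0|have := ler_norm K; lra].
Qed.

Section Completeness.
Context {R : realType} {V : completeNormedModType R[i]}.

Lemma nr_complete (T : Type) (F : set_system T) (f : T -> V) {FF : ProperFilter F} :
  (forall e : R, 0 < e -> exists x, F [set t | nr (x - f t) < e]) ->
  exists y : V, f @ F --> y.
Proof.
move=> h.
suff : cvg (f @ F) by move=> h'; exists (lim (f @ F)).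
apply: cauchy_cvg; apply: cauchy_exP => e e0.
have eR : e = (complex.Re e)%:C by rewrite RRe_real// gtr0_real.
have := h (complex.Re e); rewrite -ltcR -eR => /(_ e0) [x hx]; exists x.
rewrite -ball_normE; apply: (@filterS _ F _ _ _ _ hx) => t /=.
by rewrite nrE eR ltcR.
Qed.

Lemma nr_cauchy (f : nat -> V) (e : nat -> R) :
  e @ \oo --> (0 : R) ->
  (forall n m, (n <= m)%N -> nr (f n - f m) <= e n) ->
  exists y : V, f @ \oo --> y /\ forall n, nr (f n - y) <= e n.
Proof.
move=> e0 h.
have [y fy] : exists y : V, f @ \oo --> y.
  apply: nr_complete => d d0.
  move/cvgrPdist_lt : e0 => /(_ d d0) [N _ hN].
  exists (f N); exists N => // n /= Nn.
  apply: le_lt_trans (h _ _ Nn) _.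
  have := hN N (leqnn N); rewrite sub0r normrN; apply: le_lt_trans.
  exact: ler_norm.
exists y; split=> // n.
rewrite nrB; apply: (nr_cvg_le (F := \oo) (f := fun m => f m - f n)).
  by apply: cvgB => //; apply: cvg_cst.
by exists n => // m /= nm; rewrite nrB; exact: h.
Qed.

End Completeness.

Section Density.
Context {R : realType}.

Definition subspace (V : lmodType R[i]) (P : set V) :=
  P 0 /\ forall (k : R[i]) x y, P x -> P y -> P (k *: x + y).

Lemma subspace_sum (V : lmodType R[i]) (P : set V) (I : Type) (r : seq I)
    (F : I -> V) : subspace P -> (forall i, P (F i)) -> P (\sum_(i <- r) F i).
Proof.
move=> [P0 PD] h; elim/big_rec : _ => // i x _ Px.
by rewrite -[F i]scale1r; apply: PD.
Qed.

Lemma lspan_subspace (A : cstarAlgebra R) (S P : set A) :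
  subspace P -> (forall x, S x -> P x) -> forall x, lspan S x -> P x.
Proof.
move=> sP SP x [n [c [s [hs ->]]]].
apply: subspace_sum => // i.
by rewrite -[_ *: _]addr0; apply: sP.2; [apply: SP|apply: sP.1].
Qed.

Lemma subset_lspan (A : cstarAlgebra R) (S : set A) : S `<=` lspan S.
Proof.
move=> x Sx; exists 1%N, (fun=> 1), (fun=> x); split=> //.
by rewrite big_ord1 scale1r.
Qed.

Lemma dense_near (A : cstarAlgebra R) (S : set A) : dense S <->
  forall x (e : R), 0 < e -> exists2 y, S y & nr (x - y) < e.
Proof.
split=> [dS x e e0|h O [x Ox] oO].
  have [] := dS (ball x e%:C).
  - by exists x; apply: ballxx; rewrite ltcR.
  - exact: ball_open.
  - move=> y [+ Sy]; rewrite -ball_normE/= nrE ltcR => xy.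
    by exists y.
have /nbhs_ballP[/= e e0] : nbhs x O by apply: open_nbhs_nbhs; split.
have eR : e = (complex.Re e)%:C by rewrite RRe_real// gtr0_real.
move: e0; rewrite eR ltcR => e0 sub.
have [y Sy xy] := h x _ e0; exists y; split=> //; apply: sub.
by rewrite -ball_normE/= nrE ltcR.
Qed.

Definition nclosed (A : normedModType R[i]) (P : set A) :=
  forall x, (forall e : R, 0 < e -> exists2 y, P y & nr (x - y) < e) -> P x.

Lemma nclosed_lip (V W : normedModType R[i]) (f : V -> W) (P : set W) (K : R) :
  (forall x y, nr (f x - f y) <= K * nr (x - y)) -> nclosed P ->
  nclosed [set x | P (f x)].
Proof.
move=> lf cP x hx; apply: cP => e e0.
have K0 : 0 < `|K| + 1 by rewrite ltr_wpDl.
have [y Py] := hx (e / (`|K| + 1)) (divr_gt0 e0 K0).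
rewrite ltr_pdivlMr// => xy; exists (f y) => //.
apply: le_lt_trans (lf x y) _; apply: (le_lt_trans _ xy); rewrite mulrC.
by apply: ler_wpM2l; [exact: nr_ge0|have := ler_norm K; lra].
Qed.

Lemma nclosed_set1 (V : normedModType R[i]) (z : V) : nclosed [set z].
Proof.
move=> x hx; apply/eqP; rewrite -subr_eq0; apply/eqP/nr_eq0.
apply/le_anti; rewrite nr_ge0 andbT; apply/ler_addgt0Pr => e e0.
by have [y ->] := hx e e0; rewrite add0r => /ltW.
Qed.

Lemma nclosed_eq (V W : normedModType R[i]) (f g : V -> W) (K L : R) :
  (forall x y, nr (f x - f y) <= K * nr (x - y)) ->
  (forall x y, nr (g x - g y) <= L * nr (x - y)) ->
  nclosed [set x | f x = g x].
Proof.
move=> hf hg.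
have lip x y : nr ((f x - g x) - (f y - g y)) <= (K + L) * nr (x - y).
  rewrite opprD addrACA mulrDl; apply: le_trans (nrD _ _) _.
  by apply: lerD => //; rewrite -opprD nrN.
have cl := nclosed_lip lip (@nclosed_set1 _ 0).
move=> x hx; apply/eqP; rewrite -subr_eq0; apply/eqP; apply: cl => e e0.
by have [y hy xy] := hx e e0; exists y => //=; rewrite hy subrr.
Qed.

Lemma dense_ind (A : cstarAlgebra R) (S P : set A) :
  dense (lspan S) -> nclosed P -> subspace P -> (forall x, S x -> P x) ->
  forall x, P x.
Proof.
move=> /dense_near dS cP sP SP x; apply: cP => e e0.
have [y ly xy] := dS x e e0; exists y => //.
exact: (lspan_subspace sP SP).
Qed.

(** The closure of [lspan S] is itself a closed subspace containing [S], so the hypothesis applies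
    to it. Density can thus be proved without approximations, by testing membership in an arbitrary
    closed subspace. *)
Lemma dense_lspanP (A : cstarAlgebra R) (S : set A) :
  (forall P : set A, nclosed P -> subspace P -> (forall x, S x -> P x) ->
     forall x, P x) -> dense (lspan S).
Proof.
move=> h; apply/dense_near.
apply: (h [set x | forall e : R, 0 < e -> exists2 y, lspan S y & nr (x - y) < e]).
- move=> x hx e e0.
  have [y hy xy] := hx (e / 2) ltac:(lra).
  have [z lz yz] := hy (e / 2) ltac:(lra).
  exists z => //; apply: le_lt_trans (nrDB x y z) _; lra.
- split=> [e e0|k x y hx hy e e0].
    exists 0; last by rewrite subrr nr0.
    by exists 0%N, (fun=> 0), (fun=> 0); split; [case|rewrite big_ord0].
  have K0 : 0 < complex.Re `|k| + 1.
    by rewrite ltr_wpDl// -ler0c RRe_real// normr_real.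
  have [x' [n [c [s [hs ex']]]] xx'] :=
    hx (e / 2 / (complex.Re `|k| + 1)) ltac:(rewrite !divr_gt0//; lra).
  have [y' [m [d [t [ht ey']]]] yy'] := hy (e / 2) ltac:(lra).
  exists (k *: x' + y').
    exists (n + m)%N, (fun i : 'I_(n + m) =>
        match fintype.split i with inl j => k * c j | inr j => d j end),
      (fun i : 'I_(n + m) => match fintype.split i with inl j => s j | inr j => t j end).
    split; first by move=> i; case: fintype.split.
    rewrite big_split_ord/= ex' ey' scaler_sumr; congr (_ + _).
      by apply: eq_bigr => i _; rewrite (unsplitK (inl _)) scalerA.
    by apply: eq_bigr => i _; rewrite (unsplitK (inr _)).
  rewrite opprD addrACA -scalerBr.
  apply: le_lt_trans (nrD _ _) _; rewrite nrZ.
  rewrite ltr_pdivlMr// in xx'.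
  have := nr_ge0 (x - x'); nra.
- by move=> x Sx e e0; exists x; [exact: subset_lspan|rewrite subrr nr0].
Qed.

End Density.

(** * Identities of abelian groups by reflection *)

Section AbelianNormalization.

Inductive zterm := ZVar of nat | ZZero | ZOpp of zterm | ZAdd of zterm & zterm.

Fixpoint zeval (V : zmodType) (env : seq V) (t : zterm) : V :=
  match t with
  | ZVar n => env`_n
  | ZZero => 0
  | ZOpp t => - zeval env t
  | ZAdd t u => zeval env t + zeval env u
  end.

Fixpoint zcoef (t : zterm) (i : nat) : int :=
  match t with
  | ZVar n => if n == i then 1%Z else 0%Z
  | ZZero => 0%Z
  | ZOpp t => - zcoef t i
  | ZAdd t u => zcoef t i + zcoef u i
  end.

(** Evaluation depends on a term only through its integer coefficients, which can be compared by
    computation. Variables beyond the environment evaluate to the default 0 and drop out of the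
    sum. *)
Lemma zevalE (V : zmodType) (env : seq V) t :
  zeval env t = \sum_(i < size env) env`_i *~ zcoef t i.
Proof.
elim: t => /= [n||t ->|t -> u ->].
- have [ltn|gen] := ltnP n (size env).
    rewrite (bigD1 (Ordinal ltn))//= eqxx big1 ?addr0// => i.
    by rewrite -val_eqE/= eq_sym => /negPf ->.
  rewrite nth_default// big1// => i _.
  by rewrite gtn_eqF// (leq_trans (ltn_ord i)).
- by rewrite big1.
- by rewrite -sumrN; apply: eq_bigr => i _; rewrite mulrNz.
- by rewrite -big_split; apply: eq_bigr => i _; rewrite mulrzDr.
Qed.

Lemma zeval_eq (V : zmodType) (env : seq V) n t u : size env = n ->
  all (fun i => zcoef t i == zcoef u i) (iota 0 n) ->
  zeval env t = zeval env u.
Proof.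
move=> <- /allP h; rewrite !zevalE; apply: eq_bigr => i _.
by rewrite (eqP (h i _))// mem_iota/=.
Qed.

End AbelianNormalization.

(** In a tactic that returns a term, a test is run as a [match] branch: its failure backtracks to
    the next branch, which searches the rest of the list. *)
Ltac zlookup x env :=
  lazymatch env with
  | nil => constr:(@None nat)
  | ?y :: ?env' =>
    match constr:(Set) with
    | _ => let _ := match constr:(Set) with
                    | _ => first [constr_eq x y | unify x y]
                    end in constr:(Some 0%N)
    | _ => lazymatch zlookup x env' with
           | Some ?n => constr:(Some n.+1)
           | None => constr:(@None nat)
           end
    end
  end.

Ltac zlength env :=
  lazymatch env with
  | nil => constr:(0%N)
  | _ :: ?env' => let n := zlength env' in constr:(n.+1)
  end.

Ltac zreify env t :=
  lazymatch t with
  | @Algebra.zero _ => constr:((env, ZZero))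
  | @Algebra.opp _ ?a =>
    lazymatch zreify env a with (?env1, ?u) => constr:((env1, ZOpp u)) end
  | @Algebra.add _ ?a ?b =>
    lazymatch zreify env a with (?env1, ?u) =>
      lazymatch zreify env1 b with (?env2, ?v) => constr:((env2, ZAdd u v)) end
    end
  | _ =>
    lazymatch zlookup t env with
    | Some ?n => constr:((env, ZVar n))
    | None =>
      let n := zlength env in
      let env' := eval cbv [cat rcons] in (rcons env t) in
      constr:((env', ZVar n))
    end
  end.

(* Proves the identities valid in every abelian group, by comparing
   coefficients. *)
Ltac zmod :=
  lazymatch goal with |- @eq ?T ?a ?b =>
    lazymatch zreify (@nil T) a with (?env1, ?u) =>
      lazymatch zreify env1 b with (?env2, ?v) =>
        let n := zlength env2 in
        refine (@zeval_eq _ env2 n u v (erefl n) _); vm_compute; reflexivity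
      end end end.

(** * Square roots and contractivity *)

Section CstarBasics.
Context {R : realType} {A : cstarAlgebra R}.
Implicit Types (x y z a b c : A).

Lemma cs_mul0l x : (0 : A) ** x = 0.
Proof. by rewrite -[in LHS](scale0r x) cs_scaleAl !scale0r. Qed.

Lemma cs_mul0r x : x ** (0 : A) = 0.
Proof. by rewrite -[in LHS](scale0r x) cs_scaleAr !scale0r. Qed.

Lemma cs_mulBl x y z : (x - y) ** z = x ** z - y ** z.
Proof. by rewrite cs_mulDl cs_mulNl. Qed.

Lemma cs_mulBr x y z : x ** (y - z) = x ** y - x ** z.
Proof. by rewrite cs_mulDr cs_mulNr. Qed.

Lemma star0 : star (0 : A) = 0.
Proof. by rewrite -[in LHS](scale0r (0 : A)) starZ conjc0 scale0r. Qed.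

Lemma starN x : star (- x) = - star x.
Proof. by rewrite -scaleN1r starZ rmorphN rmorph1 scaleN1r. Qed.

Lemma starB x y : star (x - y) = star x - star y.
Proof. by rewrite starD starN. Qed.

Lemma nrM x y : nr (x ** y) <= nr x * nr y.
Proof. by rewrite -lecR rmorphM/= -!nrE cs_normM. Qed.

Lemma nr_starM x : nr (star x ** x) = nr x ^+ 2.
Proof. by apply: complexI; rewrite -nrE cs_norm_star nrE rmorphXn. Qed.

Lemma nr_star x : nr (star x) = nr x.
Proof.
have le y : nr y <= nr (star y).
  have [->|y0] := eqVneq y 0; first by rewrite star0.
  have y1 : 0 < nr y.
    by rewrite lt_neqAle nr_ge0 andbT eq_sym; apply: contra_neq y0 => /nr_eq0.
  by rewrite -(ler_pM2r y1) -expr2 -nr_starM nrM.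
by apply/le_anti; rewrite le andbT -{2}[x]starK le.
Qed.

Lemma nr_Mstar x : nr (x ** star x) = nr x ^+ 2.
Proof. by rewrite -{1}[x]starK nr_starM nr_star. Qed.

Lemma nr_sa_sq x : star x = x -> nr (x ** x) = nr x ^+ 2.
Proof. by move=> sx; rewrite -nr_starM sx. Qed.

Lemma cvg_mulr T (F : set_system T) (f : T -> A) x y {FF : Filter F} :
  f @ F --> x -> (fun t => f t ** y) @ F --> x ** y.
Proof.
move=> h; apply: (cvg_dom (K := nr y) h).
by apply: nearW => t /=; rewrite -cs_mulBl mulrC nrM.
Qed.

Lemma cvg_mull T (F : set_system T) (f : T -> A) x y {FF : Filter F} :
  f @ F --> x -> (fun t => y ** f t) @ F --> y ** x.
Proof.
move=> h; apply: (cvg_dom (K := nr y) h).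
by apply: nearW => t /=; rewrite -cs_mulBr nrM.
Qed.

Lemma cvg_star T (F : set_system T) (f : T -> A) x {FF : Filter F} :
  f @ F --> x -> (fun t => star (f t)) @ F --> star x.
Proof.
move=> h; apply: (cvg_dom (K := 1) h).
by apply: nearW => t /=; rewrite -starB nr_star mul1r.
Qed.

End CstarBasics.

Section SquareRoot.
Context {R : realType} {A : cstarAlgebra R}.
Implicit Types (h y z c : A).

Let hf : R[i] := (2^-1 : R)%:C.

Lemma half_double (V : lmodType R[i]) (x : V) : (2^-1 : R)%:C *: (x + x) = x.
Proof.
rewrite -[x in X in _ *: X]scale1r -scalerDl scalerA.
rewrite (_ : _ * _ = 1) ?scale1r//.
by rewrite fmorphV rmorph_nat mulVf// pnatr_eq0.
Qed.

Lemma double_inj (V : lmodType R[i]) (x y : V) : x + x = y + y -> x = y.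
Proof. by move=> e; rewrite -(half_double x) e half_double. Qed.

Let it (h : A) := fix it (n : nat) : A :=
  if n is n'.+1 then hf *: (h ** h + it n' ** it n') else 0.

(** The same iteration for the scalar [h = 1], which dominates all the others. Its limit 1 is a
    double root of the fixed-point equation, hence the merely harmonic rate below. *)
Let r : nat -> R := fix r n := if n is n'.+1 then 2^-1 * (1 + r n' ^+ 2) else 0.

Let r_bnd n : [/\ 0 <= r n, r n <= 1 & 1 - r n <= 2 / n.+1%:R].
Proof.
elim: n => [|n [r0 r1 rn]] /=; first by rewrite divr1; split; lra.
split; [nra|nra|].
have n0 : (0 : R) < n.+1%:R by rewrite ltr0n.
have n2 : (n.+2%:R : R) = n.+1%:R + 1 by rewrite -natr1.
rewrite n2; move: (n.+1%:R : R) n0 rn => t t0; rewrite !ler_pdivlMr//; last lra.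
move=> rn.
have -> : r n = 1 - (1 - r n) by lra.
have : 1 - r n <= 1 by lra.
have : 0 <= 1 - r n by lra.
move: (1 - r n) rn => d rn d0 d1.
(* The induction hypothesis [d t <= 2] times [1 - d / 2]; the error [d] evolves into
   [d (1 - d / 2)]. *)
have : 0 <= (2 - d * t) * (1 - d / 2) by apply: mulr_ge0; lra.
by nra.
Qed.

Let hf_ge0 : `|(2^-1 : R)| = 2^-1.
Proof. by rewrite ger0_norm// invr_ge0. Qed.

Let it_bnd h : nr h <= 1 -> forall n, nr (it h n) <= r n.
Proof.
move=> h1; elim=> [|n IH] /=; first by rewrite nr0.
rewrite nrZr hf_ge0 ler_pM2l ?invr_gt0//.
apply: le_trans (nrD _ _) _; apply: lerD.
  apply: le_trans (nrM _ _) _; have := nr_ge0 h; nra.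
apply: le_trans (nrM _ _) _; rewrite -expr2 lerXn2r// ?nnegrE ?nr_ge0//.
by have [] := r_bnd n.
Qed.

(** By [a^2 - b^2 = a (a - b) + (a - b) b], which bounds each increment by that of the majorant,
    where the corresponding estimate is an equality. *)
Let it_step h : nr h <= 1 -> forall n, nr (it h n.+1 - it h n) <= r n.+1 - r n.
Proof.
move=> h1; elim=> [|n IH].
  by rewrite !subr0; exact: it_bnd.
rewrite [it h n.+2]/= [in X in _ - X]/= -scalerBr nrZr hf_ge0.
rewrite opprD addrACA subrr add0r.
set a := hf *: _; have ea : a = it h n.+1 by [].
set b := it h n in a ea *; rewrite -/b in IH; rewrite -ea in IH *.
have -> : a ** a - b ** b = a ** (a - b) + (a - b) ** b.
  by rewrite cs_mulBl cs_mulBr addrA subrK.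
have a1 : nr a <= r n.+1 by rewrite ea; exact: it_bnd.
have b1 : nr b <= r n by exact: it_bnd.
have := nrD (a ** (a - b)) ((a - b) ** b).
have := nrM a (a - b); have := nrM (a - b) b.
have := nr_ge0 (a - b); have := nr_ge0 a; have := nr_ge0 b.
have [p0 p1 _] := r_bnd n; have [q0 q1 _] := r_bnd n.+1.
have -> : r n.+2 - r n.+1 = 2^-1 * (r n.+1 ^+ 2 - r n ^+ 2).
  change (2^-1 * (1 + r n.+1 ^+ 2) - 2^-1 * (1 + r n ^+ 2)
    = 2^-1 * (r n.+1 ^+ 2 - r n ^+ 2)).
  by move: (r n.+1) (r n) => *; lra.
move: IH a1 b1 q0 q1 p0 p1.
move: (nr (a - b)) (nr a) (nr b) (r n.+1) (r n) => d na nb s t.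
move=> IH a1 b1 s0 s1 t0 t1 nb0 na0 d0 u1 u2 u3.
have : na * d <= s * (s - t) by apply: ler_pM.
have : d * nb <= (s - t) * t by apply: ler_pM.
lra.
Qed.

(** The third clause is [(1 - y)^2 = 1 - h^2] written without a unit. As a limit of polynomials in
    [h^2], [y] commutes with whatever commutes with [h^2]. *)
Lemma sqrt_complement h : star h = h -> nr h <= 1 -> exists y,
  [/\ star y = y, nr y <= 1, h ** h + y ** y = y + y &
      forall c, c ** (h ** h) = h ** h ** c -> c ** y = y ** c].
Proof.
move=> sh h1.
have cauchy n m : (n <= m)%N -> nr (it h n - it h m) <= 2 / n.+1%:R.
  move=> nm; have [_ rm1 _] := r_bnd m; have [_ _ rn] := r_bnd n.
  suff /le_trans : nr (it h n - it h m) <= r m - r n.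
    by apply; apply: le_trans rn; rewrite lerD2r.
  elim: m nm rm1 => [|m IH]; first by rewrite leqn0 => /eqP ->; rewrite subrr nr0 subrr.
  rewrite leq_eqVlt ltnS => /orP[/eqP ->|nm _]; first by rewrite subrr nr0 subrr.
  have [_ rm1 _] := r_bnd m; have := IH nm rm1.
  have := it_step h1 m; rewrite nrB.
  by have := nrDB (it h n) (it h m) (it h m.+1); lra.
have e0 : (fun n => 2 / n.+1%:R) @ \oo --> (0 : R).
  rewrite -[X in _ --> X](mulr0 (2 : R)).
  by apply: cvgM; [exact: cvg_cst|exact: cvg_harmonic].
have [y [cy hy]] := nr_cauchy e0 cauchy.
have sit n : star (it h n) = it h n.
  elim: n => [|n IH] /=; first by rewrite star0.
  by rewrite starZ starD !starM sh IH conjc_real.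
have cit c : c ** (h ** h) = h ** h ** c -> forall n, c ** it h n = it h n ** c.
  move=> hc; elim=> [|n IH] /=; first by rewrite cs_mul0l cs_mul0r.
  rewrite cs_scaleAl cs_scaleAr cs_mulDl cs_mulDr hc; congr (_ *: (_ + _)).
  by rewrite cs_mulA IH -cs_mulA IH cs_mulA.
have fp : y = hf *: (h ** h + y ** y).
  apply: (cvg_uniq (F := \oo) (f := fun n => it h n.+1)).
    by rewrite (_ : (fun n => it h n.+1) = (fun n => it h (n + 1)))
       ?cvg_shiftn//; apply/funext => n; rewrite addn1.
  apply: cvgZr; apply: cvgD; first exact: cvg_cst.
  apply: (cvg_dom (K := nr y + 1) cy); exists 0%N => // n _ /=.
  rewrite (_ : _ - _ = y ** (y - it h n) + (y - it h n) ** it h n); last first.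
    by rewrite cs_mulBl cs_mulBr addrA subrK.
  have := nrD (y ** (y - it h n)) ((y - it h n) ** it h n).
  have := nrM y (y - it h n); have := nrM (y - it h n) (it h n).
  have := it_bnd h1 n; have [_ + _] := r_bnd n.
  by have := nr_ge0 (y - it h n); have := nr_ge0 (it h n); nra.
exists y; split.
- apply: (cvg_uniq (F := \oo) (f := it h)) => //.
  by rewrite (_ : it h = fun n => star (it h n)); [exact: cvg_star|apply/funext].
- apply: (nr_cvg_le cy); exists 0%N => // n _ /=.
  by have := it_bnd h1 n; have [_ + _] := r_bnd n; lra.
- by rewrite {3 4}fp -scalerDr half_double.
- move=> c /cit hc; apply: (cvg_uniq (F := \oo) (f := fun n => c ** it h n)).
    exact: cvg_mull.
  by rewrite (_ : (fun _ => _) = fun n => it h n ** c); [exact: cvg_mulr|apply/funext].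
Qed.

End SquareRoot.

Section UnbundledLinear.
Context {R : realType} {V W : lmodType R[i]} (f : V -> W) (lf : linear f).

Lemma lin_D a b : f (a + b) = f a + f b.
Proof. by have := lf 1 a b; rewrite !scale1r. Qed.

Lemma lin_0 : f 0 = 0.
Proof. by apply: (@addrI _ (f 0)); rewrite -lin_D !addr0. Qed.

Lemma lin_Z k a : f (k *: a) = k *: f a.
Proof. by have := lf k a 0; rewrite lin_0 !addr0. Qed.

Lemma lin_N a : f (- a) = - f a.
Proof. by rewrite -scaleN1r lin_Z scaleN1r. Qed.

Lemma lin_B a b : f (a - b) = f a - f b.
Proof. by rewrite lin_D lin_N. Qed.

Lemma lin_sum I (r : seq I) (F : I -> V) :
  f (\sum_(i <- r) F i) = \sum_(i <- r) f (F i).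
Proof. by elim/big_rec2 : _ => [|i x y _ <-]; rewrite ?lin_0 ?lin_D. Qed.

End UnbundledLinear.

Section CyclicBound.
Context {R : realType}.

Lemma conjci : ('i : R[i])^* = - 'i.
Proof. by apply/eqP; rewrite eq_complex/= oppr0 !eqxx. Qed.

Lemma mulci : 'i * 'i = -1 :> R[i].
Proof. by rewrite -expr2 sqr_i. Qed.

(** The mixed terms are [i] times [u^* v - v^* u], which vanishes. *)
Lemma star_cartesian (D : cstarAlgebra R) (u v : D) :
  star u ** v = star v ** u ->
  star (u + 'i *: v) ** (u + 'i *: v) = star u ** u + star v ** v.
Proof.
move=> uv; rewrite starD starZ conjci cs_mulDl !cs_mulDr !cs_scaleAl !cs_scaleAr.
rewrite uv scalerA mulNr mulci opprK scale1r scaleNr -addrA; congr (_ + _).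
by rewrite addrA subrr add0r.
Qed.

Lemma nr_starM_eq (A B : cstarAlgebra R) (x : A) (y : B) :
  nr (star x ** x) = nr (star y ** y) -> nr x = nr y.
Proof.
by rewrite !nr_starM => /eqP; rewrite eqrXn2 ?nr_ge0// => /eqP.
Qed.

(** The hypotheses are unaffected by the sign of [v], so [u + i v] and [u - i v] both have the norm
    of [z], and [u] is half their sum. *)
Lemma cartesian_bound (D : cstarAlgebra R) (u v z : D) :
  star u ** v = star v ** u -> star u ** u + star v ** v = star z ** z ->
  [/\ nr (u + 'i *: v) = nr z, nr (u - 'i *: v) = nr z & nr u <= nr z].
Proof.
move=> uv e.
have h1 : nr (u + 'i *: v) = nr z.
  by apply: nr_starM_eq; rewrite star_cartesian// e.
have h2 : nr (u - 'i *: v) = nr z.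
  apply: nr_starM_eq; rewrite -scalerN star_cartesian.
    by rewrite starN cs_mulNl cs_mulNr opprK e.
  by rewrite starN cs_mulNl cs_mulNr uv.
split=> //.
have : nr (u + u) <= nr z + nr z.
  rewrite -{1}h1 -h2; apply: le_trans (nrD _ _).
  by rewrite addrACA subrr addr0.
have -> : u + u = (2 : R)%:C *: u by rewrite rmorph_nat scaler_nat mulr2n.
by rewrite nrZr ger0_norm//; lra.
Qed.

(* [rho] is the orbit map of [z] under a *-representation of [A].  If [h] is
   self-adjoint with square-root complement [y], then [h + i (1 - y)] acts
   isometrically on [z], hence so does its "real part" [h] contractively. *)
Lemma cyclic_bound (A D : cstarAlgebra R) (rho : A -> D) (z : D) :
  linear rho ->
  (forall a b, star (rho a) ** rho b = star z ** rho (star a ** b)) ->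
  (forall a, star (rho a) ** z = star z ** rho (star a)) ->
  forall a, nr (rho a) <= nr a * nr z.
Proof.
move=> lrho h1 h2.
have rD := lin_D lrho; have rZ := lin_Z lrho.
have sa1 h : star h = h -> nr h <= 1 -> nr (rho h) <= nr z.
  move=> sh n1; have [y [sy _ ey cy]] := sqrt_complement sh n1.
  have hy : h ** y = y ** h by apply: cy; rewrite cs_mulA.
  have sv : star (rho h) ** (z - rho y) = star (z - rho y) ** rho h.
    by rewrite starB cs_mulBr cs_mulBl !h1 h2 sh sy hy.
  suff e : star (rho h) ** rho h + star (z - rho y) ** (z - rho y) = star z ** z.
    by have [] := cartesian_bound sv e.
  rewrite starB cs_mulBl !cs_mulBr !h1 h2 sh sy.
  have /(congr1 (fun x => star z ** rho x)) := ey.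
  rewrite !rD !cs_mulDr => /(canRL (addKr _)) ->.
  zmod.
have sa h : star h = h -> nr (rho h) <= nr h * nr z.
  move=> sh; have [->|h0] := eqVneq h 0.
    by rewrite -(scale0r (0 : A)) rZ !scale0r !nr0 mul0r.
  have n0 : 0 < nr h.
    by rewrite lt_neqAle nr_ge0 andbT eq_sym; apply: contra_neq h0 => /nr_eq0.
  have := sa1 ((nr h)^-1%:C *: h).
  rewrite starZ conjc_real sh nrZr rZ nrZr ger0_norm ?invr_ge0 ?nr_ge0//.
  by rewrite mulVf ?gt_eqF// => /(_ erefl (lexx _)); rewrite ler_pdivrMl.
move=> a.
have z0 := nr_ge0 z; have a0 := nr_ge0 a.
(* Since [|rho a|^2 = |z^* rho (a^* a)|], the self-adjoint case for [a^* a] suffices. *)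
rewrite -(@ler_pXn2r _ 2) ?nnegrE ?mulr_ge0 ?nr_ge0// -nr_starM h1.
apply: le_trans (nrM _ _) _; rewrite nr_star.
have := sa (star a ** a); rewrite starM starK nr_starM => /(_ erefl).
by move: (nr _) (nr z) (nr a) z0 a0 => u v w v0 w0 h; nra.
Qed.

End CyclicBound.

Section MultiplierBasics.
Context {R : realType} {A : cstarAlgebra R}.
Implicit Types (m n : multiplier A) (a b x y : A).

Lemma lactM m n a : lact (m * n) a = lact m (lact n a). Proof. by []. Qed.
Lemma lactDl m n a : lact (m + n) a = lact m a + lact n a. Proof. by []. Qed.
Lemma lactNl m a : lact (- m) a = - lact m a. Proof. by []. Qed.
Lemma lactZl k m a : lact (k *: m) a = k *: lact m a. Proof. by []. Qed.
Lemma lact1 a : lact 1 a = a. Proof. by []. Qed.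
Lemma lact_minj a b : lact (minj a) b = a ** b. Proof. by []. Qed.
Lemma ract_minj a b : ract (minj a) b = b ** a. Proof. by []. Qed.

Lemma ract_mstar m a : ract (mstar m) a = star (lact m (star a)). Proof. by []. Qed.

Lemma mstarK m : mstar (mstar m) = m.
Proof. by apply: multiplier_ext => a /=; rewrite !starK. Qed.

Lemma ractE m a : ract m a = star (lact (mstar m) (star a)).
Proof. by rewrite -{1}(mstarK m). Qed.

Lemma mstarM m n : mstar (m * n) = mstar n * mstar m.
Proof. by apply: multiplier_ext => a /=; rewrite !starK. Qed.

Lemma mstarD m n : mstar (m + n) = mstar m + mstar n.
Proof. by apply: multiplier_ext => a /=; rewrite starD. Qed.

Lemma mstarN m : mstar (- m) = - mstar m.
Proof. by apply: multiplier_ext => a /=; rewrite starN. Qed.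

Lemma mstarB m n : mstar (m - n) = mstar m - mstar n.
Proof. by rewrite mstarD mstarN. Qed.

Lemma mstarZ k m : mstar (k *: m) = k^* *: mstar m.
Proof. by apply: multiplier_ext => a /=; rewrite starZ. Qed.

Lemma mstar1 : mstar (1 : multiplier A) = 1.
Proof. by apply: multiplier_ext => a /=; rewrite starK. Qed.

Lemma mstar0 : mstar (0 : multiplier A) = 0.
Proof. by apply: multiplier_ext => a /=; rewrite star0. Qed.

Lemma mstar_minj a : mstar (minj a) = minj (star a).
Proof. by apply: multiplier_ext => b /=; rewrite starM starK. Qed.

Lemma minjM a b : minj (a ** b) = minj a * minj b.
Proof. by apply: multiplier_ext => c /=; rewrite cs_mulA. Qed.

Lemma minj_linear : linear (@minj R A).
Proof.
move=> k a b; apply: multiplier_ext => c /=.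
  by rewrite cs_mulDl cs_scaleAl.
by rewrite cs_mulDr cs_scaleAr.
Qed.

Lemma minj_inj : injective (@minj R A).
Proof.
by move=> a b e; apply: cs_rfaithful => c; rewrite -!lact_minj e.
Qed.

Lemma lact_ext m n : (forall a, lact m a = lact n a) -> m = n.
Proof.
move=> h; apply: multiplier_ext => // a; apply: cs_rfaithful => b.
by rewrite -!multiplierP h.
Qed.

Lemma lactMr m a b : lact m (a ** b) = lact m a ** b.
Proof.
by apply: cs_lfaithful => c; rewrite multiplierP !cs_mulA multiplierP.
Qed.

Lemma mul_minj m a : m * minj a = minj (lact m a).
Proof. by apply: lact_ext => b; rewrite lactM !lact_minj lactMr. Qed.

Lemma lact_linear m : linear (lact m).
Proof.
move=> k a b; apply: cs_lfaithful => c.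
by rewrite cs_mulDr cs_scaleAr !multiplierP cs_mulDr cs_scaleAr.
Qed.

Lemma mscaleAl k m n : (k *: m) * n = k *: (m * n).
Proof. by apply: lact_ext => a. Qed.

Lemma mscaleAr k m n : m * (k *: n) = k *: (m * n).
Proof. by apply: lact_ext => a; rewrite lactM !lactZl (lin_Z (lact_linear m)). Qed.

Lemma star_lact m x y : star (lact m x) ** y = star x ** lact (mstar m) y.
Proof. by rewrite multiplierP ract_mstar starK. Qed.

(** Boundedness of multipliers is not yet available. It is avoided by testing against [c] on the
    left: [c ** lact m a = ract m c ** a] is visibly continuous in [a]. *)
Lemma mult_dense_eq (S : set A) m n : dense (lspan S) ->
  (forall a, S a -> lact m a = lact n a) -> m = n.
Proof.
move=> dS h; apply: lact_ext => a; apply: cs_lfaithful => c.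
rewrite !multiplierP; apply/eqP; rewrite -subr_eq0 -cs_mulBl; apply/eqP.
set d := _ - _; move: a; apply: (dense_ind dS) => [|| a Sa].
- apply: (@nclosed_lip _ _ _ (fun a => d ** a) [set 0] (nr d)).
    by move=> x y; rewrite -cs_mulBr nrM.
  exact: nclosed_set1.
- split; first exact: cs_mul0r.
  by move=> k x y dx dy; rewrite cs_mulDr cs_scaleAr dx dy scaler0 addr0.
- by rewrite /d cs_mulBl -!multiplierP h// subrr.
Qed.

End MultiplierBasics.

Section Contractivity.
Context {R : realType}.

(** The orbit map of [b] under [f] satisfies the hypotheses of [cyclic_bound]. *)
Lemma star_hom_contractive (A B : cstarAlgebra R) (f : A -> multiplier B) :
  star_hom f -> forall a b, nr (lact (f a) b) <= nr a * nr b.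
Proof.
move=> [fl fM fs] a b.
apply: (cyclic_bound (rho := fun a => lact (f a) b)) => [k u v|c d|c] /=.
- by rewrite fl.
- by rewrite star_lact fM fs.
- by rewrite star_lact fs.
Qed.

End Contractivity.

Section LowerBound.
Context {R : realType}.

Lemma alg_hom_contractive (A D : cstarAlgebra R) (f : A -> D) :
  linear f -> {morph f : x y / x ** y} -> {morph f : x / star x} ->
  forall a, nr (f a) <= nr a.
Proof.
move=> fl fM fs a.
have h : star_hom (fun a => minj (f a)).
  split=> [k x y|x y|x]; first by rewrite fl minj_linear.
  - by rewrite fM minjM.
  - by rewrite fs mstar_minj.
have := star_hom_contractive h a (star (f a)); rewrite lact_minj nr_Mstar nr_star.
by have := nr_ge0 (f a); have := nr_ge0 a; nra.
Qed.

(** Here [v] is [(1 - y) z]: the unitaries [h + i (1 - y)] and [h - i (1 - y)] act isometrically on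
    [z], and their real and imaginary parts contractively. The last bound comes from exchanging the
    roles of the two parts. *)
Lemma sqrt_complement_cartesian (A : cstarAlgebra R) (h y z : A) :
  star h = h -> star y = y -> h ** y = y ** h -> h ** h + y ** y = y + y ->
  let v := z - y ** z in
  [/\ nr (h ** z + 'i *: v) = nr z, nr (h ** z - 'i *: v) = nr z,
      nr (h ** z) <= nr z & nr v <= nr z].
Proof.
move=> sh sy hy e v.
have sv : star v = star z - star z ** y by rewrite /v starB starM sy.
have c1 : star (h ** z) ** v = star v ** (h ** z).
  rewrite sv starM sh /v cs_mulBr cs_mulBl !cs_mulA; congr (_ - _).
  by rewrite -!cs_mulA [h ** (y ** z)]cs_mulA hy !cs_mulA.
have c2 : star (h ** z) ** (h ** z) + star v ** v = star z ** z.
  rewrite sv starM sh /v cs_mulBr !cs_mulBl !cs_mulA.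
  have := congr1 (fun x => star z ** x ** z) e.
  rewrite !cs_mulDr !cs_mulDl !cs_mulA => /(canRL (addrK _)) ->.
  zmod.
have [-> -> ->] := cartesian_bound c1 c2; split=> //.
have c1' : star v ** (h ** z) = star (h ** z) ** v by [].
by have [] := cartesian_bound c1' (etrans (addrC _ _) c2).
Qed.

(* For [h' = 2 h (1 - y)] one has [1 - h'^2 = (1 - 2 h^2)^2], so
   [f = 2 h^2 - y'] is twice the positive part of [2 h^2 - 1]: it does not
   vanish when [|h| = 1], but is annihilated by [2 - (2 h^2 + y')]. *)
Lemma inj_hom_bounded_below (A D : cstarAlgebra R) (f : A -> D) :
  linear f -> {morph f : x y / x ** y} -> {morph f : x / star x} ->
  (forall a, f a = 0 -> a = 0) -> forall a, nr a <= 2 * nr (f a).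
Proof.
move=> fl fM fs finj.
have fc := alg_hom_contractive fl fM fs.
have fD := lin_D fl; have fZ := lin_Z fl.
have sa1 h : star h = h -> nr h = 1 -> 1 <= 2 * nr (f h) ^+ 2.
  move=> sh n1.
  have [y [sy _ ey cy]] := sqrt_complement sh ltac:(by rewrite n1).
  have hy : h ** y = y ** h by apply: cy; rewrite cs_mulA.
  (* With the unitaries [V = h + i (1 - y)] and [V' = h - i (1 - y)] one has
     [4 g = -i (V^2 - V'^2)], whence [2 |g z| <= |z|] and [2 g] is again a self-adjoint
     contraction. *)
  have [g eg] : exists g, g = h - h ** y by exists (h - h ** y).
  have sg : star g = g by rewrite eg starB starM sh sy -hy.
  have gb z : nr (g ** z) *+ 2 <= nr z.
    have U x := sqrt_complement_cartesian x sh sy hy ey.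
    pose s := z - y ** z.
    have [u1 v1 _ _] := U z; rewrite -/s in u1 v1.
    have [u2 _ _ _] := U (h ** z + 'i *: s).
    have [_ v2 _ _] := U (h ** z - 'i *: s).
    have ed : g ** z + g ** z + (g ** z + g ** z) =
      - 'i *: ((h ** (h ** z + 'i *: s) + 'i *: (h ** z + 'i *: s - y ** (h ** z + 'i *: s)))
      - (h ** (h ** z - 'i *: s) - 'i *: (h ** z - 'i *: s - y ** (h ** z - 'i *: s)))).
      have yh x : y ** (h ** x) = h ** (y ** x) by rewrite !cs_mulA hy.
      have -> : g ** z = h ** z - h ** (y ** z) by rewrite eg cs_mulBl cs_mulA.
      have es : h ** s = h ** z - h ** (y ** z) by rewrite cs_mulBr.
      move: s es {u1 v1 u2 v2 U} => s es.
      rewrite !(cs_mulDr, cs_mulNr, cs_scaleAr) yh es.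
      move: (h ** z) (h ** (y ** z)) (h ** (h ** z)) (y ** s) => a b c d.
      rewrite !(scalerDr, scalerN, scalerA) !(mulNr, mulci, mulN1r, opprK, scale1r).
      zmod.
    have : nr (g ** z + g ** z + (g ** z + g ** z)) <= nr z + nr z.
      rewrite ed nrZ normrN normc_def/= expr0n add0r expr1n sqrtr1 mul1r.
      by apply: le_trans (nrD _ _) _; rewrite nrN u2 v2 u1 v1.
    have -> : g ** z + g ** z + (g ** z + g ** z) = (4 : R)%:C *: (g ** z).
      by rewrite rmorph_nat scaler_nat !mulrS mulr0n; zmod.
    by rewrite nrZr ger0_norm// mulr2n; lra.
  have gn : nr g *+ 2 <= 1.
    have := gb g; rewrite nr_sa_sq// mulr2n.
    by have := nr_ge0 g; nra.
  have sh' : star (g + g) = g + g by rewrite starD sg.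
  have nh' : nr (g + g) <= 1.
    by apply: le_trans (nrD _ _) _; rewrite -mulr2n.
  have [y' [sy' ny' ey' cy']] := sqrt_complement sh' nh'.
  have [H eH] : exists H, H = h ** h by exists (h ** h).
  rewrite -eH in ey.
  have hHy : h ** (h ** y) = H ** y by rewrite cs_mulA -eH.
  have gg : g ** g = H - H ** H.
    rewrite eg cs_mulBl !cs_mulBr -eH hHy.
    have -> : h ** y ** h = H ** y by rewrite -cs_mulA -hy hHy.
    have -> : h ** y ** (h ** y) = H ** y + H ** y - H ** H.
      have -> : h ** y ** (h ** y) = H ** (y ** y).
        rewrite eH -!cs_mulA; congr (_ ** _).
        by rewrite cs_mulA -hy -cs_mulA.
      rewrite -!cs_mulDr -cs_mulBr; congr (_ ** _).
      by rewrite -ey; zmod.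
    by zmod.
  have cH : H ** y' = y' ** H.
    apply: cy'; rewrite !(cs_mulDr, cs_mulDl) gg !(cs_mulBr, cs_mulBl).
    by rewrite !cs_mulA.
  pose F := H + H - y'; pose F' := H + H + y'.
  have FF : F ** F' = F + F.
    have e1 : y' ** y' = y' + y' - (g + g) ** (g + g) by rewrite -ey'; zmod.
    rewrite /F /F' cs_mulBl !cs_mulDr !cs_mulDl e1 cH.
    rewrite !(cs_mulDr, cs_mulDl) gg; zmod.
  (* If [2 |f h|^2 < 1], then [|f F'| < 2]. As [F F' = 2 F], this forces [f F = 0], hence [F = 0]
     and [y' = 2 h^2], which has norm 2 although [|y'| <= 1]. *)
  rewrite leNgt; apply/negP => lt1.
  have w2 : nr (f F') < 2.
    rewrite /F' !fD; apply: le_lt_trans (nrD _ _) _.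
    have := fc y'; have := nrD (f H) (f H).
    by rewrite eH fM nr_sa_sq -?fs ?sh//; lra.
  have : nr (f F) = 0.
    have := nrM (f F) (f F'); rewrite -fM FF fD.
    have -> : f F + f F = (2 : R)%:C *: f F by rewrite rmorph_nat scaler_nat mulr2n.
    by rewrite nrZr ger0_norm//; have := nr_ge0 (f F); nra.
  move=> /nr_eq0 /finj /eqP; rewrite subr_eq0 => /eqP eF.
  have : nr (H + H) = 2.
    have -> : H + H = (2 : R)%:C *: H by rewrite rmorph_nat scaler_nat mulr2n.
    by rewrite nrZr ger0_norm// eH nr_sa_sq// n1; lra.
  by rewrite eF; lra.
have sa h : star h = h -> nr h ^+ 2 <= 2 * nr (f h) ^+ 2.
  move=> sh; have [->|h0] := eqVneq h 0.
    by rewrite nr0 expr0n/= mulr_ge0// sqr_ge0.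
  have n0 : 0 < nr h.
    by rewrite lt_neqAle nr_ge0 andbT eq_sym; apply: contra_neq h0 => /nr_eq0.
  have := sa1 ((nr h)^-1%:C *: h).
  rewrite starZ conjc_real sh nrZr fZ nrZr ger0_norm ?invr_ge0 ?nr_ge0//.
  rewrite mulVf ?gt_eqF// => /(_ erefl erefl).
  rewrite exprMn exprVn mulrCA ler_pdivlMl ?exprn_gt0// mulr1.
  by [].
(* The self-adjoint case for [a^* a] gives [|a|^4 <= 2 |f a|^4]; the factor 2 in the statement is a
   crude consequence. *)
move=> a.
have := sa (star a ** a); rewrite starM starK fM fs !nr_starM => /(_ erefl).
have := nr_ge0 a; have := nr_ge0 (f a).
move: (nr a) (nr (f a)) => s t t0 s0 h.
rewrite leNgt; apply/negP => lt.
have : (2 * t) ^+ 2 < s ^+ 2 by rewrite ltrXn2r// ?nnegrE//; lra.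
rewrite exprMn => h2.
have : 0 <= t ^+ 2 by apply: sqr_ge0.
by move: (t ^+ 2) (s ^+ 2) h h2 => u v; nra.
Qed.

(** If [s < t], Bernoulli's inequality makes the powers of [t / s] unbounded. The exponents are the
    ones produced by iterating the C*-identity. *)
Lemma pow_le_const (t s C : R) : 0 <= t -> 0 <= s ->
  (forall k, t ^+ (2 ^ k) <= C * s ^+ (2 ^ k)) -> t <= s.
Proof.
move=> t0 s0 h; rewrite leNgt; apply/negP => st.
have tp : 0 < t by apply: le_lt_trans st.
have [s00|sn0] := eqVneq s 0.
  by have := h 0%N; rewrite s00 expn0 !expr1 mulr0; lra.
have sp : 0 < s by rewrite lt_neqAle eq_sym sn0.
pose d := t / s - 1.
have d0 : 0 < d by rewrite subr_gt0 ltr_pdivlMr// mul1r.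
have bern n : 1 + n%:R * d <= (1 + d) ^+ n.
  elim: n => [|n IH]; first by rewrite mul0r addr0 expr0.
  rewrite exprS -natr1; have : (0 : R) <= n%:R by [].
  by move: (n%:R : R) ((1 + d) ^+ n) IH => m q IH m0; nra.
have hk k : 1 + k%:R * d <= C.
  apply: le_trans (_ : 1 + (2 ^ k)%:R * d <= _).
    rewrite lerD2l ler_pM2r// ler_nat; apply: ltnW; exact: ltn_expl.
  apply: le_trans (bern _) _.
  rewrite /d addrCA subrr addr0 expr_div_n ler_pdivrMr ?exprn_gt0//.
have C0 : 0 <= C / d.
  by rewrite divr_ge0 ?(ltW d0)//; have := hk 0%N; rewrite mul0r; lra.
have := archi_boundP C0; rewrite ltr_pdivrMr// => h1.
have := hk (Num.bound (C / d)).
by lra.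
Qed.

End LowerBound.

(** * Bounded multipliers and approximate units *)

Section BoundedMultipliers.
Context {R : realType}.
Implicit Types A : cstarAlgebra R.

(** Bounds of the left action take the place of an operator norm, so that no supremum has to be
    formed. *)
Definition mbnd A (K : R) : set (multiplier A) :=
  [set m | forall a, nr (lact m a) <= K * nr a].

Lemma mbnd1E A : @mult_ball R A = @mbnd A 1.
Proof.
apply/funext => m; apply/propext; split=> h a; have := h a.
  by rewrite !nrE lecR mul1r.
by rewrite !nrE lecR mul1r.
Qed.

Lemma mbnd_le A (K L : R) (m : multiplier A) : K <= L -> mbnd K m -> mbnd L m.
Proof. by move=> KL h a; apply: le_trans (h a) _; rewrite ler_wpM2r// nr_ge0. Qed.

Lemma mbndM A (K L : R) (m n : multiplier A) : 0 <= K ->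
  mbnd K m -> mbnd L n -> mbnd (K * L) (m * n).
Proof.
move=> K0 hm hn a; rewrite lactM; apply: le_trans (hm _) _.
by rewrite -mulrA ler_wpM2l.
Qed.

Lemma mbndD A (K L : R) (m n : multiplier A) :
  mbnd K m -> mbnd L n -> mbnd (K + L) (m + n).
Proof.
by move=> hm hn a; rewrite lactDl mulrDl (le_trans (nrD _ _))// lerD.
Qed.

Lemma mbndZ A (K : R) (k : R[i]) (m : multiplier A) :
  mbnd K m -> mbnd (complex.Re `|k| * K) (k *: m).
Proof.
move=> hm a; rewrite lactZl nrZ -mulrA ler_wpM2l//.
by rewrite -ler0c RRe_real// normr_real.
Qed.

Lemma mbndN A (K : R) (m : multiplier A) : mbnd K m -> mbnd K (- m).
Proof. by move=> hm a; rewrite lactNl nrN. Qed.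

Lemma mbnd1 A : mbnd 1 (1 : multiplier A).
Proof. by move=> a; rewrite mul1r. Qed.

Lemma mbnd_minj A (a : A) : mbnd (nr a) (minj a).
Proof. by move=> b; rewrite lact_minj nrM. Qed.

(** By the C*-identity [|m^* a|^2 = |a^* m m^* a| <= |a| K |m^* a|]. *)
Lemma mbnd_star A (K : R) (m : multiplier A) : 0 <= K -> mbnd K m -> mbnd K (mstar m).
Proof.
move=> K0 hm a.
have : nr (lact (mstar m) a) ^+ 2 <= nr a * (K * nr (lact (mstar m) a)).
  rewrite -nr_starM star_lact mstarK; apply: le_trans (nrM _ _) _.
  by rewrite nr_star ler_wpM2l// nr_ge0.
have := nr_ge0 (lact (mstar m) a); have := nr_ge0 a.
move: (nr (lact (mstar m) a)) (nr a) => t s s0 t0 h.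
rewrite leNgt; apply/negP => lt.
have : 0 <= K * s by apply: mulr_ge0.
by nra.
Qed.

Lemma mbnd_nr A (K : R) (a : A) : 0 <= K -> mbnd K (minj a) -> nr a <= K.
Proof.
move=> K0 /(_ (star a)); rewrite lact_minj nr_Mstar nr_star.
have := nr_ge0 a; move: (nr a) => t t0 h.
rewrite leNgt; apply/negP => lt.
by nra.
Qed.

Lemma mbnd_lipl A (K : R) (m : multiplier A) : mbnd K m ->
  forall a b, nr (lact m a - lact m b) <= K * nr (a - b).
Proof. by move=> hm a b; rewrite -(lin_B (lact_linear m)). Qed.

Lemma mbnd_ract A (K : R) (m : multiplier A) a : 0 <= K -> mbnd K m ->
  nr (ract m a) <= K * nr a.
Proof.
move=> K0 hm; rewrite ractE nr_star -[nr a]nr_star.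
exact: mbnd_star.
Qed.

Lemma star_hom_mbnd A B (f : A -> multiplier B) a : star_hom f -> mbnd (nr a) (f a).
Proof. by move=> hf b; apply: star_hom_contractive. Qed.

End BoundedMultipliers.

Section ApproximateUnits.
Context {R : realType} {A : cstarAlgebra R}.
Implicit Types (a k u : A).

(** One has [|W a|^2 = |W a a^* W^*|], and one of the two outer contractions is dropped. So it is
    enough to make [W] small at the self-adjoint element [a a^*]. *)
Lemma mbnd_sqr_dist (W : multiplier A) a : mbnd 1 W ->
  nr (lact W a) ^+ 2 <= nr (lact W (a ** star a)).
Proof.
move=> hW; rewrite -nr_Mstar -lactMr.
apply: le_trans (hW _) _; rewrite mul1r -nr_star starM starK -lactMr.
by [].
Qed.

Lemma unital_contractionM (W W' : multiplier A) :
  (exists u, W = 1 - minj u) -> (exists u, W' = 1 - minj u) ->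
  exists u, W * W' = 1 - minj u.
Proof.
move=> [u ->] [u' ->]; exists (u + u' - u ** u').
rewrite mulrBl mul1r mulrBr mulr1 -minjM (lin_B minj_linear) (lin_D minj_linear).
zmod.
Qed.

(* Averaging the powers of the contraction [r = 1 - k^2] gives a contraction
   [W] in [1 - A] for which [W k^2] telescopes to [(1 - r^n) / n]. *)
Lemma unit_near_sa k (e : R) : star k = k -> nr k <= 1 -> 0 < e ->
  exists W : multiplier A,
    [/\ exists u, W = 1 - minj u, mbnd 1 W & nr (lact W k) <= e].
Proof.
move=> sk nk e0.
have [y [sy _ ey cy]] := sqrt_complement sk nk.
have ky : k ** y = y ** k by apply: cy; rewrite cs_mulA.
pose r : multiplier A := 1 - minj (k ** k).
(* [1 - k^2 = (1 - y)^2], and multiplication by [1 - y] is contractive. *)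
have r1 : mbnd 1 r.
  move=> z; rewrite mul1r.
  have U x := sqrt_complement_cartesian x sk sy ky ey.
  have [_ _ _ h1] := U z; have [_ _ _ h2] := U (z - y ** z).
  apply: le_trans _ h1; apply: le_trans _ h2.
  rewrite lactDl lactNl lact_minj lact1.
  rewrite (_ : k ** k = y + y - y ** y); last by rewrite -ey; zmod.
  rewrite cs_mulBl cs_mulDl cs_mulBr cs_mulA le_eqVlt; apply/orP; left; apply/eqP.
  by congr nr; zmod.
have rn n : mbnd 1 (r ^+ n) /\ exists u, r ^+ n = 1 - minj u.
  elim: n => [|n [b1 bu]].
    split; first exact: mbnd1.
    by exists 0; rewrite (lin_0 minj_linear) subr0.
  rewrite exprS; split; first by rewrite -[1]mulr1; apply: mbndM.
  by apply: unital_contractionM => //; exists (k ** k).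
have d0 : 0 < e ^+ 2 by rewrite exprn_gt0.
(* Chosen so that [|W k|^2 <= |W k^2| <= 2 / n <= e^2]. *)
pose n := (Num.bound (2 / e ^+ 2)).+1.
have n0 : (0 : R) < n%:R by rewrite ltr0n.
have hn : 2 / n%:R <= e ^+ 2.
  rewrite ler_pdivrMr// mulrC -ler_pdivrMr//.
  apply: le_trans (ltW (archi_boundP _)) _; first by rewrite divr_ge0// ltW.
  by rewrite ler_nat.
pose c : R[i] := (n%:R^-1 : R)%:C.
have c1 : complex.Re `|c| = n%:R^-1.
  by rewrite normc_def/= expr0n addr0 sqrtr_sqr ger0_norm// invr_ge0 ltW.
pose W := c *: \sum_(j < n) r ^+ j.
have W1 : mbnd 1 W.
  have -> : (1 : R) = complex.Re `|c| * n%:R by rewrite c1 mulVf// gt_eqF.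
  apply: mbndZ.
  elim: n {n0 hn c c1 W} => [|m IH].
    by move=> a; rewrite big_ord0 /= nr0 mul0r.
  rewrite big_ord_recr/= -natr1; apply: mbndD => //.
  by have [] := rn m.
exists W; split=> //.
  have [v hv] : exists v, \sum_(j < n) r ^+ j = n%:R - minj v.
    elim: n {n0 hn c c1 W W1} => [|m [v hv]].
      by exists 0; rewrite big_ord0 (lin_0 minj_linear) subr0.
    have [_ [u hu]] := rn m.
    exists (v + u); rewrite big_ord_recr/= hv hu (lin_D minj_linear) -natr1; zmod.
  exists (c *: v); rewrite /W hv scalerBr (lin_Z minj_linear); congr (_ - _).
  rewrite -[n%:R]/(1 *+ n) -scaler_nat scalerA.
  rewrite (_ : c * _ = 1) ?scale1r// /c fmorphV rmorph_nat mulVf//.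
  by rewrite pnatr_eq0.
have hk : nr (lact W (k ** k)) <= 2 / n%:R.
  apply: mbnd_nr; first by rewrite divr_ge0 ?ler0n.
  rewrite -mul_minj.
  have -> : minj (k ** k) = 1 - r by rewrite /r opprB addrC subrK.
  rewrite /W mscaleAl.
  have -> : (\sum_(j < n) r ^+ j) * (1 - r) = 1 - r ^+ n.
    elim: n {n0 hn c c1 W W1} => [|m IH]; first by rewrite big_ord0 mul0r subrr.
    rewrite big_ord_recr/= mulrDl IH mulrBr mulr1 -exprSr; zmod.
  rewrite mulrC -c1; apply: mbndZ.
  by apply: mbndD; [exact: mbnd1|apply: mbndN; have [] := rn n].
have := mbnd_sqr_dist k W1; rewrite sk => hs.
rewrite -(@ler_pXn2r _ 2) ?nnegrE ?nr_ge0 ?(ltW e0)//.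
by apply: le_trans hs (le_trans hk hn).
Qed.

Lemma unit_near a (e : R) : 0 < e -> exists W : multiplier A,
  [/\ exists u, W = 1 - minj u, mbnd 1 W & nr (lact W a) <= e].
Proof.
move=> e0.
have d0 : 0 < nr a ^+ 2 + 1 by rewrite ltr_wpDl// sqr_ge0.
(* Scaling by [t] turns [a a^*] into a contraction; the added 1 keeps the denominator positive when
   [a = 0]. *)
pose t : R := (nr a ^+ 2 + 1)^-1.
have t0 : 0 < t by rewrite invr_gt0.
pose k := t%:C *: (a ** star a).
have [|||W [hu W1 hk]] := @unit_near_sa k (t * e ^+ 2).
- by rewrite /k starZ conjc_real starM starK.
- rewrite /k nrZr nr_Mstar ger0_norm ?(ltW t0)// /t mulrC ler_pdivrMr//.
  by rewrite mul1r; lra.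
- by rewrite mulr_gt0// exprn_gt0.
exists W; split=> //.
rewrite -(@ler_pXn2r _ 2) ?nnegrE ?nr_ge0 ?(ltW e0)//.
apply: le_trans (mbnd_sqr_dist a W1) _.
move: hk; rewrite /k (lin_Z (lact_linear W)) nrZr ger0_norm ?(ltW t0)//.
by rewrite ler_pM2l.
Qed.

(** Elements are treated one at a time: multiplying on the left by a further contraction preserves
    the estimates already obtained. *)
Lemma left_unit_near (s : seq A) (e : R) : 0 < e -> exists W : multiplier A,
  [/\ exists u, W = 1 - minj u, mbnd 1 W &
      forall a, a \in s -> nr (lact W a) <= e].
Proof.
move=> e0; elim: s => [|a s [V [V0 V1 hV]]].
  exists 1; split=> //; last exact: mbnd1.
  by exists 0; rewrite (lin_0 minj_linear) subr0.
have [W [W0 W1 hW]] := unit_near (lact V a) e0.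
exists (W * V); split; first exact: unital_contractionM.
  by rewrite -[1]mulr1; apply: mbndM.
move=> b; rewrite inE lactM => /orP[/eqP -> //|/hV]; apply: le_trans.
by apply: le_trans (W1 _) _; rewrite mul1r.
Qed.

(** Taking [1 - u = W^* W], which is self-adjoint, makes the right-hand estimate at [a] the
    left-hand one at [a^*]; so [W] is chosen for the elements and their adjoints. *)
Lemma two_sided_unit_near (s : seq A) (e : R) : 0 < e -> exists u,
  mbnd 1 (1 - minj u) /\
  forall a, a \in s -> nr (a - u ** a) <= e /\ nr (a - a ** u) <= e.
Proof.
move=> e0; have [W [W0 W1 hW]] := left_unit_near (s ++ [seq star a | a <- s]) e0.
have V1 : mbnd 1 (mstar W) by apply: mbnd_star.
have V0 : exists u, mstar W = 1 - minj u.
  by have [u ->] := W0; exists (star u); rewrite mstarB mstar1 mstar_minj.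
have [u hu] := unital_contractionM V0 W0.
have hs a : a \in s ++ [seq star a | a <- s] -> nr (lact (1 - minj u) a) <= e.
  move=> /hW ha; rewrite -hu lactM; apply: le_trans (V1 _) _.
  by rewrite mul1r.
exists u; split; first by rewrite -hu -[1]mulr1; apply: mbndM.
move=> a sa; split.
  by apply: (hs a); rewrite mem_cat sa.
have -> : a - a ** u = ract (1 - minj u) a by [].
rewrite -hu ractE mstarM mstarK hu nr_star; apply: hs.
by rewrite mem_cat map_f ?orbT.
Qed.

(* The tail filter of an approximate unit of [A]. *)
Definition au : set_system A :=
  [set P | exists (s : seq A) (e : R), 0 < e /\
     forall u, mbnd 1 (1 - minj u) ->
       (forall a, a \in s -> nr (a - u ** a) <= e /\ nr (a - a ** u) <= e) -> P u].

Global Instance au_filter : ProperFilter au.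
Proof.
apply: Build_ProperFilter.
  move=> [s [e [e0 h]]].
  by have [u [u1 u2]] := two_sided_unit_near s e0; exact: (h u).
split; first by exists [::], 1.
- move=> P Q [s [e [e0 hP]]] [t [d [d0 hQ]]].
  exists (s ++ t), (Num.min e d); split; first by rewrite lt_min e0.
  move=> u u1 u2; split; [apply: hP|apply: hQ] => // a ha.
    have [] := u2 a ltac:(by rewrite mem_cat ha).
    by rewrite !le_min => /andP[-> _] /andP[-> _].
  have [] := u2 a ltac:(by rewrite mem_cat ha orbT).
  by rewrite !le_min => /andP[_ ->] /andP[_ ->].
- move=> P Q PQ [s [e [e0 hP]]]; exists s, e; split=> // u u1 u2.
  exact/PQ/hP.
Qed.

Lemma au_bnd : au [set u | nr u <= 2].
Proof.
exists [::], 1; split=> // u u1 _ /=; apply: mbnd_nr => // a.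
rewrite (_ : minj u = 1 - (1 - minj u)); last by zmod.
by apply: mbndD; [exact: mbnd1|apply: mbndN].
Qed.

Lemma au_l a : (fun u => u ** a) @ au --> a.
Proof.
apply/cvg_nrP => e e0; exists [:: a], (e / 2); split; first by lra.
by move=> u _ /(_ a); rewrite inE eqxx => /(_ isT) [h _] /=; lra.
Qed.

Lemma au_r a : (fun u => a ** u) @ au --> a.
Proof.
apply/cvg_nrP => e e0; exists [:: a], (e / 2); split; first by lra.
by move=> u _ /(_ a); rewrite inE eqxx => /(_ isT) [_ h] /=; lra.
Qed.

Lemma dense_mul : dense (lspan [set c | exists a b : A, c = a ** b]).
Proof.
apply: dense_lspanP => P cP sP SP a; apply: cP => e e0.
have /cvg_nrP/(_ e e0) h := @au_l a.
have [u /= hu] := filter_ex h.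
by exists (u ** a) => //; apply: SP; exists u, a.
Qed.

End ApproximateUnits.

Section UniformBoundedness.
Context {R : realType} {A : cstarAlgebra R}.

(* Since [b ** lact m z = ract m b ** z] is continuous in [z], the set of the
   [z] with [N < nr (lact m z)] is open. *)
Lemma unbounded_step (m : multiplier A) :
  (forall K : R, 0 <= K -> exists a, K * nr a < nr (lact m a)) ->
  forall (x : A) (r N : R), 0 < r -> 0 <= N -> exists (y : A) (s : R),
    [/\ 0 < s, s <= r / 2, nr (y - x) <= r / 2 &
        forall z, nr (z - y) <= s -> N < nr (lact m z)].
Proof.
move=> hm x r N r0 N0.
have mB := lin_B (lact_linear m); have mD := lin_D (lact_linear m).
have mZ := lin_Z (lact_linear m).
have [y yx yN] : exists2 y, nr (y - x) <= r / 2 & N < nr (lact m y).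
  have [a ha] := hm (N / (r / 2)) ltac:(apply: divr_ge0 => //; lra).
  have a0 : 0 < nr a.
    rewrite lt_neqAle nr_ge0 andbT eq_sym; apply/eqP => /nr_eq0 a0.
    by move: ha; rewrite a0 (lin_0 (lact_linear m)) !nr0 mulr0 ltxx.
  pose b := (r / 2 / nr a)%:C *: a.
  have rr : 0 < r / 2 / nr a by rewrite !divr_gt0.
  have nb : nr b = r / 2 by rewrite nrZr ger0_norm ?(ltW rr)// divfK// gt_eqF.
  have mb : N < nr (lact m b).
    rewrite mZ nrZr ger0_norm ?(ltW rr)//.
    rewrite -ltr_pdivrMl//; apply: le_lt_trans ha.
    rewrite le_eqVlt; apply/orP; left; apply/eqP.
    by field; rewrite !gt_eqF.
  (* [2 m b] is the difference of the values at [x + b] and [x - b], so one of these exceeds [N]. *)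
  have [h1|h1] := ltP N (nr (lact m (x + b))).
    by exists (x + b) => //; rewrite addrC addrA addNr add0r nb.
  exists (x - b); first by rewrite addrC addrA addNr add0r nrN nb.
  rewrite ltNge; apply/negP => h2.
  have : nr (lact m b + lact m b) <= N + N.
    have -> : lact m b + lact m b = lact m (x + b) - lact m (x - b).
      by rewrite mD mB; zmod.
    by apply: le_trans (nrD _ _) _; rewrite nrN lerD.
  have -> : lact m b + lact m b = (2 : R)%:C *: lact m b.
    by rewrite rmorph_nat scaler_nat mulr2n.
  by rewrite nrZr ger0_norm//; lra.
set c := star (lact m y).
pose M := nr (lact m y); have M0 : 0 < M by apply: le_lt_trans yN.
have d0 : 0 < nr (ract m c) + 1 by rewrite ltr_wpDl// nr_ge0.
(* On the ball of radius [s], [c m z] differs from [c m y], of norm [M^2], by at most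
   [(M - N) M / 2]; as [|c| = M], this leaves [|m z| > N]. *)
pose s := Num.min (r / 2) ((M - N) / 2 * M / (nr (ract m c) + 1)).
have s0 : 0 < s.
  rewrite lt_min; apply/andP; split; first by lra.
  rewrite divr_gt0// mulr_gt0// /M; move: yN; lra.
exists y, s; split=> //; first by rewrite ge_min lexx.
move=> z zy.
have h1 : nr (c ** lact m y) = M ^+ 2 by rewrite /c nr_starM.
have h2 : nr (c ** lact m y) <= nr (c ** lact m z) + nr (ract m c) * s.
  rewrite !multiplierP; apply: le_trans (nr_le_dist _ (ract m c ** z)) _.
  rewrite lerD2l -cs_mulBr; apply: le_trans (nrM _ _) _.
  by rewrite ler_wpM2l ?nr_ge0// nrB.
have h3 : nr (c ** lact m z) <= M * nr (lact m z).
  by apply: le_trans (nrM _ _) _; rewrite /c nr_star.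
have h4 : s * (nr (ract m c) + 1) <= (M - N) / 2 * M.
  by rewrite -ler_pdivlMr// ge_min lexx orbT.
have : N < M by [].
have := nr_ge0 (ract m c); move: h1 h2 h3 h4 s0 M0 {d0 zy}.
clearbody s; clearbody M.
move: (nr (c ** lact m y)) (nr (c ** lact m z)) (nr (ract m c)) (nr (lact m z)) s M.
move=> p q u v s' M' -> h2 h3 h4 s0 M0 u0 NM.
rewrite ltNge; apply/negP => vN.
have : M' * v <= M' * N by rewrite ler_pM2l.
have : 0 < M' * (M' - N) by rewrite mulr_gt0// subr_gt0.
nra.
Qed.

(** The Banach-Steinhaus argument with nested balls: if [m] were unbounded, [unbounded_step] would
    give shrinking balls on the successive ones of which [|m z|] exceeds 0, 1, 2 and so on, and
    their common point is absurd. *)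
Lemma multiplier_bounded (m : multiplier A) : exists2 K : R, 0 <= K & mbnd K m.
Proof.
apply: contrapT => /forall2NP nb.
have hm (K : R) : 0 <= K -> exists a, K * nr a < nr (lact m a).
  move=> K0; have [//|/existsNP[a ha]] := nb K.
  by exists a; rewrite ltNge; apply/negP.
have /choice[st hst] (p : (A * R) * nat) : exists q : A * R, 0 < p.1.2 ->
    [/\ 0 < q.2, q.2 <= p.1.2 / 2, nr (q.1 - p.1.1) <= p.1.2 / 2 &
        forall z, nr (z - q.1) <= q.2 -> p.2%:R < nr (lact m z)].
  have [r0|r0] := ltP 0 p.1.2; last by exists p.1; lra.
  have [y [s h]] := unbounded_step hm p.1.1 r0 (ler0n _ p.2).
  by exists (y, s).
pose u := fix u n : A * R := if n is k.+1 then st (u k, k) else (0, 1).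
have u0 n : 0 < (u n).2.
  by elim: n => //= n IH; have [] := hst (u n, n) IH.
have uS n := hst (u n, n) (u0 n).
have ub n : (u n).2 <= 2 * n.+1%:R^-1.
  suff : (u n).2 <= n.+1%:R^-1.
    by move/le_trans; apply; rewrite ler_peMl ?invr_ge0// ler1n.
  elim: n => [|n IH]; first by rewrite /= invr1.
  have h : (u n.+1).2 <= (u n).2 / 2 by have [] := uS n.
  apply: le_trans h _.
  apply: le_trans (_ : n.+1%:R^-1 / 2 <= _); first by rewrite ler_pM2r ?invr_gt0.
  rewrite -invfM lef_pV2 ?posrE ?mulr_gt0 ?ltr0n//.
  by rewrite -natrM ler_nat muln2 -addnn addSn addnS !ltnS leq_addr.
have nest n k z : nr (z - (u (n + k)%N).1) <= (u (n + k)%N).2 -> nr (z - (u n).1) <= (u n).2.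
  elim: k z => [|k IH] z; first by rewrite addn0.
  rewrite addnS => hz; apply: IH.
  have [_ h1 h2 _] := uS (n + k)%N; rewrite /= in hz h1 h2.
  apply: le_trans (nrDB z (st (u (n + k)%N, (n + k)%N)).1 _) _.
  by move: hz h1 h2; lra.
have [y [_ hy]] : exists y : A, (fun n => (u n).1) @ \oo --> y /\
    forall n, nr ((u n).1 - y) <= (u n).2.
  apply: nr_cauchy.
    apply: (@squeeze_cvgr _ _ _ _ (fun=> 0) (fun n => 2 * n.+1%:R^-1)).
    - by exists 0%N => // n _ /=; rewrite (ltW (u0 n)) ub.
    - exact: cvg_cst.
    - rewrite -[X in _ --> X](mulr0 (2 : R)).
      by apply: cvgM; [exact: cvg_cst|exact: cvg_harmonic].
  move=> n k nk; rewrite nrB; have := nest n (k - n)%N (u k).1.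
  by rewrite subnKC// subrr nr0; apply; apply: ltW.
have big n : n%:R < nr (lact m y).
  have [_ _ _ h] := uS n; apply: h.
  by rewrite nrB; exact: (hy n.+1).
have := archi_boundP (nr_ge0 (lact m y)).
by apply/negP; rewrite -leNgt ltW.
Qed.

Lemma cvg_lact T (F : set_system T) (f : T -> A) (x : A) (m : multiplier A)
    {FF : Filter F} :
  f @ F --> x -> (fun t => lact m (f t)) @ F --> lact m x.
Proof.
have [K K0 hK] := multiplier_bounded m.
move=> h; apply: (cvg_dom (K := K) h).
by apply: nearW => t /=; exact: mbnd_lipl.
Qed.

Lemma cvg_ract T (F : set_system T) (f : T -> A) (x : A) (m : multiplier A)
    {FF : Filter F} :
  f @ F --> x -> (fun t => ract m (f t)) @ F --> ract m x.
Proof.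
move=> h; rewrite ractE.
rewrite (_ : (fun t => _) = fun t => star (lact (mstar m) (star (f t)))).
  by apply: cvg_star; apply: cvg_lact; exact: cvg_star.
by apply/funext => t; rewrite ractE.
Qed.

End UniformBoundedness.

(** * Strict completeness and extension *)

Section StrictCompleteness.
Context {R : realType} {X : cstarAlgebra R}.

Lemma dense_setT : dense (lspan (@setT X)).
Proof. by apply/dense_near => x e e0; exists x; [exact: subset_lspan|rewrite subrr nr0]. Qed.

Lemma lact_converges T (F : set_system T) {FF : ProperFilter F}
    (phi : T -> multiplier X) (K : R) (S : set X) : 0 <= K ->
  F [set t | mbnd K (phi t)] -> dense (lspan S) ->
  (forall x, S x -> exists y : X, (fun t => lact (phi t) x) @ F --> y) ->
  forall x, exists y : X, (fun t => lact (phi t) x) @ F --> y.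
Proof.
move=> K0 bK dS hS; apply: (dense_ind dS) hS.
  move=> x hx; apply: nr_complete => e e0.
  have d0 : 0 < e / 2 / (K + 1) by rewrite !divr_gt0// ltr_wpDl.
  have [x' [y' /cvg_nrP/(_ (e / 2))]] := hx _ d0.
  move=> /(_ ltac:(lra)) h xx'; exists y'.
  apply: filterS2 h bK => t /= h1 h2.
  apply: le_lt_trans (nrDB _ (lact (phi t) x') _) _.
  rewrite ltr_pdivlMr ?ltr_wpDl// in xx'.
  have := mbnd_lipl h2 x' x; rewrite [nr (x' - x)]nrB.
  by have := nr_ge0 (x - x'); nra.
split; first by exists 0; rewrite (_ : (fun t => _) = fun=> 0);
  [exact: cvg_cst|apply/funext => t; rewrite (lin_0 (lact_linear (phi t)))].
move=> k x x' [y hy] [y' hy']; exists (k *: y + y').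
rewrite (_ : (fun t => _) = fun t => k *: lact (phi t) x + lact (phi t) x').
  by apply: cvgD => //; exact: cvgZr.
by apply/funext => t; exact: lact_linear.
Qed.

Lemma strict_complete T (F : set_system T) {FF : ProperFilter F}
    (phi : T -> multiplier X) (K : R) (S S' : set X) : 0 <= K ->
  F [set t | mbnd K (phi t)] -> dense (lspan S) -> dense (lspan S') ->
  (forall x, S x -> exists y : X, (fun t => lact (phi t) x) @ F --> y) ->
  (forall x, S' x -> exists y : X, (fun t => lact (mstar (phi t)) x) @ F --> y) ->
  exists2 m, strict_cvg (phi @ F) m & mbnd K m.
Proof.
move=> K0 bK dS dS' hS hS'.
have [l hl] := choice (lact_converges K0 bK dS hS).
have bK' : F [set t | mbnd K (mstar (phi t))].
  by apply: filterS bK => t; exact: mbnd_star.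
have [r hr] := choice (lact_converges K0 bK' dS' hS').
have hr' a : (fun t => ract (phi t) a) @ F --> star (r (star a)).
  rewrite (_ : (fun t => _) = fun t => star (lact (mstar (phi t)) (star a))).
    by apply: cvg_star; exact: hr.
  by apply/funext => t; rewrite ractE.
have mP a b : a ** l b = star (r (star a)) ** b.
  apply: (cvg_uniq (F := F) (f := fun t => a ** lact (phi t) b)).
    by apply: cvg_mull; exact: hl.
  rewrite (_ : (fun t => _) = fun t => ract (phi t) a ** b).
    by apply: cvg_mulr; exact: hr'.
  by apply/funext => t; rewrite multiplierP.
exists (Multiplier mP).
  by move=> a; split; [exact: hl|exact: hr'].
by move=> a; apply: (nr_cvg_le (hl a)); apply: filterS bK => t; exact.
Qed.

Lemma strict_cvg_unique T (F : set_system T) {FF : ProperFilter F}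
    (phi : T -> multiplier X) (m n : multiplier X) :
  strict_cvg (phi @ F) m -> strict_cvg (phi @ F) n -> m = n.
Proof.
move=> hm hn; apply: lact_ext => a.
exact: (cvg_uniq (F := F) (f := fun t => lact (phi t) a) (proj1 (hm a)) (proj1 (hn a))).
Qed.

End StrictCompleteness.

Section ContractiveExtension.
Context {R : realType} {D X : cstarAlgebra R} (S : D -> multiplier X -> Prop).
Hypothesis S_lin : forall k z m z' m', S z m -> S z' m' -> S (k *: z + z') (k *: m + m').
Hypothesis S_mul : forall z m z' m', S z m -> S z' m' -> S (z ** z') (m * m').
Hypothesis S_star : forall z m, S z m -> S (star z) (mstar m).
Hypothesis S_bnd : forall z m, S z m -> mbnd (nr z) m.
Hypothesis S_dense : forall z (e : R), 0 < e -> exists z' m', S z' m' /\ nr (z - z') < e.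

(** The norm closure of the graph [S], with operator bounds in the second component. *)
Let cl z m := forall e : R, 0 < e -> exists z' m',
  [/\ S z' m', nr (z - z') <= e & mbnd e (m - m')].

Let cl_S z m : S z m -> cl z m.
Proof.
move=> zm e e0; exists z, m; split=> //; first by rewrite subrr nr0 ltW.
by move=> a; rewrite subrr/= nr0 mulr_ge0 ?nr_ge0 ?ltW.
Qed.

Let cl_lin k z m z' m' : cl z m -> cl z' m' -> cl (k *: z + z') (k *: m + m').
Proof.
move=> h h' e e0.
have k0 : 0 <= complex.Re `|k| by rewrite -ler0c RRe_real// normr_real.
have d0 : 0 < e / 2 / (complex.Re `|k| + 1) by rewrite !divr_gt0// ltr_wpDl.
have e2 : 0 < e / 2 by lra.
have kd : complex.Re `|k| * (e / 2 / (complex.Re `|k| + 1)) <= e / 2.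
  by rewrite mulrCA ger_pMr// ler_pdivrMr ?ltr_wpDl// mul1r lerDl.
have [w [n [Swn zw mn]]] := h _ d0; have [w' [n' [Swn' zw' mn']]] := h' _ e2.
exists (k *: w + w'), (k *: n + n'); split; first exact: S_lin.
  have -> : k *: z + z' - (k *: w + w') = k *: (z - w) + (z' - w').
    by rewrite scalerBr; zmod.
  apply: le_trans (nrD _ _) _; rewrite nrZ.
  have : complex.Re `|k| * nr (z - w) <= e / 2 by apply: le_trans kd; rewrite ler_wpM2l.
  by lra.
have -> : k *: m + m' - (k *: n + n') = k *: (m - n) + (m' - n').
  by rewrite scalerBr; zmod.
apply: mbnd_le (mbndD (mbndZ k mn) mn'); lra.
Qed.

Let cl_bnd z m : cl z m -> mbnd (nr z) m.
Proof.
move=> h a; apply/ler_addgt0Pr => e e0.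
have d0 : 0 < e / 2 / (nr a + 1) by rewrite !divr_gt0// ltr_wpDl// nr_ge0.
have [z' [m' [/S_bnd/(_ a) b zz /(_ a)]]] := h _ d0.
rewrite lactDl lactNl => mm.
apply: le_trans (nr_le_dist _ (lact m' a)) _.
have a0 := nr_ge0 a.
have da : e / 2 / (nr a + 1) * nr a <= e / 2.
  by rewrite -mulrA ger_pMr ?ltr_wpDl// 1?mulrC ?ler_pdivrMr ?ltr_wpDl// ?mul1r ?lerDl//; lra.
have : nr z' <= nr z + e / 2 / (nr a + 1).
  by apply: le_trans (nr_le_dist _ z) _; rewrite lerD2l nrB.
by move: (e / 2 / _) da b mm => d; nra.
Qed.

Let cl_uniq z m n : cl z m -> cl z n -> m = n.
Proof.
move=> hm hn; have := cl_bnd (cl_lin (-1) hm hn).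
rewrite !scaleN1r addNr nr0 => h; apply: lact_ext => a.
have := h a; rewrite mul0r lactDl lactNl => h0.
apply/eqP; rewrite eq_sym -subr_eq0 addrC; apply/eqP/nr_eq0/le_anti.
by rewrite nr_ge0 h0.
Qed.

Let cl_mul z m w n : cl z m -> cl w n -> cl (z ** w) (m * n).
Proof.
move=> hz hw e e0.
have z0 := nr_ge0 z; have w0 := nr_ge0 w.
have L0 : 0 < nr z + nr w + 2 by lra.
pose d := Num.min 1 (e / (nr z + nr w + 2)).
have d0 : 0 < d by rewrite lt_min ltr01 divr_gt0.
have d1 : d <= 1 by rewrite ge_min lexx.
have de : d * (nr z + nr w + 2) <= e by rewrite -ler_pdivlMr// ge_min lexx orbT.
have [z' [m' [Sz zz mm]]] := hz _ d0; have [w' [n' [Sw ww nn]]] := hw _ d0.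
clearbody d.
have z'b : nr z' <= nr z + d.
  by apply: le_trans (nr_le_dist _ z) _; rewrite lerD2l nrB.
exists (z' ** w'), (m' * n'); split; first exact: S_mul.
  have -> : z ** w - z' ** w' = (z - z') ** w + z' ** (w - w').
    by rewrite cs_mulBl cs_mulBr addrA subrK.
  apply: le_trans (nrD _ _) _.
  have := nrM (z - z') w; have := nrM z' (w - w').
  have := nr_ge0 (z - z'); have := nr_ge0 (w - w'); have := nr_ge0 z'.
  by nra.
have -> : m * n - m' * n' = (m - m') * n + m' * (n - n').
  by rewrite mulrBl mulrBr addrA subrK.
apply: mbnd_le (mbndD (mbndM (ltW d0) mm (cl_bnd hw))
  (mbndM (nr_ge0 z') (S_bnd Sz) nn)).
by nra.
Qed.

Let cl_star z m : cl z m -> cl (star z) (mstar m).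
Proof.
move=> h e e0; have [z' [m' [Sz zz mm]]] := h e e0.
exists (star z'), (mstar m'); split; first exact: S_star.
  by rewrite -starB nr_star.
by rewrite -mstarB; apply: mbnd_star => //; exact: ltW.
Qed.

(** Images of approximants at distance [1 / (n + 1)] form a Cauchy sequence for the operator bounds.
    It converges strictly, and the rate given by [nr_cauchy], linear in [|x|], turns pointwise
    convergence back into an operator bound. *)
Let cl_exists z : exists m, cl z m.
Proof.
pose h n : R := n.+1%:R^-1.
have h0 n : 0 < h n by rewrite invr_gt0 ltr0n.
have hmono n k : (n <= k)%N -> h k <= h n.
  by move=> nk; rewrite lef_pV2 ?posrE ?ltr0n// ler_nat.
have hcvg (c : R) : (fun n => c * h n) @ \oo --> (0 : R).
  rewrite -[X in _ --> X](mulr0 c).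
  by apply: cvgM; [exact: cvg_cst|exact: cvg_harmonic].
have /choice[s hs] n : exists p : D * multiplier X, S p.1 p.2 /\ nr (z - p.1) < h n.
  by have [z' [m' H]] := S_dense z (h0 n); exists (z', m').
have dist n k : (n <= k)%N -> mbnd (2 * h n) ((s n).2 - (s k).2).
  move=> nk; have [S1 z1] := hs n; have [S2 z2] := hs k.
  have := S_bnd (S_lin (-1) S2 S1); rewrite !scaleN1r ![- _ + _]addrC.
  apply: mbnd_le; apply: le_trans (nrDB _ z _) _.
  by have := hmono _ _ nk; rewrite nrB; lra.
have sb : \oo [set n | mbnd (nr z + 1) (s n).2].
  exists 0%N => // n _ /=; have [S1 z1] := hs n.
  apply: mbnd_le (S_bnd S1); apply: le_trans (nr_le_dist _ z) _.
  have := hmono 0%N n (leq0n n); rewrite nrB.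
  have -> : h 0%N = 1 by rewrite /h invr1.
  by move: (h n) z1 => v; lra.
have z0 : 0 <= nr z + 1 by rewrite addr_ge0// nr_ge0.
have cau (f : nat -> multiplier X) :
    (forall n k, (n <= k)%N -> mbnd (2 * h n) (f n - f k)) ->
    forall x, exists y : X, (fun n => lact (f n) x) @ \oo --> y /\
      forall n, nr (lact (f n) x - y) <= 2 * nr x * h n.
  move=> hf x; apply: nr_cauchy; first exact: hcvg.
  move=> n k nk; have := hf n k nk x; rewrite lactDl lactNl.
  by rewrite mulrAC.
have dist' n k : (n <= k)%N -> mbnd (2 * h n) (mstar (s n).2 - mstar (s k).2).
  move=> nk; rewrite -mstarB; apply: mbnd_star; last exact: dist.
  by rewrite mulr_ge0// ltW.
have [m hm _] := strict_complete z0 sb dense_setT dense_setT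
  (fun x _ => let: ex_intro y (conj h _) := cau _ dist x in ex_intro _ y h)
  (fun x _ => let: ex_intro y (conj h _) := cau _ dist' x in ex_intro _ y h).
exists m => e e0.
have [N hN] : exists N, 2 * h N <= e.
  have e2 : 0 <= 2 / e by rewrite divr_ge0// ltW.
  exists (Num.bound (2 / e)); rewrite /h ler_pdivrMr ?ltr0n// mulrC -ler_pdivrMr//.
  apply: ltW; apply: lt_le_trans (archi_boundP e2) _.
  by rewrite ler_nat.
have [SN zN] := hs N; exists (s N).1, (s N).2; split=> //.
  by have := h0 N; lra.
move=> x; have [y [hy hyN]] := cau _ dist x.
have -> : lact (m - (s N).2) x = y - lact (s N).2 x.
  rewrite lactDl lactNl; congr (_ - _).
  exact: (cvg_uniq (F := \oo) (f := fun n => lact (s n).2 x) (proj1 (hm x)) hy).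
rewrite nrB; apply: le_trans (hyN N) _.
by rewrite mulrAC ler_wpM2r// nr_ge0.
Qed.

(** [S] is a relation because an element of [D] may have many presentations. Contractivity, applied
    to a difference of two pairs over the same element, shows that its closure is single-valued. *)
Lemma contractive_extension : exists2 f : D -> multiplier X,
  star_hom f & forall z m, S z m -> f z = m.
Proof.
have [f hf] := choice cl_exists; exists f.
  split=> [k x y|x y|x]; apply: cl_uniq (hf _) _.
  - exact: cl_lin.
  - exact: cl_mul.
  - exact: cl_star.
by move=> z m /cl_S; apply: cl_uniq (hf z).
Qed.

End ContractiveExtension.

Section PowerBound.
Context {R : realType} {D X : cstarAlgebra R} (S : D -> multiplier X -> Prop).

(* The C*-identity improves a bound [C] to [sqrt C], whatever [C] is. *)
Lemma power_bound (C : R) :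
  (forall z m, S z m -> S (star z ** z) (mstar m * m)) ->
  (forall z m, S z m -> mbnd (C * nr z) m) ->
  forall z m, S z m -> mbnd (nr z) m.
Proof.
move=> Ssq SC z m Szm w.
apply: (@pow_le_const _ _ _ C); [exact: nr_ge0|by rewrite mulr_ge0 ?nr_ge0|].
move=> k; elim: k z m Szm w => [|k IH] z m Szm w.
  by rewrite expn0 !expr1 mulrA; exact: SC.
rewrite expnS !exprM.
have h1 : nr (lact m w) ^+ 2 <= nr w * nr (lact (mstar m * m) w).
  by rewrite -nr_starM star_lact lactM; apply: le_trans (nrM _ _) _; rewrite nr_star.
have := IH _ _ (Ssq _ _ Szm) w; rewrite nr_starM => h2.
have n0 : 0 <= nr w ^+ (2 ^ k) by rewrite exprn_ge0// nr_ge0.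
apply: le_trans (_ : (nr w * nr (lact (mstar m * m) w)) ^+ (2 ^ k) <= _).
  by rewrite lerXn2r// nnegrE ?exprn_ge0 ?mulr_ge0 ?nr_ge0.
rewrite exprMn; apply: le_trans (ler_wpM2l n0 h2) _.
rewrite mulrCA; rewrite -exprMn le_eqVlt; apply/orP; left; apply/eqP.
by congr (_ * _ ^+ _); ring.
Qed.

End PowerBound.

Section Subcross.
Context {R : realType} {A B D : cstarAlgebra R} (t : A -> B -> D).
Hypothesis t_linl : forall b, linear (t^~ b).
Hypothesis t_linr : forall a, linear (t a).
Hypothesis t_mul : forall a a' b b', t a b ** t a' b' = t (a ** a') (b ** b').
Hypothesis t_star : forall a b, star (t a b) = t (star a) (star b).

(** With [a] and [b] moved out one at a time by [cyclic_bound], [|t a b|^2 = |t (a^* a) (b^* b)| <=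
    |a| |b| |t a b|]. *)
Lemma subcross a b : nr (t a b) <= nr a * nr b.
Proof.
have hl x y a' : nr (t (x ** a') y) <= nr x * nr (t a' y).
  apply: (cyclic_bound (rho := fun x => t (x ** a') y)).
  - by move=> k u v; rewrite cs_mulDl cs_scaleAl t_linl.
  - by move=> u v; rewrite !t_star !t_mul starM !cs_mulA.
  - by move=> u; rewrite !t_star !t_mul starM !cs_mulA.
have hr x y b' : nr (t x (y ** b')) <= nr y * nr (t x b').
  apply: (cyclic_bound (rho := fun y => t x (y ** b'))).
  - by move=> k u v; rewrite cs_mulDl cs_scaleAl t_linr.
  - by move=> u v; rewrite !t_star !t_mul starM !cs_mulA.
  - by move=> u; rewrite !t_star !t_mul starM !cs_mulA.
have h : nr (t a b) ^+ 2 <= nr a * nr b * nr (t a b).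
  rewrite -nr_starM t_star t_mul; apply: le_trans (hl _ _ _) _.
  rewrite nr_star -mulrA ler_wpM2l ?nr_ge0//.
  by apply: le_trans (hr _ _ _) _; rewrite nr_star.
have t0 := nr_ge0 (t a b); have := mulr_ge0 (nr_ge0 a) (nr_ge0 b).
move: (nr (t a b)) (nr a * nr b) t0 h => u v u0 h v0.
by rewrite leNgt; apply/negP => lt; nra.
Qed.

Lemma tens_cvgr T (F : set_system T) {FF : Filter F} (f : T -> B) a b :
  f @ F --> b -> (fun x => t a (f x)) @ F --> t a b.
Proof.
move=> h; apply: (cvg_dom (K := nr a) h); apply: nearW => x /=.
by rewrite -(lin_B (t_linr a)); exact: subcross.
Qed.

End Subcross.

Section StrictConvergence.
Context {R : realType} {A : cstarAlgebra R}.

Lemma strict_cvg_mstar (F : set_system (multiplier A)) (m : multiplier A)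
    {FF : Filter F} : strict_cvg F m -> strict_cvg (mstar @ F) (mstar m).
Proof.
move=> h a; have [hl hr] := h (star a).
split; first exact: cvg_star.
exact: (cvg_star hl).
Qed.

Lemma approx_mult (m : multiplier A) :
  strict_cvg ((fun u => minj (lact m u)) @ au) m.
Proof.
move=> a; split.
  apply: (cvg_congr (F := au) (f := fun u => lact m (u ** a))
    (g := fun u => lact (minj (lact m u)) a)).
    by move=> u; rewrite lactMr.
  by apply: cvg_lact; exact: au_l.
apply: (cvg_congr (F := au) (f := fun u => ract m a ** u)
  (g := fun u => ract (minj (lact m u)) a)).
  by move=> u; rewrite ract_minj multiplierP.
exact: au_r.
Qed.

Lemma approx_mult_bnd (m : multiplier A) (K : R) : 0 <= K -> mbnd K m ->
  au [set u : A | nr (lact m u) <= K * 2].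
Proof.
move=> K0 hK; apply: filterS au_bnd => u /= hu.
by apply: le_trans (hK u) _; rewrite ler_wpM2l.
Qed.

Lemma bounded_cvg T (F : set_system T) {FF : Filter F}
    (phi : T -> multiplier A) (m : multiplier A) (K : R) (S : set A) : 0 <= K ->
  F [set t | mbnd K (phi t)] -> mbnd K m -> dense (lspan S) ->
  (forall x, S x -> (fun t => lact (phi t) x) @ F --> lact m x) ->
  forall x, (fun t => lact (phi t) x) @ F --> lact m x.
Proof.
move=> K0 bK mK dS hS; apply: (dense_ind dS) hS.
  move=> x hx; apply/cvg_nrP => e e0.
  have d0 : 0 < e / 3 / (K + 1) by rewrite !divr_gt0// ltr_wpDl.
  have [x' /cvg_nrP/(_ (e / 3))] := hx _ d0.
  move=> /(_ ltac:(lra)) h xx'.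
  apply: filterS2 h bK => t /= h1 h2.
  apply: le_lt_trans (nrDB _ (lact m x') _) _.
  have := nrDB (lact m x') (lact (phi t) x') (lact (phi t) x).
  rewrite ltr_pdivlMr ?ltr_wpDl// in xx'.
  have := mbnd_lipl h2 x' x; rewrite [nr (x' - x)]nrB.
  have := mbnd_lipl mK x x'.
  by have := nr_ge0 (x - x'); nra.
split.
  rewrite (lin_0 (lact_linear m)) (_ : (fun t => _) = fun=> 0); first exact: cvg_cst.
  by apply/funext => t; rewrite (lin_0 (lact_linear (phi t))).
move=> k x x' hy hy'; rewrite lact_linear.
rewrite (_ : (fun t => _) = fun t => k *: lact (phi t) x + lact (phi t) x').
  by apply: cvgD => //; exact: cvgZr.
by apply/funext => t; exact: lact_linear.
Qed.

End StrictConvergence.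

Section StrictMaps.
Context {R : realType}.
Implicit Types A B C : cstarAlgebra R.

(* Strict continuity is required on all bounded sets, and boundedness is built
   in, so that these maps compose. *)
Definition smap A B (F : multiplier A -> multiplier B) :=
  [/\ linear F,
      forall K : R, 0 <= K ->
        exists2 L : R, 0 <= L & forall m, mbnd K m -> mbnd L (F m) &
      forall (FF : set_system (multiplier A)) m, Filter FF ->
        (exists K : R, FF (mbnd K)) -> strict_cvg FF m -> strict_cvg (F @ FF) (F m)].

Lemma mult_star_hom_minj A B (F : multiplier A -> multiplier B) :
  mult_star_hom F -> star_hom (fun a => F (minj a)).
Proof.
move=> [Fl FM Fs]; split=> [k x y|x y|x].
- by rewrite minj_linear Fl.
- by rewrite minjM FM.
- by rewrite -mstar_minj Fs.
Qed.

(** [mult_strict] concerns the unit ball, so bounded nets are rescaled into it. Boundedness comes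
    from contractivity on [A] along the net [m u], the factor 2 being the bound of the approximate
    unit. *)
Lemma strict_smap A B (F : multiplier A -> multiplier B) :
  mult_star_hom F -> mult_strict F -> smap F.
Proof.
move=> Fh Fs; have [Fl _ _] := Fh.
have str (FF : set_system (multiplier A)) m : Filter FF ->
    (exists K : R, FF (mbnd K)) -> strict_cvg FF m -> strict_cvg (F @ FF) (F m).
  move=> fF [K hK] hm; have [K' K'0 hK'] := multiplier_bounded m.
  pose L : R := `|K| + K' + 1.
  have L0 : 0 < L by rewrite ltr_wpDl// addr_ge0.
  pose c : R[i] := (L^-1)%:C.
  have c0 : c != 0.
    by rewrite gt_eqF// /c ltcR invr_gt0.
  have cn : complex.Re `|c| = L^-1.
    by rewrite normc_def/= expr0n addr0 sqrtr_sqr ger0_norm// invr_ge0 ltW.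
  have sc (n : multiplier A) M : mbnd M n -> M <= L -> mult_ball (c *: n).
    move=> hn ML; rewrite mbnd1E.
    apply: mbnd_le (mbndZ c hn); rewrite cn mulrC ler_pdivrMr// mul1r//.
  have h : strict_cvg ((fun n => F (c *: n)) @ FF) (F (c *: m)).
    apply: (Fs ((fun n => c *: n) @ FF)).
    - apply: (@filterS _ FF _ _ _ _ hK) => n /= hn; apply: (sc n K hn).
      by rewrite /L; have := ler_norm K; lra.
    - apply: (sc m K' hK'); rewrite /L; have := normr_ge0 K; lra.
    - by move=> a; have [h1 h2] := hm a; split; exact: cvgZr.
  have e n : F n = c^-1 *: F (c *: n) by rewrite (lin_Z Fl) scalerA mulVf// scale1r.
  move=> a; have [h1 h2] := h a; rewrite e; split.
    apply: (cvg_congr (F := FF) (f := fun n => c^-1 *: lact (F (c *: n)) a)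
      (g := fun n => lact (F n) a)); first by move=> n; rewrite [in LHS]e.
    exact: cvgZr.
  apply: (cvg_congr (F := FF) (f := fun n => c^-1 *: ract (F (c *: n)) a)
    (g := fun n => ract (F n) a)); first by move=> n; rewrite [in LHS]e.
  exact: cvgZr.
split=> // K K0; exists (K * 2); first by rewrite mulr_ge0.
move=> m hm w.
have h : strict_cvg (F @ ((fun u => minj (lact m u)) @ au)) (F m).
  apply: str; last exact: approx_mult.
  exists (K * 2); apply: filterS (approx_mult_bnd K0 hm) => u /= hu.
  by apply: mbnd_le hu _; exact: mbnd_minj.
apply: (nr_cvg_le (proj1 (h w))); apply: filterS (approx_mult_bnd K0 hm) => u /= hu.
apply: le_trans (star_hom_contractive (mult_star_hom_minj Fh) _ _) _.
by rewrite ler_wpM2r// nr_ge0.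
Qed.

Lemma smap_id A : smap (@id (multiplier A)).
Proof. by split=> // K K0; exists K. Qed.

Lemma smap_comp A B C (F : multiplier A -> multiplier B) (G : multiplier B -> multiplier C) :
  smap F -> smap G -> smap (fun m => G (F m)).
Proof.
move=> [Fl Fb Fs] [Gl Gb Gs]; split.
- by move=> k m n; rewrite Fl Gl.
- move=> K /Fb[L L0 hF]; have [M M0 hG] := Gb L L0.
  by exists M => // m /hF/hG.
- move=> FF m fF [K hK] hm.
  have hK' : FF (mbnd `|K|) by apply: filterS hK => n; apply: mbnd_le; exact: ler_norm.
  have [L L0 hL] := Fb `|K| (normr_ge0 _).
  apply: (Gs (F @ FF)); last by apply: Fs => //; exists K.
  by exists L; apply: (@filterS _ FF _ _ _ _ hK') => n /hL.
Qed.

Lemma smap_add A B (F G : multiplier A -> multiplier B) :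
  smap F -> smap G -> smap (fun m => F m + G m).
Proof.
move=> [Fl Fb Fs] [Gl Gb Gs]; split.
- by move=> k m n; rewrite Fl Gl scalerDr; zmod.
- move=> K K0; have [L L0 hL] := Fb K K0; have [M M0 hM] := Gb K K0.
  exists (L + M); first exact: addr_ge0.
  by move=> m hm; apply: mbndD; [exact: hL|exact: hM].
- move=> FF m fF hK hm a; have [f1 f2] := Fs FF m fF hK hm a.
  by have [g1 g2] := Gs FF m fF hK hm a; split; exact: cvgD.
Qed.

Lemma smap_mull A B (F : multiplier A -> multiplier B) n :
  smap F -> smap (fun m => n * F m).
Proof.
move=> [Fl Fb Fs]; split.
- by move=> k m m'; rewrite Fl mulrDr mscaleAr.
- move=> K K0; have [L L0 hL] := Fb K K0; have [M M0 hM] := multiplier_bounded n.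
  exists (M * L); first exact: mulr_ge0.
  by move=> m /hL; exact: mbndM.
- move=> FF m fF hK hm a; have [f1 _] := Fs FF m fF hK hm a.
  have [_ f2] := Fs FF m fF hK hm (ract n a).
  by split; [exact: (cvg_lact (m := n) f1)|exact: f2].
Qed.

Lemma smap_mulr A B (F : multiplier A -> multiplier B) n :
  smap F -> smap (fun m => F m * n).
Proof.
move=> [Fl Fb Fs]; split.
- by move=> k m m'; rewrite Fl mulrDl mscaleAl.
- move=> K K0; have [L L0 hL] := Fb K K0; have [M M0 hM] := multiplier_bounded n.
  exists (L * M); first exact: mulr_ge0.
  by move=> m /hL h; exact: mbndM.
- move=> FF m fF hK hm a; have [_ f2] := Fs FF m fF hK hm a.
  have [f1 _] := Fs FF m fF hK hm (lact n a).
  by split; [exact: f1|exact: (cvg_ract (m := n) f2)].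
Qed.

(** Every multiplier [m] is the strict limit of the bounded net [m u] in [A]. *)
Lemma smap_uniq A B (F G : multiplier A -> multiplier B) :
  smap F -> smap G -> (forall a, F (minj a) = G (minj a)) -> forall m, F m = G m.
Proof.
move=> [_ _ Fs] [_ _ Gs] FG m.
have [K K0 hK] := multiplier_bounded m.
have bd : exists K : R, ((fun u => minj (lact m u)) @ au) (mbnd K).
  exists (K * 2); apply: filterS (approx_mult_bnd K0 hK) => u /= hu.
  by apply: mbnd_le hu _; exact: mbnd_minj.
have fF : Filter ((fun u => minj (lact m u)) @ au) by typeclasses eauto.
have hF := Fs _ _ fF bd (approx_mult m).
have hG := Gs _ _ fF bd (approx_mult m).
have hG' : strict_cvg ((fun u => F (minj (lact m u))) @ au) (G m).
  have -> : (fun u => F (minj (lact m u))) = fun u => G (minj (lact m u)).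
    by apply/funext => u; rewrite FG.
  exact: hG.
refine (@strict_cvg_unique _ _ _ au _ (fun u => F (minj (lact m u))) _ _ hF hG').
Qed.

Lemma smap_dense_uniq A B (F G : multiplier A -> multiplier B) (S : set A) :
  smap F -> smap G -> dense (lspan S) ->
  (forall a, S a -> F (minj a) = G (minj a)) -> forall m, F m = G m.
Proof.
move=> sF sG dS h; apply: smap_uniq => //; apply: (dense_ind dS) h; last first.
  have [Fl _ _] := sF; have [Gl _ _] := sG; split.
    by rewrite (lin_0 minj_linear) (lin_0 Fl) (lin_0 Gl).
  by move=> k x y hx hy; rewrite minj_linear Fl Gl hx hy.
have bd (H : multiplier A -> multiplier B) : smap H -> exists2 L : R, 0 <= L &
    forall (e : R) a, 0 < e -> nr a <= e -> mbnd (e * L) (H (minj a)).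
  move=> [Hl Hb _]; have [L L0 hL] := Hb 1 ler01; exists L => // e a e0 ae.
  have en : complex.Re `|(e%:C : R[i])| = e.
    by rewrite normc_def/= expr0n addr0 sqrtr_sqr ger0_norm// ltW.
  have -> : minj a = e%:C *: minj ((e^-1)%:C *: a).
    rewrite (lin_Z minj_linear) scalerA -rmorphM/= mulfV ?gt_eqF//.
    by rewrite rmorph1 scale1r.
  rewrite (lin_Z Hl) -[X in X * L]en; apply: mbndZ; apply: hL.
  apply: mbnd_le (@mbnd_minj _ _ _).
  by rewrite nrZr ger0_norm ?invr_ge0 ?(ltW e0)// ler_pdivrMl// mulr1.
have [L L0 hL] := bd F sF; have [M M0 hM] := bd G sG.
move=> x hx; apply: lact_ext => w; apply/eqP; rewrite -subr_eq0; apply/eqP/nr_eq0/le_anti.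
rewrite nr_ge0 andbT; apply/ler_addgt0Pr => e e0; rewrite add0r.
have w0 := nr_ge0 w.
have c0 : 0 < (L + M) * nr w + 1 by rewrite ltr_wpDl// mulr_ge0// addr_ge0.
have d0 : 0 < e / ((L + M) * nr w + 1) by rewrite divr_gt0.
have [y hy xy] := hx _ d0.
have [Fl _ _] := sF; have [Gl _ _] := sG.
have -> : lact (F (minj x)) w - lact (G (minj x)) w =
    lact (F (minj (x - y))) w - lact (G (minj (x - y))) w.
  rewrite (lin_B minj_linear) (lin_B Fl) (lin_B Gl) hy !lactDl !lactNl; zmod.
apply: le_trans (nrD _ _) _; rewrite nrN.
have h1 := hL _ _ d0 (ltW xy) w; have h2 := hM _ _ d0 (ltW xy) w.
apply: le_trans (lerD h1 h2) _; rewrite -mulrDl -mulrDr.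
by rewrite -!mulrA ger_pMr// ler_pdivrMl// mulr1 lerDl.
Qed.

Lemma nondegenerate_cancel A B (f : A -> multiplier B) (m n : multiplier B) :
  Defs.nondegenerate f -> (forall a, m * f a = n * f a) -> m = n.
Proof.
move=> nd h; apply: (mult_dense_eq nd) => _ [a [x ->]].
by rewrite -!lactM h.
Qed.

(** [F m] is the strict limit of [f (m u)] along the approximate unit. The relation
    [F m * f a = f (m a)] then determines [F m] by nondegeneracy, and all algebraic properties
    follow by cancelling [f a]. *)
Lemma nondegenerate_ext A B (f : A -> multiplier B) :
  star_hom f -> Defs.nondegenerate f -> exists F : multiplier A -> multiplier B,
    [/\ mult_star_hom F, mult_strict F & forall a, F (minj a) = f a].
Proof.
move=> hf nd; have [fl fM fs] := hf.
have ctr := star_hom_contractive hf.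
have fcvg T (FF : set_system T) (g : T -> A) a x : Filter FF -> g @ FF --> a ->
    (fun t => lact (f (g t)) x) @ FF --> lact (f a) x.
  move=> fF h; apply: (cvg_dom (K := nr x) h); apply: nearW => t /=.
  by rewrite -lactNl -lactDl -(lin_B fl) mulrC.
have /choice[F hF] m : exists n, strict_cvg ((fun u => f (lact m u)) @ au) n.
  have [K K0 hK] := multiplier_bounded m.
  have [||||n hn _] := @strict_complete _ B _ au _ (fun u => f (lact m u)) (K * 2) _ _
    _ _ nd nd; rewrite ?mulr_ge0//; last by exists n.
  - apply: filterS (approx_mult_bnd K0 hK) => u /= hu.
    by apply: mbnd_le hu _; exact: star_hom_mbnd.
  - move=> _ [a [x ->]]; exists (lact (f (lact m a)) x).
    rewrite (_ : (fun t => _) = fun u => lact (f (lact m (u ** a))) x).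
      by apply: fcvg; apply: cvg_lact; exact: au_l.
    by apply/funext => u; rewrite -lactM -fM lactMr.
  - move=> _ [a [x ->]]; exists (lact (f (lact (mstar m) a)) x).
    rewrite (_ : (fun t => _) = fun u =>
        lact (f (star (star (lact (mstar m) a) ** u))) x).
      apply: fcvg; rewrite -[X in _ --> X]starK; apply: cvg_star; exact: au_r.
    apply/funext => u; rewrite -fs -lactM -fM; congr (lact (f _) _).
    by rewrite star_lact [RHS]starM starK.
have Ff m a : F m * f a = f (lact m a).
  apply: lact_ext => x; rewrite lactM.
  apply: (cvg_uniq (F := au) (f := fun u => lact (f (lact m u)) (lact (f a) x))).
    exact: (proj1 (hF m _)).
  rewrite (_ : (fun t => _) = fun u => lact (f (lact m (u ** a))) x).
    by apply: fcvg; apply: cvg_lact; exact: au_l.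
  by apply/funext => u; rewrite -lactM -fM lactMr.
have fF m a : f a * F m = f (ract m a).
  apply: (nondegenerate_cancel nd) => b.
  by rewrite -mulrA Ff -!fM multiplierP.
have Fl : linear F.
  move=> k m n; apply: (nondegenerate_cancel nd) => a.
  by rewrite mulrDl mscaleAl !Ff -fl.
have Fs m : F (mstar m) = mstar (F m).
  apply: (nondegenerate_cancel nd) => a.
  by rewrite Ff -[a in RHS]starK fs -mstarM fF -fs.
have Fb m (K : R) : 0 <= K -> mbnd K m -> mbnd (K * 2) (F m).
  move=> K0 hK w; apply: (nr_cvg_le (proj1 (hF m w))).
  apply: filterS (approx_mult_bnd K0 hK) => u /= hu.
  by apply: le_trans (ctr _ _) _; rewrite ler_wpM2r// nr_ge0.
have Fstr (FF : set_system (multiplier A)) m : Filter FF -> FF (@mult_ball R A) ->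
    mult_ball m -> strict_cvg FF m -> forall w, (fun n => lact (F n) w) @ FF --> lact (F m) w.
  rewrite mbnd1E => fFF bF bm hm.
  apply: (@bounded_cvg _ _ _ FF fFF F (F m) (1 * 2) _ _ _ _ nd).
  - by rewrite mul1r.
  - by apply: filterS bF => n; exact: Fb.
  - exact: Fb.
  - move=> _ [a [x ->]]; rewrite -lactM Ff.
    rewrite (_ : (fun t => _) = fun n => lact (f (lact n a)) x).
      by apply: fcvg; exact: (proj1 (hm a)).
    by apply/funext => n; rewrite -lactM Ff.
exists F; split.
- split=> // m n; apply: (nondegenerate_cancel nd) => a.
  by rewrite -mulrA !Ff.
- move=> FF m fFF bF bm hm w; split; first exact: (Fstr FF m).
  have h := Fstr (mstar @ FF) (mstar m) _ _ _ (strict_cvg_mstar hm) (star w).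
  rewrite ractE; apply: (cvg_congr (F := FF)
      (f := fun n => star (lact (F (mstar n)) (star w))) (g := fun n => ract (F n) w)).
    by move=> n; rewrite ractE Fs.
  rewrite -Fs; apply: cvg_star; apply: h.
  + move: bF; rewrite mbnd1E => bF; apply: (@filterS _ FF _ _ _ _ bF) => n; exact: mbnd_star.
  + move: bm; rewrite mbnd1E; exact: mbnd_star.
- by move=> a; apply: (nondegenerate_cancel nd) => b; rewrite Ff -fM.
Qed.

End StrictMaps.

(** * Tensor products *)

Section TensorLeg.
Context {R : realType} {A B D : cstarAlgebra R} (t : A -> B -> D).
Hypothesis t_linl : forall b, linear (t^~ b).
Hypothesis t_linr : forall a, linear (t a).
Hypothesis t_mul : forall a a' b b', t a b ** t a' b' = t (a ** a') (b ** b').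
Hypothesis t_star : forall a b, star (t a b) = t (star a) (star b).
Hypothesis t_dense : dense (lspan [set x | exists a b, x = t a b]).

Let sub a b := subcross t_linl t_linr t_mul t_star a b.

Lemma tens_lip_l b x y : nr (t x b - t y b) <= nr b * nr (x - y).
Proof. by rewrite -(lin_B (t_linl b)) mulrC; exact: sub. Qed.

(** [f a] is the strict limit of [t a v] as [v] runs through an approximate unit of [B]. *)
Lemma leg_alg_exists : exists f : A -> multiplier D,
  [/\ star_hom f, Defs.nondegenerate f &
      forall a x y, lact (f a) (t x y) = t (a ** x) y].
Proof.
have key (a : A) : exists m : multiplier D,
    strict_cvg ((fun v => minj (t a v)) @ au) m.
  have [||||m hm _] := @strict_complete _ D _ au _ (fun v => minj (t a v))
    (nr a * 2) _ _ _ _ t_dense t_dense; last by exists m.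
  - by rewrite mulr_ge0 ?nr_ge0.
  - apply: filterS au_bnd => v /= hv; apply: mbnd_le (@mbnd_minj _ _ _).
    by apply: le_trans (sub _ _) _; rewrite ler_wpM2l ?nr_ge0.
  - move=> _ [x [y ->]]; exists (t (a ** x) y).
    apply: (cvg_congr (f := fun v => t (a ** x) (v ** y))) => [v|].
      by rewrite lact_minj t_mul.
    by apply: (tens_cvgr t_linl t_linr t_mul t_star); exact: au_l.
  - move=> _ [x [y ->]]; exists (t (star a ** x) y).
    apply: (cvg_congr (f := fun v => t (star a ** x) (star (star y ** v)))) => [v|].
      by rewrite mstar_minj lact_minj t_star t_mul starM starK.
    apply: (tens_cvgr t_linl t_linr t_mul t_star).
    by rewrite -[X in _ --> X]starK; apply: cvg_star; exact: au_r.
have [f hf] := choice key.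
have fE a x y : lact (f a) (t x y) = t (a ** x) y.
  apply: (cvg_uniq (F := au) (f := fun v => lact (minj (t a v)) (t x y))).
    exact: (proj1 (hf a _)).
  apply: (cvg_congr (f := fun v => t (a ** x) (v ** y))) => [v|].
    by rewrite lact_minj t_mul.
  by apply: (tens_cvgr t_linl t_linr t_mul t_star); exact: au_l.
have fsE a x y : lact (mstar (f a)) (t x y) = t (star a ** x) y.
  apply: (cvg_uniq (F := au) (f := fun v => lact (mstar (minj (t a v))) (t x y))).
    exact: (proj1 (strict_cvg_mstar (hf a) _)).
  apply: (cvg_congr (f := fun v => t (star a ** x) (star (star y ** v)))) => [v|].
    by rewrite mstar_minj lact_minj t_star t_mul starM starK.
  apply: (tens_cvgr t_linl t_linr t_mul t_star).
  by rewrite -[X in _ --> X]starK; apply: cvg_star; exact: au_r.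
have ext (m n : multiplier D) :
    (forall x y, lact m (t x y) = lact n (t x y)) -> m = n.
  by move=> h; apply: (mult_dense_eq t_dense) => _ [x [y ->]].
exists f; split=> //.
- split=> [k a b|a b|a]; apply: ext => x y.
  + by rewrite lactDl lactZl !fE cs_mulDl cs_scaleAl t_linl.
  + by rewrite lactM !fE cs_mulA.
  + by rewrite fE fsE.
- apply: dense_lspanP => P cP sP SP.
  apply: (dense_ind t_dense cP sP) => _ [a [b ->]].
  move: a; apply: (dense_ind dense_mul).
  + exact: (nclosed_lip (tens_lip_l b) cP).
  + split; first by rewrite /= (lin_0 (t_linl b)); exact: sP.1.
    by move=> k x y hx hy; rewrite /= t_linl; exact: sP.2.
  + by move=> _ [a [c ->]] /=; rewrite -fE; apply: SP; exists a, (t c b).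
Qed.

Lemma leg_exists : exists F : multiplier A -> multiplier D,
  [/\ mult_star_hom F, mult_strict F &
      forall m a b, lact (F m) (t a b) = t (lact m a) b].
Proof.
have [f [hf nd fE]] := leg_alg_exists.
have [F [hF sF Ff]] := nondegenerate_ext hf nd.
exists F; split=> // m a b; move: a; apply: (dense_ind dense_mul).
- have [K K0 hK] := multiplier_bounded m.
  have [L L0 hL] := multiplier_bounded (F m).
  apply: (nclosed_eq (K := L * nr b) (L := nr b * K)) => x y.
    apply: le_trans (mbnd_lipl hL _ _) _; rewrite -mulrA ler_wpM2l//.
    exact: tens_lip_l.
  apply: le_trans (tens_lip_l _ _ _) _.
  by rewrite -mulrA ler_wpM2l ?nr_ge0// mbnd_lipl.
- split; first by rewrite (lin_0 (lact_linear m)) (lin_0 (t_linl b)) (lin_0 (lact_linear _)).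
  by move=> k x y hx hy; rewrite t_linl !lact_linear hx hy t_linl.
- move=> _ [a [c ->]]; rewrite -fE -lactM -Ff.
  have [_ FM _] := hF; rewrite -FM mul_minj Ff fE lactMr.
  by [].
Qed.

End TensorLeg.

Section Legs.
Context {R : realType} {A B : cstarAlgebra R} (D : mintensor A B).

Lemma tens_linl b : linear ((tens D)^~ b).
Proof. by have [[[h _] _ _ _] _] := tensP D. Qed.

Lemma tens_linr a : linear (tens D a).
Proof. by have [[[_ h] _ _ _] _] := tensP D. Qed.

Lemma tensM a a' b b' : tens D a b ** tens D a' b' = tens D (a ** a') (b ** b').
Proof. by have [[_ [h _] _ _] _] := tensP D. Qed.

Lemma tens_star a b : star (tens D a b) = tens D (star a) (star b).
Proof. by have [[_ [_ h] _ _] _] := tensP D. Qed.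

Lemma tens_dense : dense (lspan [set x | exists a b, x = tens D a b]).
Proof. by have [[_ _ _ h] _] := tensP D. Qed.

Lemma tens_indep n (a : 'I_n -> A) (b : 'I_n -> B) :
  (forall c : 'I_n -> R[i], \sum_(i < n) c i *: b i = 0 -> forall i, c i = 0) ->
  \sum_(i < n) tens D (a i) (b i) = 0 -> forall i, a i = 0.
Proof. by have [[_ _ h _] _] := tensP D; exact: h. Qed.

Lemma nr_tens a b : nr (tens D a b) <= nr a * nr b.
Proof. exact: (subcross tens_linl tens_linr tensM tens_star). Qed.

Lemma tens_dense_flip : dense (lspan [set x | exists b a, x = tens D a b]).
Proof.
rewrite (_ : [set x | _] = [set x | exists a b, x = tens D a b]); first exact: tens_dense.
by apply/seteqP; split=> x [b [a ->]]; exists a, b.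
Qed.

Definition leg1_sig := cid (leg_exists tens_linl tens_linr tensM tens_star tens_dense).
Definition leg2_sig := cid (@leg_exists _ B A D (fun b a => tens D a b) tens_linr tens_linl
  (fun b b' a a' => tensM a a' b b') (fun b a => tens_star a b) tens_dense_flip).

(* [leg1 m] is m (x) 1 and [leg2 n] is 1 (x) n. *)
Definition leg1 : multiplier A -> multiplier D := sval leg1_sig.
Definition leg2 : multiplier B -> multiplier D := sval leg2_sig.

Lemma leg1_hom : mult_star_hom leg1.
Proof. by rewrite /leg1; case: leg1_sig => f []. Qed.

Lemma leg2_hom : mult_star_hom leg2.
Proof. by rewrite /leg2; case: leg2_sig => f []. Qed.

Lemma leg1_smap : smap leg1.
Proof. by rewrite /leg1; case: leg1_sig => f [/= h s _]; exact: strict_smap. Qed.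

Lemma leg2_smap : smap leg2.
Proof. by rewrite /leg2; case: leg2_sig => f [/= h s _]; exact: strict_smap. Qed.

Lemma leg1E m a b : lact (leg1 m) (tens D a b) = tens D (lact m a) b.
Proof. by rewrite /leg1; case: leg1_sig => f []. Qed.

Lemma leg2E n a b : lact (leg2 n) (tens D a b) = tens D a (lact n b).
Proof. by rewrite /leg2; case: leg2_sig => f [? ? h] /=; exact: h. Qed.

Lemma leg1_linear : linear leg1. Proof. by have [] := leg1_hom. Qed.
Lemma leg2_linear : linear leg2. Proof. by have [] := leg2_hom. Qed.
Lemma leg1M m n : leg1 (m * n) = leg1 m * leg1 n. Proof. by have [] := leg1_hom. Qed.
Lemma leg2M m n : leg2 (m * n) = leg2 m * leg2 n. Proof. by have [] := leg2_hom. Qed.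

Lemma tens_ext (m n : multiplier D) :
  (forall a b, lact m (tens D a b) = lact n (tens D a b)) -> m = n.
Proof. by move=> h; apply: (mult_dense_eq tens_dense) => _ [a [b ->]]. Qed.

Lemma leg1_1 : leg1 1 = 1.
Proof. by apply: tens_ext => a b; rewrite leg1E. Qed.

Lemma leg2_1 : leg2 1 = 1.
Proof. by apply: tens_ext => a b; rewrite leg2E. Qed.

Lemma legC m n : leg1 m * leg2 n = leg2 n * leg1 m.
Proof. by apply: tens_ext => a b; rewrite !lactM !(leg1E, leg2E). Qed.

Lemma mtensorP m n (k : multiplier D) : is_mtensor m n k <-> k = leg1 m * leg2 n.
Proof.
split=> [h|-> a b]; last by rewrite lactM leg2E leg1E.
by apply: tens_ext => a b; rewrite h lactM leg2E leg1E.
Qed.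

Lemma minj_tens a b : minj (tens D a b) = leg1 (minj a) * leg2 (minj b).
Proof. by apply: tens_ext => x y; rewrite lactM leg2E leg1E lact_minj tensM. Qed.

Lemma nondegenerate_leg1 (C : cstarAlgebra R) (f : C -> multiplier A) :
  Defs.nondegenerate f -> Defs.nondegenerate (fun c => leg1 (f c)).
Proof.
move=> nd; apply: dense_lspanP => P cP sP SP.
apply: (dense_ind tens_dense cP sP) => _ [a [b ->]].
move: a; apply: (dense_ind nd).
- apply: (nclosed_lip (K := nr b) _ cP) => x y.
  by rewrite -(lin_B (tens_linl b)) mulrC; exact: nr_tens.
- split; first by rewrite /= (lin_0 (tens_linl b)); exact: sP.1.
  by move=> k x y hx hy; rewrite /= tens_linl; exact: sP.2.
- by move=> _ [c [x ->]] /=; rewrite -leg1E; apply: SP; exists c, (tens D x b).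
Qed.

Lemma nondegenerate_leg2 (C : cstarAlgebra R) (f : C -> multiplier B) :
  Defs.nondegenerate f -> Defs.nondegenerate (fun c => leg2 (f c)).
Proof.
move=> nd; apply: dense_lspanP => P cP sP SP.
apply: (dense_ind tens_dense cP sP) => _ [a [b ->]].
move: b; apply: (dense_ind nd).
- apply: (nclosed_lip (K := nr a) _ cP) => x y.
  by rewrite -(lin_B (tens_linr a)); exact: nr_tens.
- split; first by rewrite /= (lin_0 (tens_linr a)); exact: sP.1.
  by move=> k x y hx hy; rewrite /= tens_linr; exact: sP.2.
- by move=> _ [c [x ->]] /=; rewrite -leg2E; apply: SP; exists c, (tens D a x).
Qed.

Lemma tens_smap_uniq (X : cstarAlgebra R) (F G : multiplier D -> multiplier X) :
  smap F -> smap G ->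
  (forall a b, F (minj (tens D a b)) = G (minj (tens D a b))) -> forall m, F m = G m.
Proof.
by move=> sF sG h; apply: (smap_dense_uniq sF sG tens_dense) => _ [a [b ->]].
Qed.

End Legs.

Section HomTensor.
Context {R : realType}.

Lemma nondegenerate_minj (A : cstarAlgebra R) : Defs.nondegenerate (@minj R A).
Proof. exact: dense_mul. Qed.

Lemma hom_tensor_smap (A1 B1 A2 B2 : cstarAlgebra R) (D1 : mintensor A1 B1)
    (D2 : mintensor A2 B2) f g (h : multiplier D1 -> multiplier D2) :
  hom_tensor f g h -> smap h.
Proof. by move=> [hh hs _]; exact: strict_smap. Qed.

Lemma hom_tensorE (A1 B1 A2 B2 : cstarAlgebra R) (D1 : mintensor A1 B1)
    (D2 : mintensor A2 B2) f g (h : multiplier D1 -> multiplier D2) a b :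
  hom_tensor f g h -> h (minj (tens D1 a b)) = leg1 D2 (f a) * leg2 D2 (g b).
Proof. by move=> [_ _ he]; apply/mtensorP/he. Qed.

(** Strict uniqueness is used one leg at a time, which reduces [m] and [n] to algebra elements. *)
Lemma hom_tensor_legs (A1 B1 A2 B2 : cstarAlgebra R) (D1 : mintensor A1 B1)
    (D2 : mintensor A2 B2) f g (h : multiplier D1 -> multiplier D2)
    (F : multiplier A1 -> multiplier A2) (G : multiplier B1 -> multiplier B2) :
  hom_tensor f g h -> smap F -> smap G ->
  (forall a, F (minj a) = f a) -> (forall b, G (minj b) = g b) ->
  forall m n, h (leg1 D1 m * leg2 D1 n) = leg1 D2 (F m) * leg2 D2 (G n).
Proof.
move=> hh sF sG Ff Gg m n; have sh := hom_tensor_smap hh.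
move: n; apply: smap_uniq.
- exact: (smap_comp (smap_mull _ (leg2_smap D1)) sh).
- exact: (smap_mull _ (smap_comp sG (leg2_smap D2))).
move=> b; move: m; apply: smap_uniq.
- exact: (smap_comp (smap_mulr _ (leg1_smap D1)) sh).
- exact: (smap_mulr _ (smap_comp sF (leg1_smap D2))).
by move=> a; rewrite -minj_tens (hom_tensorE _ _ hh) Ff Gg.
Qed.

End HomTensor.

(** * Tensor products with sums of matrix algebras *)

Section MatrixCoefficients.
Context {R : realType} {A G : cstarAlgebra R} (D : mintensor A G).
Context {I : Type} {n : I -> nat} {E : forall x : I, 'I_(n x) -> 'I_(n x) -> G}.
Hypothesis hE : c0_sum_of_matrices E.
Context {X : cstarAlgebra R} (alpha : A -> multiplier X) (beta : G -> multiplier X).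
Hypothesis h_alpha : star_hom alpha.
Hypothesis h_beta : star_hom beta.
Hypothesis h_comm : forall a g, alpha a * beta g = beta g * alpha a.

(** [I] is an arbitrary type; [classic] supplies the equality test needed to single out one index in
    a finite sum. *)
Let J := {classic {x : I & ('I_(n x) * 'I_(n x))%type}}.
Let mkJ x (p : 'I_(n x) * 'I_(n x)) : J :=
  @Tagged I x (fun x => ('I_(n x) * 'I_(n x))%type) p.
Let Et (s : J) : G := E (tagged s).1 (tagged s).2.
Let Er (s : J) : G := E (tagged s).1 (tagged s).1.
Let Ec (s : J) : G := E (tagged s).2 (tagged s).2.

Let EtM (s t : J) : exists (c : R[i]) (r : J),
  (tag r = tag s) /\ Et s ** Et t = c *: Et r.
Proof.
have [h1 h2 _ _ _] := hE.
case: s t => [x [i j]] [y [k l]].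
have [e|ne] := pselect (x = y); last first.
  by exists 0, (mkJ (i, j)); split=> //; rewrite /Et/= h2// scale0r.
move: k l; rewrite -e => k l.
by exists (j == k)%:R, (mkJ (i, l)); split=> //; rewrite /Et/= h1.
Qed.

Let Et_star (s : J) : exists r : J, tag r = tag s /\ star (Et s) = Et r.
Proof.
have [_ _ h3 _ _] := hE; case: s => [x [i j]].
by exists (mkJ (j, i)); split=> //; rewrite /Et/= h3.
Qed.

(** Compression between a row and a column projection isolates a single matrix coefficient. *)
Let Et_cut (s t : J) : Er s ** Et t ** Ec s = if t == s then Et s else 0.
Proof.
have [h1 h2 _ _ _] := hE.
case: s t => [x [i j]] [y [k l]]; case: eqP => [->|ne].
  by rewrite /Er /Ec /Et/= !h1 !eqxx !scale1r h1 eqxx scale1r.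
rewrite /Er /Ec /Et/=.
have [e|nxy] := pselect (x = y); last by rewrite h2// cs_mul0l.
move: k l ne; rewrite -e => k l ne.
rewrite h1 cs_scaleAl h1; have [ik|] := eqVneq i k; last by rewrite scale0r.
have [lj|] := eqVneq l j; last by rewrite scale0r scaler0.
by case: ne; rewrite ik lj.
Qed.

Let alpha_lin : linear alpha. Proof. by have [] := h_alpha. Qed.
Let beta_lin : linear beta. Proof. by have [] := h_beta. Qed.

(** A finite sum paired with its intended image, both formed from the same coefficients. *)
Let RU (U : seq J) (z : D) (m : multiplier X) := exists a : J -> A,
  z = \sum_(s <- U) tens D (a s) (Et s) /\
  m = \sum_(s <- U) alpha (a s) * beta (Et s).

Let RU0 U : RU U 0 0.
Proof.
exists (fun=> 0); split; rewrite big1// => s _.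
  by rewrite (lin_0 (tens_linl D _)).
by rewrite (lin_0 alpha_lin) mul0r.
Qed.

Let RU_lin U k z m z' m' : RU U z m -> RU U z' m' ->
  RU U (k *: z + z') (k *: m + m').
Proof.
move=> [a [-> ->]] [a' [-> ->]]; exists (fun s => k *: a s + a' s); split.
  rewrite scaler_sumr -big_split/=; apply: eq_bigr => s _.
  by rewrite tens_linl.
rewrite scaler_sumr -big_split/=; apply: eq_bigr => s _.
by rewrite alpha_lin mulrDl mscaleAl.
Qed.

Let RU_sum U (r : seq J) (F : J -> D) (M : J -> multiplier X) :
  (forall s, s \in r -> RU U (F s) (M s)) ->
  RU U (\sum_(s <- r) F s) (\sum_(s <- r) M s).
Proof.
move=> h; rewrite [X in RU U X _]big_seq [X in RU U _ X]big_seq.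
apply: (big_ind2 (RU U)) => //.
by move=> z m z' m' h1 h2; have := RU_lin 1 h1 h2; rewrite !scale1r.
Qed.

Let RU_gen U a (c : R[i]) s : uniq U -> s \in U ->
  RU U (tens D a (c *: Et s)) (alpha a * beta (c *: Et s)).
Proof.
move=> uU sU; exists (fun t => if t == s then c *: a else 0); split.
  rewrite (bigD1_seq s)//= eqxx big1 ?addr0 => [|t /negPf ->].
    by rewrite (lin_Z (tens_linl D _)) (lin_Z (tens_linr D _)).
  by rewrite (lin_0 (tens_linl D _)).
rewrite (bigD1_seq s)//= eqxx big1 ?addr0 => [|t /negPf ->].
  by rewrite (lin_Z alpha_lin) (lin_Z beta_lin) mscaleAl mscaleAr.
by rewrite (lin_0 alpha_lin) mul0r.
Qed.

Let blocks (L : seq {classic I}) : seq J :=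
  undup (flatten [seq [seq @mkJ x p | p <- enum {: 'I_(n x) * 'I_(n x)}] | x <- L]).

Let blocks_uniq L : uniq (blocks L).
Proof. exact: undup_uniq. Qed.

Let mem_blocks L (s : J) : (s \in blocks L) = ((tag s : {classic I}) \in L).
Proof.
rewrite mem_undup; elim: L => [|y L IH] //=; rewrite mem_cat IH inE; congr (_ || _).
apply/mapP/eqP => [[p _ ->] //|].
case: s {IH} => x p /= xy; move: p; rewrite xy => p.
by exists p; rewrite ?mem_enum.
Qed.

Let RU_sub L L' z m : {subset L <= L'} -> RU (blocks L) z m -> RU (blocks L') z m.
Proof.
move=> LL [a [-> ->]]; apply: RU_sum => s sU.
rewrite -[Et s]scale1r; apply: RU_gen => //.
by move: sU; rewrite !mem_blocks => /LL.
Qed.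

Let RU_mul L z m z' m' : RU (blocks L) z m -> RU (blocks L) z' m' ->
  RU (blocks L) (z ** z') (m * m').
Proof.
move=> [a [-> ->]] [a' [-> ->]].
have -> : (\sum_(s <- blocks L) tens D (a s) (Et s)) **
    (\sum_(s <- blocks L) tens D (a' s) (Et s)) =
    \sum_(s <- blocks L) \sum_(t <- blocks L) tens D (a s ** a' t) (Et s ** Et t).
  rewrite -lact_minj (lin_sum minj_linear).
  have -> (r : seq J) (F : J -> D) y :
      lact (\sum_(s <- r) minj (F s)) y = \sum_(s <- r) F s ** y.
    by elim: r => [|s r IH]; rewrite ?big_nil// !big_cons lactDl IH.
  apply: eq_bigr => s _; rewrite -lact_minj (lin_sum (lact_linear _)).
  by apply: eq_bigr => t _; rewrite lact_minj tensM.
rewrite mulr_suml; apply: RU_sum => s sU; rewrite mulr_sumr; apply: RU_sum => t tU.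
have -> : alpha (a s) * beta (Et s) * (alpha (a' t) * beta (Et t)) =
    alpha (a s ** a' t) * beta (Et s ** Et t).
  have [_ aM _] := h_alpha; have [_ bM _] := h_beta.
  by rewrite aM bM !mulrA -[alpha (a s) * beta _ * _]mulrA -h_comm mulrA.
have [c [r [tr ->]]] := EtM s t; apply: RU_gen => //.
by rewrite mem_blocks tr -mem_blocks.
Qed.

Let RU_star L z m : RU (blocks L) z m -> RU (blocks L) (star z) (mstar m).
Proof.
move=> [a [-> ->]].
have -> (r : seq J) (F : J -> D) : star (\sum_(s <- r) F s) = \sum_(s <- r) star (F s).
  by elim: r => [|s r IH]; rewrite ?big_nil ?star0// !big_cons starD IH.
have -> (r : seq J) (F : J -> multiplier X) :
    mstar (\sum_(s <- r) F s) = \sum_(s <- r) mstar (F s).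
  by elim: r => [|s r IH]; rewrite ?big_nil ?mstar0// !big_cons mstarD IH.
apply: RU_sum => s sU; have [r [tr e]] := Et_star s.
have [_ _ aS] := h_alpha; have [_ _ bS] := h_beta.
rewrite tens_star mstarM -aS -bS -h_comm e -[Et r]scale1r; apply: RU_gen => //.
by rewrite mem_blocks tr -mem_blocks.
Qed.

(** Tensoring with a diagonal unit is an injective homomorphism, hence bounded below. The
    off-diagonal case follows from the C*-identity, since [E_ij E_ij^* = E_ii]. *)
Let coef_bound a (s : J) : nr a <= 2 * nr (tens D a (Et s)).
Proof.
have [h1 _ h3 h4 _] := hE.
have lb b : nr b <= 2 * nr (tens D b (Er s)).
  apply: (inj_hom_bounded_below (f := fun b => tens D b (Er s))).
  - exact: tens_linl.
  - by move=> x y; rewrite tensM /Er h1 eqxx scale1r.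
  - by move=> x; rewrite tens_star /Er h3.
  - move=> x x0; apply: (@tens_indep _ _ _ D 1 (fun=> x) (fun=> Er s) _ _ ord0).
      move=> c; rewrite big_ord1 => /eqP; rewrite scaler_eq0 => /orP[/eqP c0|/eqP].
        by move=> i; rewrite (ord1 i).
      by move=> /h4.
    by rewrite big_ord1.
have := lb (a ** star a).
have -> : tens D (a ** star a) (Er s) = tens D a (Et s) ** star (tens D a (Et s)).
  by rewrite tens_star tensM /Er /Et h3 h1 eqxx scale1r.
rewrite !nr_Mstar; have := nr_ge0 a; have := nr_ge0 (tens D a (Et s)).
move: (nr a) (nr _) => u v v0 u0 h; rewrite leNgt; apply/negP => lt.
by nra.
Qed.

(** Each coefficient is controlled by a compression of [z], and there are finitely many of them. The
    constant depends on [L], which [power_bound] makes harmless. *)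
Let RU_crude L : exists C : R, forall z m, RU (blocks L) z m -> mbnd (C * nr z) m.
Proof.
exists (\sum_(s <- blocks L) 2 * (nr (Er s) * nr (Ec s)) * nr (Et s)).
move=> z m [a [ez ->]].
have ca s : s \in blocks L -> nr (a s) <= 2 * (nr (Er s) * nr (Ec s)) * nr z.
  move=> sU; apply: le_trans (coef_bound (a s) s) _; rewrite -mulrA ler_wpM2l//.
  have -> : tens D (a s) (Et s) =
      lact (leg2 D (minj (Er s))) (ract (leg2 D (minj (Ec s))) z).
    have rlin : linear (ract (leg2 D (minj (Ec s)))).
      move=> k x y; rewrite !ractE starD starZ (lact_linear _) starD starZ.
      by rewrite conjcK.
    rewrite ez (lin_sum rlin) (lin_sum (lact_linear _)) (bigD1_seq s)//=.
    have cut t : lact (leg2 D (minj (Er s))) (ract (leg2 D (minj (Ec s)))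
        (tens D (a t) (Et t))) = tens D (a t) (if t == s then Et s else 0).
      rewrite ractE tens_star; have [_ _ <-] := leg2_hom D.
      rewrite mstar_minj !leg2E !lact_minj tens_star starK starM !starK leg2E.
      by rewrite lact_minj cs_mulA Et_cut.
    rewrite cut eqxx big1 ?addr0// => t /negPf ts.
    by rewrite cut ts (lin_0 (tens_linr D _)).
  have e0 g : mbnd (nr g) (leg2 D (minj g)).
    exact: (star_hom_mbnd g (mult_star_hom_minj (leg2_hom D))).
  apply: le_trans (e0 _ _) _; rewrite -mulrA ler_wpM2l ?nr_ge0//.
  exact: (mbnd_ract _ (nr_ge0 _) (e0 _)).
have : mbnd (\sum_(s <- blocks L) nr (a s) * nr (Et s))
    (\sum_(s <- blocks L) alpha (a s) * beta (Et s)).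
  elim: (blocks L) => [|s r IH]; first by rewrite !big_nil => w; rewrite /= nr0 mul0r.
  rewrite !big_cons; apply: mbndD => //; apply: mbndM; first exact: nr_ge0.
    exact: star_hom_mbnd.
  exact: star_hom_mbnd.
apply: mbnd_le; rewrite mulr_suml big_seq [leRHS]big_seq; apply: ler_sum => s sU.
rewrite [leRHS]mulrAC ler_wpM2r ?nr_ge0//.
exact: ca.
Qed.

Let RU_bnd L z m : RU (blocks L) z m -> mbnd (nr z) m.
Proof.
have [C hC] := RU_crude L.
apply: (power_bound (S := RU (blocks L)) (C := C)) => //.
by move=> {}z {}m h; apply: RU_mul => //; exact: RU_star.
Qed.

Let S z m := exists L, RU (blocks L) z m.

Let S_pair z m z' m' : S z m -> S z' m' ->
  exists L, RU (blocks L) z m /\ RU (blocks L) z' m'.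
Proof.
move=> [L h] [L' h']; exists (L ++ L'); split.
  by apply: RU_sub h => x; rewrite mem_cat => ->.
by apply: RU_sub h' => x; rewrite mem_cat => ->; rewrite orbT.
Qed.

Let S_gen a s : S (tens D a (Et s)) (alpha a * beta (Et s)).
Proof.
exists [:: (tag s : {classic I})]; rewrite -[Et s]scale1r; apply: RU_gen => //.
by rewrite mem_blocks inE.
Qed.

Let Et_dense : dense (lspan [set g | exists s, g = Et s]).
Proof.
have [_ _ _ _ h] := hE; rewrite (_ : [set g | _] = [set a | exists x i j, a = @E x i j])//.
apply/seteqP; split=> g.
  by move=> [[x [i j]] ->]; exists x, i, j.
by move=> [x [i [j ->]]]; exists (mkJ (i, j)).
Qed.

Let S_dense z (e : R) : 0 < e -> exists z' m', S z' m' /\ nr (z - z') < e.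
Proof.
have dS : dense (lspan [set z : D | exists a s, z = tens D a (Et s)]).
  apply: dense_lspanP => P cP sP SP.
  apply: (dense_ind (@tens_dense _ _ _ D) cP sP) => _ [a [g ->]].
  move: g; apply: (dense_ind Et_dense).
  - apply: (nclosed_lip (K := nr a) _ cP) => x y.
    by rewrite -(lin_B (tens_linr D a)); exact: nr_tens.
  - split; first by rewrite /= (lin_0 (tens_linr D a)); exact: sP.1.
    by move=> k x y hx hy; rewrite /= tens_linr; exact: sP.2.
  - by move=> _ [s ->] /=; apply: SP; exists a, s.
move=> e0; have /dense_near/(_ z e e0)[z' hz' zz'] := dS.
have [m' hm'] : exists m', S z' m'.
  move: z' hz' {zz'}; apply: lspan_subspace.
    split; first by exists 0, [::].
    move=> k x y [m hm] [m' hm']; have [L [h1 h2]] := S_pair hm hm'.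
    by exists (k *: m + m'), L; exact: RU_lin.
  by move=> _ [a [s ->]]; exists (alpha a * beta (Et s)).
by exists z', m'.
Qed.

Lemma commuting_pair_hom : exists2 f : D -> multiplier X,
  star_hom f & forall a g, f (tens D a g) = alpha a * beta g.
Proof.
have [||||f hf fS] := @contractive_extension _ D X S _ _ _ _ S_dense.
- by move=> k z m z' m' h h'; have [L [h1 h2]] := S_pair h h'; exists L; exact: RU_lin.
- by move=> z m z' m' h h'; have [L [h1 h2]] := S_pair h h'; exists L; exact: RU_mul.
- by move=> z m [L h]; exists L; exact: RU_star.
- by move=> z m [L h]; exact: RU_bnd h.
exists f => // a g; apply: lact_ext => w.
have [fl _ _] := hf; move: g; apply: (dense_ind Et_dense).
- apply: (nclosed_eq (K := nr a * nr w) (L := nr a * nr w)) => x y.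
    rewrite -lactNl -lactDl -(lin_B fl) -(lin_B (tens_linr D a)).
    apply: le_trans (star_hom_contractive hf _ _) _.
    by rewrite mulrAC ler_wpM2r ?nr_ge0// nr_tens.
  rewrite -lactNl -lactDl -mulrBr -(lin_B beta_lin) lactM.
  apply: le_trans (star_hom_contractive h_alpha _ _) _.
  rewrite -mulrA ler_wpM2l ?nr_ge0// mulrC.
  exact: star_hom_contractive.
- split; first by rewrite (lin_0 (tens_linr D a)) (lin_0 fl) (lin_0 beta_lin) mulr0.
  move=> k x y hx hy; rewrite tens_linr fl beta_lin mulrDr mscaleAr.
  by rewrite !lactDl !lactZl hx hy.
- by move=> _ [s ->]; rewrite (fS _ _ (S_gen a s)).
Qed.

End MatrixCoefficients.

Section Existence.
Context {R : realType}.

Definition matrix_sum (G : cstarAlgebra R) :=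
  exists (I : Type) (n : I -> nat) (E : forall x : I, 'I_(n x) -> 'I_(n x) -> G),
    c0_sum_of_matrices E.

Lemma nondegenerate_product (A G X : cstarAlgebra R) (D : mintensor A G)
    (alpha : A -> multiplier X) (beta : G -> multiplier X) (f : D -> multiplier X) :
  Defs.nondegenerate alpha -> Defs.nondegenerate beta ->
  (forall a g, f (tens D a g) = alpha a * beta g) -> Defs.nondegenerate f.
Proof.
move=> nda ndb fE; apply: dense_lspanP => P cP sP SP.
apply: (dense_ind nda cP sP) => _ [a [x ->]].
move: x; apply: (dense_ind ndb).
- have [K K0 hK] := multiplier_bounded (alpha a).
  exact: (nclosed_lip (mbnd_lipl hK) cP).
- split; first by rewrite /= (lin_0 (lact_linear _)); exact: sP.1.
  by move=> k x y hx hy; rewrite /= lact_linear; exact: sP.2.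
- by move=> _ [g [x ->]] /=; rewrite -lactM -fE; apply: SP; exists (tens D a g), x.
Qed.

Lemma commuting_pair_ext (A G X : cstarAlgebra R) (D : mintensor A G)
    (alpha : A -> multiplier X) (beta : G -> multiplier X) :
  matrix_sum G -> star_hom alpha -> star_hom beta ->
  (forall a g, alpha a * beta g = beta g * alpha a) ->
  Defs.nondegenerate alpha -> Defs.nondegenerate beta ->
  exists F : multiplier D -> multiplier X, [/\ mult_star_hom F, mult_strict F &
    forall a g, F (minj (tens D a g)) = alpha a * beta g].
Proof.
move=> [I [n [E hE]]] ha hb ab nda ndb.
have [f hf fE] := commuting_pair_hom D hE ha hb ab.
have ndf := nondegenerate_product nda ndb fE.
have [F [hF sF Ff]] := nondegenerate_ext hf ndf.
by exists F; split=> // a g; rewrite Ff fE.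
Qed.

Lemma hom_tensor_exists (A1 G A2 B2 : cstarAlgebra R) (D1 : mintensor A1 G)
    (D2 : mintensor A2 B2) (f : A1 -> multiplier A2) (g : G -> multiplier B2) :
  matrix_sum G -> star_hom f -> star_hom g ->
  Defs.nondegenerate f -> Defs.nondegenerate g ->
  exists h : multiplier D1 -> multiplier D2, hom_tensor f g h.
Proof.
move=> mG [fl fM fs] [gl gM gs] ndf ndg.
have [|||||F [hF sF FE]] := @commuting_pair_ext A1 G D2 D1
  (fun a => leg1 D2 (f a)) (fun b => leg2 D2 (g b)) mG.
- have [l1 l2 l3] := leg1_hom D2; split=> [k x y|x y|x].
  + by rewrite fl l1.
  + by rewrite fM l2.
  + by rewrite fs l3.
- have [l1 l2 l3] := leg2_hom D2; split=> [k x y|x y|x].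
  + by rewrite gl l1.
  + by rewrite gM l2.
  + by rewrite gs l3.
- by move=> a b; exact: legC.
- exact: nondegenerate_leg1.
- exact: nondegenerate_leg2.
by exists F; split=> // a b; apply/mtensorP; exact: FE.
Qed.

(** The slice is the product of the commuting pair [minj] and [g |-> w g 1] with values in M(A). *)
Lemma slice_r_exists (A G : cstarAlgebra R) (D : mintensor A G) (w : G -> R[i]) :
  matrix_sum G -> is_character w ->
  exists h : multiplier D -> multiplier A, slice_r w h.
Proof.
move=> mG [wl wM ws [g0 wg0]].
have [|||||F [hF sF FE]] := @commuting_pair_ext A G A D
  minj (fun g => w g *: (1 : multiplier A)) mG.
- by split=> [|x y|x]; [exact: minj_linear|exact: minjM|rewrite mstar_minj].
- split=> [k x y|x y|x].
  + by rewrite wl scalerDl scalerA.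
  + by rewrite wM mscaleAl mul1r scalerA.
  + by rewrite ws mstarZ mstar1.
- by move=> a g; rewrite mscaleAl mscaleAr mul1r mulr1.
- exact: nondegenerate_minj.
- apply: dense_lspanP => P cP sP SP x; apply: SP.
  by exists g0, ((w g0)^-1 *: x); rewrite lactZl lact1 scalerA mulfV// scale1r.
exists F; split=> // a g.
by rewrite FE mscaleAr mulr1 (lin_Z minj_linear).
Qed.

End Existence.

(** * Triple tensor products, slices and amplifications *)

Section TripleTensor.
Context {R : realType} {A B D : cstarAlgebra R} {AB : mintensor A B} {BD : mintensor B D}.
Variable T : mintensor3 AB BD.

Lemma tens3_dense :
  dense (lspan [set z : T | exists a b d, z = tens3l T (tens AB a b) d]).
Proof.
apply: dense_lspanP => P cP sP SP.
apply: (dense_ind (@tens_dense _ _ _ (mt3l T)) cP sP) => _ [x [d ->]].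
move: x; apply: (dense_ind (@tens_dense _ _ _ AB)).
- apply: (nclosed_lip (K := nr d) _ cP) => x y.
  by rewrite -(lin_B (tens_linl (mt3l T) d)) mulrC; exact: (nr_tens (mt3l T)).
- split; first by rewrite (lin_0 (tens_linl (mt3l T) d)); exact: sP.1.
  by move=> k x y hx hy; rewrite (tens_linl (mt3l T)); exact: sP.2.
- by move=> _ [a [b ->]] /=; apply: SP; exists a, b, d.
Qed.

Lemma tens3_ext (m n : multiplier T) :
  (forall a b d, lact m (tens3l T (tens AB a b) d) = lact n (tens3l T (tens AB a b) d)) ->
  m = n.
Proof. by move=> h; apply: (mult_dense_eq tens3_dense) => _ [a [b [d ->]]]. Qed.

(** This and the next two lemmas translate leg notation between the bracketings A (B D) and (A B) D,
    one for each of the three positions. *)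
Lemma leg1_mt3r m : leg1 (mt3r T) m = leg1 (mt3l T) (leg1 AB m).
Proof.
apply: tens3_ext => a b d.
rewrite [RHS](leg1E (mt3l T)) leg1E tens3A [LHS](leg1E (mt3r T)).
exact: (esym (tens3A T _ _ _)).
Qed.

Lemma leg2_mt3r_leg1 n : leg2 (mt3r T) (leg1 BD n) = leg1 (mt3l T) (leg2 AB n).
Proof.
apply: tens3_ext => a b d.
rewrite [RHS](leg1E (mt3l T)) leg2E tens3A [LHS](leg2E (mt3r T)) leg1E.
exact: (esym (tens3A T _ _ _)).
Qed.

Lemma leg2_mt3r_leg2 n : leg2 (mt3r T) (leg2 BD n) = leg2 (mt3l T) n.
Proof.
apply: tens3_ext => a b d.
rewrite [RHS](leg2E (mt3l T)) tens3A [LHS](leg2E (mt3r T)) leg2E.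
exact: (esym (tens3A T _ _ _)).
Qed.

End TripleTensor.

Section UnitalHoms.
Context {R : realType}.

Lemma unital_nondegenerate (A B : cstarAlgebra R) (f : A -> multiplier B) e :
  f e = 1 -> Defs.nondegenerate f.
Proof.
move=> fe; apply: dense_lspanP => P cP sP SP x; apply: SP.
by exists e, x; rewrite fe.
Qed.

Lemma star_hom_minj (A : cstarAlgebra R) : star_hom (@minj R A).
Proof. by split=> [|x y|x]; [exact: minj_linear|exact: minjM|rewrite mstar_minj]. Qed.

Lemma hom_tensor_leg1 (A1 B1 A2 B2 : cstarAlgebra R) (D1 : mintensor A1 B1)
    (D2 : mintensor A2 B2) f g (h : multiplier D1 -> multiplier D2)
    (F : multiplier A1 -> multiplier A2) (G : multiplier B1 -> multiplier B2) :
  hom_tensor f g h -> smap F -> smap G ->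
  (forall a, F (minj a) = f a) -> (forall b, G (minj b) = g b) -> G 1 = 1 ->
  forall m, h (leg1 D1 m) = leg1 D2 (F m).
Proof.
move=> hh sF sG Ff Gg G1 m.
have := hom_tensor_legs hh sF sG Ff Gg m 1.
by rewrite G1 !leg2_1 !mulr1.
Qed.

Lemma hom_tensor_leg2 (A1 B1 A2 B2 : cstarAlgebra R) (D1 : mintensor A1 B1)
    (D2 : mintensor A2 B2) f g (h : multiplier D1 -> multiplier D2)
    (F : multiplier A1 -> multiplier A2) (G : multiplier B1 -> multiplier B2) :
  hom_tensor f g h -> smap F -> smap G ->
  (forall a, F (minj a) = f a) -> (forall b, G (minj b) = g b) -> F 1 = 1 ->
  forall n, h (leg2 D1 n) = leg2 D2 (G n).
Proof.
move=> hh sF sG Ff Gg F1 n.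
have := hom_tensor_legs hh sF sG Ff Gg 1 n.
by rewrite F1 !leg1_1 !mul1r.
Qed.

Lemma nondegenerate_smap (A B : cstarAlgebra R) (f : A -> multiplier B) :
  star_hom f -> Defs.nondegenerate f -> exists F : multiplier A -> multiplier B,
    [/\ mult_star_hom F, smap F, forall a, F (minj a) = f a & F 1 = 1].
Proof.
move=> hf ndf; have [F [hF sF Ff]] := nondegenerate_ext hf ndf.
exists F; split=> //; first exact: strict_smap.
apply: (nondegenerate_cancel ndf) => a; have [_ FM _] := hF.
by rewrite -Ff -FM !mul1r.
Qed.

Lemma hom_tensor_star_hom (A1 B1 A2 B2 : cstarAlgebra R) (D1 : mintensor A1 B1)
    (D2 : mintensor A2 B2) f g (h : multiplier D1 -> multiplier D2) :
  hom_tensor f g h -> star_hom (fun x => h (minj x)).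
Proof. by move=> [hh _ _]; exact: mult_star_hom_minj. Qed.

Lemma hom_tensor_nondegenerate (A1 B1 A2 B2 : cstarAlgebra R) (D1 : mintensor A1 B1)
    (D2 : mintensor A2 B2) f g (h : multiplier D1 -> multiplier D2) :
  hom_tensor f g h -> Defs.nondegenerate f -> Defs.nondegenerate g ->
  Defs.nondegenerate (fun x => h (minj x)).
Proof.
move=> hh ndf ndg; apply: (nondegenerate_product (nondegenerate_leg1 ndf) (nondegenerate_leg2 ndg)).
by move=> a b; exact: hom_tensorE.
Qed.

Lemma hom_tensor_id (A B : cstarAlgebra R) (D : mintensor A B) :
  hom_tensor (D1 := D) (D2 := D) minj minj id.
Proof. by split=> // a b; apply/mtensorP; exact: minj_tens. Qed.

Lemma slice_r_smap (A B : cstarAlgebra R) (D : mintensor A B) w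
    (h : multiplier D -> multiplier A) : slice_r w h -> smap h.
Proof. by move=> [hh hs _]; exact: strict_smap. Qed.

Lemma slice_r_legs (A B : cstarAlgebra R) (D : mintensor A B) w
    (h : multiplier D -> multiplier A) m b : slice_r w h ->
  h (leg1 D m * leg2 D (minj b)) = w b *: m.
Proof.
move=> hh; have sh := slice_r_smap hh; move: m; apply: smap_uniq.
- exact: (smap_comp (smap_mulr _ (leg1_smap D)) sh).
- have e k : smap (fun m : multiplier A => k *: m).
    have -> : (fun m : multiplier A => k *: m) = fun m => (k *: (1 : multiplier A)) * m.
      by apply/funext => m; rewrite mscaleAl mul1r.
    exact: (smap_mull _ (@smap_id _ A)).
  exact: e.
- move=> a; rewrite -minj_tens; have [_ _ ->] := hh.
  by rewrite (lin_Z minj_linear).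
Qed.

(** An element [b] with [w b] nonzero is inserted in the second leg and its value divided out. *)
Lemma slice_r_leg1 (A B : cstarAlgebra R) (D : mintensor A B) w
    (h : multiplier D -> multiplier A) m : is_character w -> slice_r w h ->
  h (leg1 D m) = m.
Proof.
move=> [_ _ _ [b wb]] hh; have [[_ hM _] _ _] := hh.
have h2 : h (leg2 D (minj b)) = w b *: (1 : multiplier A).
  by rewrite -[leg2 D _]mul1r -(leg1_1 D) (slice_r_legs _ _ hh).
have := slice_r_legs m b hh; rewrite hM h2 mscaleAr mulr1 => e.
by rewrite -[LHS](scalerK wb) e scalerK.
Qed.

(** Slicing is natural: (id (x) w)(f (x) id) equals f composed with (id (x) w), as one checks on
    elementary tensors. *)
Lemma slice_r_hom (B G Z : cstarAlgebra R) (BG : mintensor B G) (ZG : mintensor Z G)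
    (f : B -> multiplier Z) (h : multiplier BG -> multiplier ZG) w
    (hB : multiplier BG -> multiplier B) (hZ : multiplier ZG -> multiplier Z) x b :
  star_hom f -> Defs.nondegenerate f -> hom_tensor f minj h ->
  slice_r w hB -> slice_r w hZ -> hB x = minj b -> hZ (h x) = f b.
Proof.
move=> hf ndf hh sB sZ hx; have [F [_ sF Ff _]] := nondegenerate_smap hf ndf.
rewrite -Ff -hx; move: x {hx}; apply: tens_smap_uniq.
- exact: (smap_comp (hom_tensor_smap hh) (slice_r_smap sZ)).
- exact: (smap_comp (slice_r_smap sB) sF).
move=> a g; rewrite (hom_tensorE _ _ hh) (slice_r_legs _ _ sZ).
have [_ _ ->] := sB; rewrite Ff; have [fl _ _] := hf.
by rewrite (lin_Z fl).
Qed.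

End UnitalHoms.

Section Transfer.
Context {R : realType} (G : cstarBialgebra R) (mG : matrix_sum G).
Context {A Z : cstarAlgebra R} {AG : mintensor A G} {ZG : mintensor Z G}.
Context (AGG : mintensor3 AG (bi_sq G)) (ZGG : mintensor3 ZG (bi_sq G)).
Context (f : A -> multiplier Z) (h : multiplier AG -> multiplier ZG).
Hypothesis f_hom : star_hom f.
Hypothesis f_nd : Defs.nondegenerate f.
Hypothesis h_hom : hom_tensor f minj h.

Let smap_h : smap h. Proof. exact: hom_tensor_smap h_hom. Qed.

Let h_1 : h 1 = 1.
Proof.
have nd := hom_tensor_nondegenerate h_hom f_nd (@nondegenerate_minj _ _).
apply: (nondegenerate_cancel nd) => x; have [[_ hM _] _ _] := h_hom.
by rewrite -hM !mul1r.
Qed.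

(** This is f (x) id (x) id, obtained by amplifying [h], which is f (x) id, once more. *)
Lemma amplification_exists : exists S : multiplier AGG -> multiplier ZGG,
  hom_tensor (D1 := mt3l AGG) (D2 := mt3l ZGG) (fun x => h (minj x)) minj S.
Proof.
apply: (@hom_tensor_exists _ _ _ _ _ (mt3l AGG) (mt3l ZGG)) => //.
- exact: hom_tensor_star_hom h_hom.
- exact: star_hom_minj.
- exact: (hom_tensor_nondegenerate h_hom f_nd (@nondegenerate_minj _ _)).
- exact: nondegenerate_minj.
Qed.

Context (S : multiplier AGG -> multiplier ZGG).
Hypothesis S_hom :
  hom_tensor (D1 := mt3l AGG) (D2 := mt3l ZGG) (fun x => h (minj x)) minj S.

Let smap_S : smap S. Proof. exact: (hom_tensor_smap S_hom). Qed.

Lemma amplification_leg1 m : S (leg1 (mt3l AGG) m) = leg1 (mt3l ZGG) (h m).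
Proof. exact: (hom_tensor_leg1 S_hom smap_h (@smap_id _ _)). Qed.

Lemma amplification_leg2 n : S (leg2 (mt3l AGG) n) = leg2 (mt3l ZGG) n.
Proof. exact: (hom_tensor_leg2 S_hom smap_h (@smap_id _ _)). Qed.

(** (f (x) id (x) id)(id (x) Delta) = (id (x) Delta)(f (x) id). The amplification follows the left
    bracketing and Delta the right one, so the legs of an elementary tensor are compared
    separately. *)
Lemma amplification_comul (dA : multiplier AG -> multiplier AGG)
    (dZ : multiplier ZG -> multiplier ZGG) x :
  hom_tensor (D1 := AG) (D2 := mt3r AGG) minj (@comul R G) dA ->
  hom_tensor (D1 := ZG) (D2 := mt3r ZGG) minj (@comul R G) dZ ->
  S (dA x) = dZ (h x).
Proof.
move=> hA hZ.
have [F [_ sF Ff F1]] := nondegenerate_smap f_hom f_nd.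
have [dd [_ sd dE d1]] := nondegenerate_smap (@comul_hom R G) (@comul_nondegenerate R G).
have [[_ SM _] _ _] := S_hom.
move: x; apply: (tens_smap_uniq (D := AG)).
- exact: (smap_comp (hom_tensor_smap hA) smap_S).
- exact: (smap_comp smap_h (hom_tensor_smap hZ)).
move=> a g; rewrite (hom_tensorE _ _ hA) (hom_tensorE _ _ h_hom).
rewrite (hom_tensor_legs hZ (@smap_id _ _) sd (fun=> erefl) dE) dE SM; congr (_ * _).
  rewrite !leg1_mt3r amplification_leg1.
  rewrite (hom_tensor_leg1 h_hom sF (@smap_id _ _) Ff (fun=> erefl) erefl).
  by rewrite Ff.
move: (comul g); apply: (tens_smap_uniq (D := bi_sq G)).
- exact: (smap_comp (leg2_smap (mt3r AGG)) smap_S).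
- exact: (leg2_smap (mt3r ZGG)).
move=> g1 g2; rewrite minj_tens !leg2M !leg2_mt3r_leg1 !leg2_mt3r_leg2 SM.
rewrite amplification_leg1 amplification_leg2.
by rewrite (hom_tensor_leg2 h_hom sF (@smap_id _ _) Ff (fun=> erefl) F1).
Qed.

End Transfer.

(** The commutation relation is carried over by f (x) id (x) id. With f the identity, this also
    passes from one model of the triple tensor product to another. *)
Lemma admissible_transfer (R : realType) (G : cstarBialgebra R) (A Z : cstarAlgebra R)
    (AG : mintensor A G) (ZG : mintensor Z G) (AGG : mintensor3 AG (bi_sq G))
    (ZGG : mintensor3 ZG (bi_sq G)) (f : A -> multiplier Z)
    (h : multiplier AG -> multiplier ZG) x :
  matrix_sum G -> star_hom f -> Defs.nondegenerate f -> hom_tensor f minj h ->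
  admissible AGG x -> admissible ZGG (h x).
Proof.
move=> mG hf ndf hh [xx sx [dA [x1 [hA ex1 comm]]]].
have [[_ hM hS] _ _] := hh.
split; [by rewrite -hM xx|by rewrite -hS sx|].
have [dZ hZ] : exists dZ : multiplier ZG -> multiplier (mt3r ZGG),
    hom_tensor (D1 := ZG) (D2 := mt3r ZGG) minj (@comul R G) dZ.
  apply: (@hom_tensor_exists _ _ _ _ _ ZG (mt3r ZGG)) => //.
  - exact: star_hom_minj.
  - exact: comul_hom.
  - exact: nondegenerate_minj.
  - exact: comul_nondegenerate.
exists dZ, (leg1 (mt3l ZGG) (h x)); split=> //.
  by apply/mtensorP; rewrite leg2_1 mulr1.
have [S hS'] := amplification_exists mG AGG ZGG ndf hh.
have [[_ SM _] _ _] := hS'.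
move/mtensorP : ex1; rewrite leg2_1 mulr1 => ex1.
have := congr1 S comm; rewrite ex1 !SM (amplification_leg1 hh hS').
by rewrite (amplification_comul hf ndf hh hS' x hA hZ).
Qed.

(** The right counit identity with a spectator leg: (id (x) id (x) eps)(id (x) Delta) = id. *)
Lemma slice_comul (R : realType) (G : cstarBialgebra R) (C : cstarAlgebra R)
    (CG : mintensor C G) (CGG : mintensor3 CG (bi_sq G)) (eps : G -> R[i])
    (dC : multiplier CG -> multiplier CGG) (hZ : multiplier (mt3l CGG) -> multiplier CG) x :
  is_counit eps -> slice_r eps hZ ->
  hom_tensor (D1 := CG) (D2 := mt3r CGG) minj (@comul R G) dC -> hZ (dC x) = x.
Proof.
move=> [char [hl [hr [_ sr hc]]]] sZ hd.
have [[_ ZM _] _ _] := sZ.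
move: x; apply: (tens_smap_uniq (D := CG)).
- exact: (smap_comp (hom_tensor_smap hd) (slice_r_smap sZ)).
- exact: smap_id.
move=> c g; rewrite (hom_tensorE _ _ hd) ZM leg1_mt3r (slice_r_leg1 _ char sZ) minj_tens.
congr (_ * _); have [_ <-] := hc g.
move: (comul g); apply: (tens_smap_uniq (D := bi_sq G)).
- exact: (smap_comp (leg2_smap (mt3r CGG)) (slice_r_smap sZ)).
- exact: (smap_comp (slice_r_smap sr) (leg2_smap CG)).
move=> g1 g2; rewrite minj_tens leg2M leg2_mt3r_leg1 leg2_mt3r_leg2.
rewrite (slice_r_legs _ _ sZ) (slice_r_legs _ _ sr).
by rewrite (lin_Z (leg2_linear CG)).
Qed.

(** * Partial coactions and the universal projection *)

Lemma discrete_matrix_sum (R : realType) (G : discreteQuantumGroup R) : matrix_sum G.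
Proof.
by have [K [I [n [u [E [_ hE _]]]]]] := dq_dual G; exists I, n, E.
Qed.

(** Tested at the unit, strict convergence in [A] is norm convergence, which contractivity
    transports. *)
Lemma unital_star_hom_strict (R : realType) (A B : cstarAlgebra R) (f : A -> multiplier B) (e : A) :
  is_unit_elt e -> star_hom f -> strict_hom f.
Proof.
move=> he hf; split=> // F a fF _ _ ha.
have [fl _ fs] := hf.
have aF : id @ F --> a.
  apply: (cvg_congr (f := fun x => x ** e)) => [x|]; first by have [_ ->] := he x.
  by have [_ <-] := he a; exact: (proj1 (ha e)).
move=> w; split.
  apply: (cvg_dom (K := nr w) aF); apply: nearW => x /=.
  rewrite -lactNl -lactDl -(lin_B fl) mulrC; exact: star_hom_contractive.
apply: (cvg_dom (K := nr w) aF); apply: nearW => x /=.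
have -> : ract (f a) w - ract (f x) w = ract (f (a - x)) w.
  by rewrite (lin_B fl).
rewrite mulrC; apply: mbnd_ract; first exact: nr_ge0.
exact: star_hom_mbnd.
Qed.

Section Corner.
Context {R : realType} {B Be : cstarAlgebra R} {pe : B} {inc : Be -> B}.
Hypothesis hinc : is_corner pe inc.
Hypothesis pe_idem : pe ** pe = pe.
Hypothesis pe_star : star pe = pe.

Let incJ : injective inc. Proof. by have [] := hinc. Qed.

Lemma corner_linear : linear inc.
Proof.
have [[il _ _] _ _] := hinc => k a b; apply: minj_inj.
by rewrite il minj_linear.
Qed.

Lemma cornerM a b : inc (a ** b) = inc a ** inc b.
Proof. by have [[_ iM _] _ _] := hinc; apply: minj_inj; rewrite iM minjM. Qed.

Lemma corner_star a : inc (star a) = star (inc a).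
Proof. by have [[_ _ iS] _ _] := hinc; apply: minj_inj; rewrite iS mstar_minj. Qed.

Lemma corner_lift b : exists a, inc a = pe ** b.
Proof.
have [_ _ rg] := hinc; have : [set pe ** b | b in setT] (pe ** b) by exists b.
by rewrite -rg => -[a _ <-]; exists a.
Qed.

Lemma corner_pel a : pe ** inc a = inc a.
Proof.
have [_ _ rg] := hinc; have : range inc (inc a) by exists a.
by rewrite rg => -[b _ <-]; rewrite cs_mulA pe_idem.
Qed.

Lemma corner_per a : inc a ** pe = inc a.
Proof.
by rewrite -[inc a]starK -corner_star -{1}pe_star -starM corner_pel.
Qed.

(* The range of [inc] is closed under the adjoint, so pe B = B pe. *)
Lemma corner_central b : pe ** b = b ** pe.
Proof.
have h c : pe ** c ** pe = pe ** c.
  by have [a <-] := corner_lift c; exact: corner_per.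
have e := congr1 (@star R B) (h (star b)); rewrite !starM starK pe_star in e.
by rewrite -e cs_mulA h.
Qed.

End Corner.

Section PartialCoaction.
Context {R : realType} {G : cstarBialgebra R} {C : cstarAlgebra R} {CG : mintensor C G}.
Context {CGG : mintensor3 CG (bi_sq G)} {d : C -> multiplier CG}.
Context {dbar : multiplier C -> multiplier CG}.
Hypothesis dP : partial_coaction CGG d dbar.

Lemma partial_coaction_smap : smap dbar.
Proof. by have [_ [h s _] _ _] := dP; exact: strict_smap. Qed.

Lemma partial_coaction_ext c : dbar (minj c) = d c.
Proof. by have [_ [_ _ e] _ _] := dP. Qed.

Lemma partial_coactionM m n : dbar (m * n) = dbar m * dbar n.
Proof. by have [_ [[_ h _] _ _] _ _] := dP. Qed.

Lemma partial_coaction_star m : dbar (mstar m) = mstar (dbar m).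
Proof. by have [_ [[_ _ h] _ _] _ _] := dP. Qed.

Lemma partial_coaction_idem : dbar 1 * dbar 1 = dbar 1.
Proof. by rewrite -partial_coactionM mulr1. Qed.

Lemma partial_coaction_sa : mstar (dbar 1) = dbar 1.
Proof. by rewrite -partial_coaction_star mstar1. Qed.

(* Both sides of the coaction identity are strictly continuous, so it extends
   from [d c] to [dbar 1]; the left-hand side is self-adjoint there, which
   forces the two factors on the right to commute. *)
Lemma partial_coaction_unit : exists d_id id_D : multiplier CG -> multiplier CGG,
  [/\ hom_tensor (D1 := CG) (D2 := mt3l CGG) d minj d_id,
      hom_tensor (D1 := CG) (D2 := mt3r CGG) minj (@comul R G) id_D,
      d_id (dbar 1) = leg1 (mt3l CGG) (dbar 1) * id_D (dbar 1) &
      leg1 (mt3l CGG) (dbar 1) * id_D (dbar 1) =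
        id_D (dbar 1) * leg1 (mt3l CGG) (dbar 1)].
Proof.
have [_ _ _ [d_id [id_D [k [h1 h2 /mtensorP ek hc]]]]] := dP.
rewrite leg2_1 mulr1 in ek; rewrite {}ek in hc.
exists d_id, id_D.
have e : d_id (dbar 1) = leg1 (mt3l CGG) (dbar 1) * id_D (dbar 1).
  apply: (smap_uniq (F := fun m => d_id (dbar m))
    (G := fun m => leg1 (mt3l CGG) (dbar 1) * id_D (dbar m))).
  - exact: (smap_comp partial_coaction_smap (hom_tensor_smap h1)).
  - exact: (smap_mull _ (smap_comp partial_coaction_smap (hom_tensor_smap h2))).
  - by move=> c; rewrite partial_coaction_ext.
split=> //; rewrite -e.
have [[_ _ S1] _ _] := h1; have [[_ _ S2] _ _] := h2.
have [_ _ SL] := leg1_hom (mt3l CGG).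
rewrite -[dbar 1 in LHS]partial_coaction_sa S1 e mstarM -S2 -SL.
by rewrite partial_coaction_sa.
Qed.

Lemma partial_coaction_admissible : admissible CGG (dbar 1).
Proof.
have [d_id [id_D [h1 h2 _ comm]]] := partial_coaction_unit.
split; [exact: partial_coaction_idem|exact: partial_coaction_sa|].
exists id_D, (leg1 (mt3l CGG) (dbar 1)); split=> //.
by apply/mtensorP; rewrite leg2_1 mulr1.
Qed.

Lemma counital_slice_unit (eps : G -> R[i]) (h : multiplier CG -> multiplier C) :
  slice_r eps h -> (forall c, h (d c) = minj c) -> h (dbar 1) = 1.
Proof.
move=> sh hd.
apply: (smap_uniq (F := fun m => h (dbar m)) (G := id)).
- exact: (smap_comp partial_coaction_smap (slice_r_smap sh)).
- exact: smap_id.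
- by move=> c; rewrite partial_coaction_ext.
Qed.

End PartialCoaction.

(** * Comparison of homomorphisms through the universal property *)

Section BernoulliUniversality.
Context {R : realType} {G : cstarBialgebra R} (mG : matrix_sum G).
Context {B : cstarAlgebra R} {BG : mintensor B G} {BGG : mintensor3 BG (bi_sq G)}.
Context {p : multiplier BG} (hp : universal_admissible BGG p).
Context {delta : B -> multiplier BG} (hdelta : bernoulli_coaction BGG p delta).
Context {C : cstarAlgebra R} {CG : mintensor C G} {CGG : mintensor3 CG (bi_sq G)}.
Context {d : C -> multiplier CG} {dbar : multiplier C -> multiplier CG}.
Hypothesis dP : partial_coaction CGG d dbar.
Context {rho0 : B -> multiplier C} {h0 : multiplier BG -> multiplier CG}.
Hypothesis rho0_unital : unital_hom rho0.
Hypothesis h0_hom : hom_tensor rho0 minj h0.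
Hypothesis h0_p : h0 p = dbar 1.

(** In these notations [h0] is rho (x) id and [s1] is sigma. *)
Let q := dbar 1.
Let k := leg1 (mt3l CGG) q.
Let s1 b := h0 (delta b).

Let qq : q * q = q. Proof. exact: partial_coaction_idem dP. Qed.
Let qS : mstar q = q. Proof. exact: partial_coaction_sa dP. Qed.

Let B_unit : exists e : B, is_unit_elt e.
Proof. by have [] := hp. Qed.

Let rho0_star : star_hom rho0. Proof. by have [] := rho0_unital. Qed.

Let rho0_nd : Defs.nondegenerate rho0.
Proof.
have [e he] := B_unit; have [_ /(_ e he) p1] := rho0_unital.
exact: unital_nondegenerate p1.
Qed.

Let h0_1 : h0 1 = 1.
Proof.
have [F [_ sF Ff F1]] := nondegenerate_smap rho0_star rho0_nd.
rewrite -[X in h0 X](leg1_1 BG).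
by rewrite (hom_tensor_leg1 h0_hom sF (@smap_id _ _) Ff (fun=> erefl) erefl) F1 leg1_1.
Qed.

Let s1_unital : unital_hom s1.
Proof.
have [[[dl dM dS] d1] _] := hdelta; have [[hl hM hS] _ _] := h0_hom; split.
  split=> [c x y|x y|x]; rewrite /s1.
  - by rewrite dl hl.
  - by rewrite dM hM.
  - by rewrite dS hS.
by move=> e he; rewrite /s1 d1// h0_1.
Qed.

Let s1_nd : Defs.nondegenerate s1.
Proof.
have [e he] := B_unit; have [_ /(_ e he) p1] := s1_unital.
exact: unital_nondegenerate p1.
Qed.

(** [id_D q] is admissible over C (x) G because it is the image of [p] under the amplification [h1]
    of [s1]. The universal property for this projection gives the last clause, the criterion by
    which other homomorphisms are identified with [s1]. *)
Let s1_universal : exists id_D h1 d_id,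
  [/\ hom_tensor (D1 := CG) (D2 := mt3r CGG) minj (@comul R G) id_D,
      hom_tensor (D1 := BG) (D2 := mt3l CGG) s1 minj h1 /\ h1 p = id_D q,
      hom_tensor (D1 := CG) (D2 := mt3l CGG) d minj d_id,
      d_id q = k * id_D q /\ k * id_D q = id_D q * k &
      forall (t : B -> multiplier CG) (ht : multiplier BG -> multiplier (mt3l CGG)),
        unital_hom t -> hom_tensor (D1 := BG) (D2 := mt3l CGG) t minj ht ->
        ht p = id_D q -> forall b, t b = s1 b].
Proof.
have [d_id [id_D [hd hD e comm]]] := partial_coaction_unit dP.
have [S hS] := amplification_exists mG BGG CGG rho0_nd h0_hom.
have [_ [dB [DB [hdB hDB _ dBp]]]] := hdelta.
have [h1 hh1] : exists h1, hom_tensor (D1 := BG) (D2 := mt3l CGG) s1 minj h1.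
  apply: (@hom_tensor_exists _ _ _ _ _ BG (mt3l CGG)) => //.
  - by have [] := s1_unital.
  - exact: star_hom_minj.
  - exact: nondegenerate_minj.
have h1E x : h1 x = S (dB x).
  move: x; apply: (tens_smap_uniq (D := BG)).
  - exact: (hom_tensor_smap hh1).
  - exact: (smap_comp (hom_tensor_smap hdB) (hom_tensor_smap hS)).
  move=> b g; rewrite (hom_tensorE _ _ hh1) (hom_tensorE _ _ hdB).
  have [[_ SM _] _ _] := hS.
  by rewrite SM (amplification_leg1 h0_hom hS) (amplification_leg2 rho0_nd h0_hom hS).
(* (sigma (x) id)(p) = (rho (x) id (x) id)(delta (x) id)(p), where (delta (x) id)(p) = (id (x)
   Delta)(p) and (id (x) Delta) commutes with the amplification of rho. *)
have h1p : h1 p = id_D q.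
  rewrite h1E dBp (amplification_comul rho0_star rho0_nd h0_hom hS p hDB hD).
  by rewrite h0_p.
exists id_D, h1, d_id; split=> // t ht ut hht htp b.
have [_ padm puniv] := hp.
have [t0 [_ uniq]] := puniv CG (mt3l CGG) (id_D q) (fun CAA =>
  ltac:(rewrite -h1p; exact: (admissible_transfer CAA mG (proj1 s1_unital) s1_nd hh1 padm))).
rewrite -(uniq t) ?(uniq s1)//; split=> //.
- by exists h1.
- by exists ht.
Qed.

Let s1_commute b : q * s1 b = s1 b * q.
Proof.
have [id_D [h1 [d_id [hD [hh1 h1p] hd [e comm] univ]]]] := s1_universal.
have [u uE] : exists u, u = q + q - 1 by exists (q + q - 1).
have uu : u * u = 1.
  rewrite uE !(mulrBl, mulrDl, mulrBr, mulrDr) !mul1r !mulr1 qq; zmod.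
have uS : mstar u = u by rewrite uE mstarB mstarD mstar1 qS.
pose t b := u * s1 b * u.
have [[sl sM sS] s1_1] := s1_unital.
have ut : unital_hom t.
  split; last by move=> x hx; rewrite /t s1_1// mulr1.
  split=> [c x y|x y|x]; rewrite /t.
  - by rewrite sl mulrDr mscaleAr mulrDl mscaleAl.
  - by rewrite sM !mulrA -[u * s1 x * u * u]mulrA uu mulr1.
  - by rewrite sS !mstarM uS mulrA.
have [ht hht] : exists ht, hom_tensor (D1 := BG) (D2 := mt3l CGG) t minj ht.
  apply: (@hom_tensor_exists _ _ _ _ _ BG (mt3l CGG)) => //.
  - by have [] := ut.
  - exact: star_hom_minj.
  - have [x hx] := B_unit; have [_ /(_ x hx) p1] := ut.
    exact: unital_nondegenerate p1.
  - exact: nondegenerate_minj.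
have htE x : ht x = leg1 (mt3l CGG) u * h1 x * leg1 (mt3l CGG) u.
  move: x; apply: (tens_smap_uniq (D := BG)).
  - exact: (hom_tensor_smap hht).
  - exact: (smap_mulr _ (smap_mull _ (hom_tensor_smap hh1))).
  move=> x g; rewrite (hom_tensorE _ _ hht) (hom_tensorE _ _ hh1) /t !leg1M.
  by rewrite -!mulrA -[leg2 _ _ * _]legC.
have lu : leg1 (mt3l CGG) u = k + k - 1.
  by rewrite uE (lin_B (leg1_linear _)) (lin_D (leg1_linear _)) leg1_1.
have htp : ht p = id_D q.
  have cu : leg1 (mt3l CGG) u * id_D q = id_D q * leg1 (mt3l CGG) u.
    by rewrite lu mulrBl mulrDl mulrBr mulrDr comm mul1r mulr1.
  by rewrite htE h1p cu -mulrA -leg1M uu leg1_1 mulr1.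
have := univ t ht ut hht htp b; rewrite /t => /(congr1 (fun x => x * u)).
rewrite -!mulrA uu mulr1 uE mulrBl mulrDl mulrBr mulrDr mul1r mulr1.
by move=> /(addIr (- s1 b)) /double_inj.
Qed.

Lemma bernoulli_intertwines b : dbar (rho0 b) = q * s1 b.
Proof.
have [id_D [h1 [d_id [hD [hh1 h1p] hd [e comm] univ]]]] := s1_universal.
have dM := partial_coactionM dP; have dS := partial_coaction_star dP.
have sd := partial_coaction_smap dP; have [dl _ _] := sd.
have qd m : q * dbar m = dbar m by rewrite -dM mul1r.
have dq m : dbar m * q = dbar m by rewrite -dM mulr1.
have [r rE] : exists r, r = 1 - q by exists (1 - q).
have rr : r * r = r by rewrite rE mulrBl mul1r mulrBr mulr1 qq; zmod.
have rd m : r * dbar m = 0 by rewrite rE mulrBl mul1r qd subrr.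
have dr m : dbar m * r = 0 by rewrite rE mulrBr mulr1 dq subrr.
(* Commutation with [r] makes [t] multiplicative: moved next to a value of [dbar], [r] annihilates
   it, and the mixed products vanish. *)
have rs x : r * s1 x = s1 x * r.
  by rewrite rE mulrBl mulrBr mul1r mulr1 s1_commute.
have [[sl sM sS] s1_1] := s1_unital; have [[pl pM pS] p1] := rho0_unital.
pose t b := dbar (rho0 b) + r * s1 b.
have ut : unital_hom t.
  split; last first.
    by move=> x hx; rewrite /t s1_1// p1// mulr1 rE -/q; zmod.
  split=> [c x y|x y|x]; rewrite /t.
  - by rewrite pl dl sl mulrDr mscaleAr scalerDr; zmod.
  - rewrite pM dM sM mulrDl !mulrDr.
    rewrite [dbar (rho0 x) * (r * _)]mulrA dr mul0r addr0.
    rewrite [r * s1 x]rs -[s1 x * r * dbar _]mulrA rd mulr0 add0r; congr (_ + _).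
    by rewrite -mulrA [r * (r * _)]mulrA rr !mulrA -rs.
  - by rewrite pS dS mstarD mstarM -sS rs rE mstarB mstar1 qS.
have [ht hht] : exists ht, hom_tensor (D1 := BG) (D2 := mt3l CGG) t minj ht.
  apply: (@hom_tensor_exists _ _ _ _ _ BG (mt3l CGG)) => //.
  - by have [] := ut.
  - exact: star_hom_minj.
  - have [x hx] := B_unit; have [_ /(_ x hx) px] := ut.
    exact: unital_nondegenerate px.
  - exact: nondegenerate_minj.
have htE x : ht x = d_id (h0 x) + (1 - k) * h1 x.
  move: x; apply: (tens_smap_uniq (D := BG)).
  - exact: (hom_tensor_smap hht).
  - apply: smap_add; first exact: (smap_comp (hom_tensor_smap h0_hom) (hom_tensor_smap hd)).
    exact: (smap_mull _ (hom_tensor_smap hh1)).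
  move=> x g; rewrite (hom_tensorE _ _ hht) (hom_tensorE _ _ hh1) (hom_tensorE _ _ h0_hom).
  rewrite (hom_tensor_legs hd sd (@smap_id _ _) (partial_coaction_ext dP) (fun=> erefl)).
  rewrite /t (lin_D (leg1_linear _)) leg1M rE (lin_B (leg1_linear _)) leg1_1.
  by rewrite mulrDl mulrA.
have htp : ht p = id_D q.
  by rewrite htE h1p h0_p -/q e mulrBl mul1r; zmod.
have := univ t ht ut hht htp b; rewrite /t rE mulrBl mul1r.
by move=> /(canRL (addrK _)) ->; zmod.
Qed.

(** Slicing the last leg of (sigma (x) id)(p) = (id (x) Delta)(q) with the counit gives sigma(p_eps)
    on the left and q on the right. *)
Lemma bernoulli_slice (eps : G -> R[i]) (pe : B) (hB : multiplier BG -> multiplier B) :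
  is_counit eps -> slice_r eps hB -> hB p = minj pe -> s1 pe = q.
Proof.
move=> ceps sB hBp.
have [id_D [h1 [d_id [hD [hh1 h1p] _ _ _]]]] := s1_universal.
have [hZ sZ] : exists hZ : multiplier (mt3l CGG) -> multiplier CG, slice_r eps hZ.
  by apply: slice_r_exists => //; have [] := ceps.
rewrite -(slice_r_hom (proj1 s1_unital) s1_nd hh1 sB sZ hBp) h1p.
exact: (slice_comul _ ceps sZ hD).
Qed.

End BernoulliUniversality.

Theorem proposition7p10 (R : realType) (G : discreteQuantumGroup R)
  (eps : G -> R[i]) (heps : is_counit eps)
  (B : cstarAlgebra R) (BG : mintensor B G) (BGG : mintensor3 BG (bi_sq G))
  (p : multiplier BG) (hp : universal_admissible BGG p)
  (delta : B -> multiplier BG) (hdelta : bernoulli_coaction BGG p delta)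
  (pe : B) (hpe : exists h, slice_r eps h /\ h p = minj pe)
  (Be : cstarAlgebra R) (inc : Be -> B) (hinc : is_corner pe inc)
  (BeG : mintensor Be G) (ppe : multiplier BeG) (deltae : Be -> multiplier BeG)
  (hdeltae : partial_bernoulli p delta pe inc ppe deltae)
  (C : cstarAlgebra R) (CG : mintensor C G) (CGG : mintensor3 CG (bi_sq G))
  (deltaC : C -> multiplier CG) (deltaCbar : multiplier C -> multiplier CG)
  (hdeltaC : partial_coaction CGG deltaC deltaCbar)
  (hcounital : counital eps deltaC) :
  exists pi : Be -> multiplier C,
    unique (fun pi' => unital_hom pi' /\ leg1_maps pi' ppe (deltaCbar 1)) pi /\
    strong_morphism deltae deltaCbar pi.
Proof.
have mG := discrete_matrix_sum G.
have [hB [sB hBp]] := hpe.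
have [[e he] padm puniv] := hp.
have pe_idem : pe ** pe = pe.
  have [[_ hM _] _ _] := sB; have [pp _ _] := padm.
  by apply: minj_inj; rewrite minjM -hBp -hM pp.
have pe_star : star pe = pe.
  have [[_ _ hS] _ _] := sB; have [_ ps _] := padm.
  by apply: minj_inj; rewrite -mstar_minj -hBp -hS ps.
have incP := corner_pel hinc pe_idem.
have incC := corner_central hinc pe_idem pe_star.
have incM := cornerM hinc; have incS := corner_star hinc.
have [_ incJ _] := hinc.
(* The universal property asks for admissibility in every model of the triple tensor product; it is
   moved there from [CGG] along the identity of [C]. *)
have qadm (CAA : mintensor3 CG (bi_sq G)) : admissible CAA (deltaCbar 1).
  have adm := partial_coaction_admissible hdeltaC.
  exact: (admissible_transfer CAA mG (@star_hom_minj _ _) (@nondegenerate_minj _ _)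
    (@hom_tensor_id _ _ _ CG) adm).
have [rho [[rho_unital [h0 [h0_hom h0_p]]] rho_uniq]] := puniv C CG _ qadm.
have [rho_star rho1] := rho_unital; have rhoe := rho1 e he.
have rho_nd := unital_nondegenerate rhoe.
have [rl rM rS] := rho_star.
have rho_pe : rho pe = 1.
  have [hC [sC hCd]] := hcounital.
  rewrite -(slice_r_hom rho_star rho_nd h0_hom sB sC hBp) h0_p.
  exact: (counital_slice_unit hdeltaC sC hCd).
have [J [pe1 [J_hom /mtensorP epe1 JP Jde]]] := hdeltae.
rewrite leg2_1 mulr1 in epe1.
pose pi b := rho (inc b).
(* The preimage of [pe] under [inc] is the unit of [Be]. *)
have [pe' epe'] := corner_lift hinc e.
have pe'P : inc pe' = pe by rewrite epe'; have [_ ->] := he pe.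
have pe'_unit : is_unit_elt pe'.
  by move=> a; split; apply: incJ; rewrite incM pe'P ?incP// -incC incP.
have unit_uniq x : is_unit_elt x -> x = pe'.
  by move=> hx; have [<- _] := hx pe'; have [_ ->] := pe'_unit x.
have pi_star : star_hom pi.
  split=> [c x y|x y|x]; rewrite /pi.
  - by rewrite (corner_linear hinc) rl.
  - by rewrite incM rM.
  - by rewrite incS rS.
have pi_pe' : pi pe' = 1 by rewrite /pi pe'P.
have pi_unital : unital_hom pi.
  by split=> // x /unit_uniq ->.
have [h h_hom] : exists h : multiplier BeG -> multiplier CG, hom_tensor pi minj h.
  apply: (@hom_tensor_exists _ _ _ _ _ BeG CG) => //; first exact: star_hom_minj.
    exact: unital_nondegenerate pi_pe'.
  exact: nondegenerate_minj.
have J_tens b g : J (minj (tens BeG b g)) = minj (tens BG (inc b) g).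
  by rewrite (hom_tensorE _ _ J_hom) -minj_tens.
have hE x : h x = h0 (J x).
  (* As [pi] is [rho] after [inc], its amplification factors through [J]. *)
  move: x; apply: (tens_smap_uniq (D := BeG)).
  - exact: (hom_tensor_smap h_hom).
  - exact: (smap_comp (hom_tensor_smap J_hom) (hom_tensor_smap h0_hom)).
  by move=> b g; rewrite J_tens (hom_tensorE _ _ h_hom) (hom_tensorE _ _ h0_hom).
have [[_ h0M _] _ _] := h0_hom.
have [F [_ sF Ff F1]] := nondegenerate_smap rho_star rho_nd.
have h0_pe1 : h0 pe1 = 1.
  rewrite epe1 (hom_tensor_leg1 h0_hom sF (@smap_id _ _) Ff (fun=> erefl) erefl).
  by rewrite Ff rho_pe leg1_1.
have h_ppe : h ppe = deltaCbar 1 by rewrite hE JP h0M h0_p h0_pe1 mulr1.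
exists pi; split; last first.
  split; first exact: unital_star_hom_strict pe'_unit pi_star.
  exists h; split=> // b.
  rewrite hE Jde h0M h0_pe1 mulr1 /pi.
  (* For [x] in the corner, deltaC(rho(x)) = q sigma(x) = sigma(p_eps) sigma(x) = sigma(p_eps x) =
     sigma(x). *)
  rewrite (bernoulli_intertwines mG hp hdelta hdeltaC rho_unital h0_hom h0_p).
  rewrite -(bernoulli_slice mG hp hdelta hdeltaC rho_unital h0_hom h0_p heps sB hBp).
  have [[[_ dM _] _] _] := hdelta.
  by rewrite -h0M -dM incP.
split; first by split=> //; exists h.
move=> pi' [pi'_unital [h' [h'_hom h'_ppe]]].
have [pi'_star pi'1] := pi'_unital; have [pl pM pS] := pi'_star.
(* Uniqueness: [r] is compression by [pe], a homomorphism because [pe] is central. Composed with it,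
   [pi'] becomes a unital homomorphism on [B], to which the uniqueness of [rho] applies. *)
have [r hr] := choice (corner_lift hinc).
have rinc b : r (inc b) = b by apply: incJ; rewrite hr incP.
have rpe' x : inc (r x) = pe -> r x = pe' by move=> hx; apply: incJ; rewrite hx pe'P.
pose rho' b := pi' (r b).
have rho'_star : star_hom rho'.
  have rD c x y : r (c *: x + y) = c *: r x + r y.
    apply: incJ; rewrite (corner_linear hinc) !hr.
    by rewrite cs_mulDr cs_scaleAr.
  have rMM x y : r (x ** y) = r x ** r y.
    apply: incJ; rewrite incM !hr -cs_mulA [x ** (pe ** y)]cs_mulA -incC.
    by rewrite -[pe ** x ** y]cs_mulA [RHS]cs_mulA pe_idem.
  have rSS x : r (star x) = star (r x).
    by apply: incJ; rewrite incS !hr starM pe_star incC.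
  split=> [c x y|x y|x]; rewrite /rho'.
  - by rewrite rD pl.
  - by rewrite rMM pM.
  - by rewrite rSS pS.
have rho'_pe : rho' pe = 1.
  by rewrite /rho' rpe' ?hr//; exact: pi'1.
have rho'_e : rho' e = 1.
  rewrite /rho' rpe'; first exact: pi'1.
  by rewrite hr; have [_ ->] := he pe.
have rho'_unital : unital_hom rho'.
  split=> // x hx; have -> : x = e by have [<- _] := hx e; have [_ ->] := he x.
  exact: rho'_e.
have rho'_nd := unital_nondegenerate rho'_e.
have [h2 h2_hom] : exists h2 : multiplier BG -> multiplier CG, hom_tensor rho' minj h2.
  apply: (@hom_tensor_exists _ _ _ _ _ BG CG) => //; first exact: star_hom_minj.
  exact: nondegenerate_minj.
have [F' [_ sF' Ff' F'1]] := nondegenerate_smap rho'_star rho'_nd.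
have h2J x : h2 (J x) = h' x.
  move: x; apply: (tens_smap_uniq (D := BeG)).
  - exact: (smap_comp (hom_tensor_smap J_hom) (hom_tensor_smap h2_hom)).
  - exact: (hom_tensor_smap h'_hom).
  move=> b g; rewrite J_tens (hom_tensorE _ _ h2_hom) (hom_tensorE _ _ h'_hom).
  by rewrite /rho' rinc.
have h2_p : h2 p = deltaCbar 1.
  (* [p] and [p * pe1] have the same image under [h2], since [rho'] sends [pe] to 1. *)
  rewrite -h'_ppe -h2J JP; have [[_ -> _] _ _] := h2_hom.
  rewrite epe1 (hom_tensor_leg1 h2_hom sF' (@smap_id _ _) Ff' (fun=> erefl) erefl).
  by rewrite Ff' rho'_pe leg1_1 mulr1.
apply/funext => b; rewrite /pi (rho_uniq rho').
  by rewrite /rho' rinc.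
by split=> //; exists h2.
Qed.
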